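(* For any $\sigma_0$ with $1<\sigma_0<\sigma_b$ and any sufficiently small $\delta>0$ (i.e. for all $0<\delta<\delta_0$ with some $\delta_0>0$ depending on $\sigma_0$), we have $$\liminf_{T\to\infty}\frac1T N(\sigma_0-\delta,\sigma_0+\delta,T)>0.$$
   Context: The Euler double zeta-function is $\zeta_2(s_1,s_2)=\sum_{n_1=1}^{\infty}\sum_{n_2=1}^{\infty}\frac{1}{n_1^{s_1}(n_1+n_2)^{s_2}}$, absolutely convergent for $\operatorname{Re}(s_1+s_2)>2$, $\operatorname{Re} s_2>1$, and continued meromorphically to $\mathbb{C}^2$. The function $\zeta_2(s,s)$ of one complex variable $s$ is obtained by putting $s_1=s_2=s$; it is the meromorphic function on $\mathbb{C}$ satisfying $\zeta_2(s,s)=\frac12\left(\zeta(s)^2-\zeta(2s)\right)$, where $\zeta$ is the Riemann zeta-function. $N(\sigma_1,\sigma_2,T)$ denotes the number of zeros of $\zeta_2(s,s)$ in the region $\{s \mid \sigma_1<\operatorname{Re} s<\sigma_2,\ 0\le\operatorname{Im} s\le T\}$. Let $p_n$ denote the $n$-th prime. For $\sigma>1$ put $\theta_n=\theta_n(\sigma)=\arg\frac{1+i/p_n^{\sigma}}{1-i/p_n^{\sigma}}=2\arctan(p_n^{-\sigma})$ $(n\ge 1)$ and $g(\sigma)=\theta_1-\sum_{n\ge 2}\theta_n$. The number $\sigma_b=1.8018642\cdots$ is the unique zero of $g$ in $(1,\infty)$. *)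

(* Defs.v *)
From HB Require Import structures.
From mathcomp Require Import all_boot all_order all_algebra.
From mathcomp Require Import complex.
From mathcomp Require Import all_classical all_reals all_analysis.

Set Implicit Arguments.
Unset Strict Implicit.
Unset Printing Implicit Defensive.

Import Order.TTheory GRing.Theory Num.Theory.
Import numFieldNormedType.Exports.

Local Open Scope classical_set_scope.
Local Open Scope ring_scope.

(* The complex numbers; the alias ^o makes them a normed space over themselves,
   so that [derivable] and [derive1n] below are complex differentiation. *)
Notation Cplx R := ((complex R)^o).

Definition cexp (R : realType) (z : Cplx R) : Cplx R :=
  (expR (complex.Re z) * cos (complex.Im z)
    +i* (expR (complex.Re z) * sin (complex.Im z)))%C.

(* x ^ s for real x > 0, with the real logarithm of x *)
Definition cpow (R : realType) (x : R) (s : Cplx R) : Cplx R :=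
  cexp (s * ((ln x)%:C)%C).

(* The iterated limit is the sum of the double series in its domain of absolute
   convergence, Re (s1 + s2) > 2 and Re s2 > 1; elsewhere it is meaningless.
   Indices are shifted: n1 = m.+1 and n2 = n.+1. *)
Definition zeta2_series (R : realType) (s1 s2 : Cplx R) : Cplx R :=
  limn (series (fun m : nat =>
    limn (series (fun n : nat =>
      (cpow m.+1%:R s1 * cpow (m.+1 + n.+1)%N%:R s2)^-1 : Cplx R)) : Cplx R)).

Definition holomorphic_at (R : realType) (f : Cplx R -> Cplx R) (z : Cplx R)
    : Prop :=
  \forall w \near z, derivable f w 1.

Definition pole (R : realType) (f : Cplx R -> Cplx R) (z : Cplx R) : Prop :=
  exists (k : nat) (h : Cplx R -> Cplx R),
    [/\ holomorphic_at h z, h z != 0 &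
        \forall w \near z^', f w = h w / (w - z) ^+ k.+1].

(* A meromorphic function is a total function here; its values at its poles are
   irrelevant, and it takes the continuous value at every other point. *)
Definition meromorphic (R : realType) (f : Cplx R -> Cplx R) : Prop :=
  forall z : Cplx R, holomorphic_at f z \/ pole f z.

(* f is the one-variable function s |-> zeta_2(s, s) on the whole plane. By the
   identity theorem this determines f away from its poles. *)
Definition is_zeta2_diag (R : realType) (f : Cplx R -> Cplx R) : Prop :=
  meromorphic f /\
  forall s : Cplx R, 1 < complex.Re s -> f s = zeta2_series s s.

(* The least m such that the m-th derivative of f does not vanish at z *)
Definition zero_order (R : realType) (f : Cplx R -> Cplx R) (z : Cplx R)
    : \bar R :=
  ereal_sup [set (m%:R)%:E | m in
    [set m : nat | forall k : nat, (k < m)%N -> derive1n k f z = 0]].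

(* Zeros are counted with multiplicity. *)
Definition zero_count (R : realType) (f : Cplx R -> Cplx R)
    (sigma1 sigma2 T : R) : \bar R :=
  esum [set s : Cplx R | [/\ holomorphic_at f s, f s = 0,
          sigma1 < complex.Re s < sigma2 & 0 <= complex.Im s <= T]]
       (zero_order f).

Lemma ex_prime_gt (m : nat) : exists p : nat, (m < p)%N && prime p.
Proof. by have [p ltmp pr_p] := prime_above m; exists p; rewrite ltmp. Qed.

Definition next_prime (m : nat) : nat := ex_minn (ex_prime_gt m).

(* nth_prime 1 = 2, nth_prime 2 = 3, and so on *)
Definition nth_prime (n : nat) : nat := iter n next_prime 0%N.

(* 2 arctan x is the argument of (1 + i x) / (1 - i x). *)
Definition theta (R : realType) (sigma : R) (n : nat) : R :=
  2 * atan ((nth_prime n)%:R `^ (- sigma)).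

Definition g_theta (R : realType) (sigma : R) : R :=
  theta sigma 1 - limn (fun N : nat => \sum_(2 <= n < N) theta sigma n : R).

(* Main.v *)
Require Import Defs.
From HB Require Import structures.
From mathcomp Require Import all_boot all_order all_algebra.
From mathcomp Require Import complex.
From mathcomp Require Import all_classical all_reals all_analysis.
From mathcomp Require Import ring lra zify.

Set Implicit Arguments.
Unset Strict Implicit.
Unset Printing Implicit Defensive.

Import Order.TTheory GRing.Theory Num.Theory.
Import numFieldNormedType.Exports.

Local Open Scope classical_set_scope.
Local Open Scope ring_scope.

(** For Re s > 1 the function zeta_2(s, s) is (zeta(s)^2 - zeta(2s)) / 2.  Fix a
    completely multiplicative a with |a(n)| = 1 and replace n^-s by a(n) n^-s:
    with Z(s) the sum of a(n) n^-s and Z2(s) the sum of a(n)^2 n^-s, the twisted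
    function is (Z(s)^2 - Z2(2s)) / 2.  A vertical translation by t is the twist
    by n^-it.  By Kronecker's theorem every twist is approximated, on any finite
    set of integers, by the translations t = k D for a positive proportion of
    the integers k; this holds with a quantitative density because the
    frequencies log p are independent ([kronecker_density],
    [twists_approximate]).  So if some twisted function has a simple zero at
    sigma0, each good k gives a zero of zeta_2(s, s) close to sigma0 + i k D
    ([zero_persists]), and these zeros are distinct because D >= 1.  Simplicity
    makes Newton's iteration converge, so that the zeros are produced by a
    contraction and only Lipschitz estimates for Dirichlet series are used.

    It remains to find the twist ([balanced_character]).  By the Euler product,
    Z(s)^2 / Z2(2s) is the product of (1 + z_p) / (1 - z_p) with
    z_p = a(p) p^-s, so this product has to be 1 at sigma0.  The factor of p is
    exp (i theta_p) or exp (- i theta_p) when a(p) is i or -i.  Start with i at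
    the prime 2 and -i at all other primes: the total angle is g(sigma0), which
    is negative, since theta_p / theta_2 decreases with sigma and g vanishes at
    sigma_b ([theta_ratio], [first_angle_lt]).  Change -i into i at the primes
    3, 5, ... successively until the total angle becomes positive, at the prime
    p_n say.  On the last step turn a(p_n) continuously from -i to i through
    the right half of the circle, while a(2) moves so that the moduli of the two
    factors stay inverse to each other; by the intermediate value theorem the
    total angle vanishes on the way ([balance_two]).

    The derivative at the zero is a non-zero multiple of the sum of
    log p z_p / (1 - z_p^2) ([critical_point]).  If the zero is strictly inside
    the path, the terms of 2 and p_n are the only ones with a real part, and
    these do not cancel ([phase_choice_generic]).  If it is at the beginning of
    the path, every a(p) is i or -i and the sum is purely imaginary; it is
    non-zero because the ratio of log p p^-s / (1 + p^-2s) to theta_p increases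
    with p ([phase_choice_degenerate]). *)

(** * Modulus and limits of complex numbers *)

Notation cabs z := (ComplexField.Normc.normc z).

Section ComplexModulus.
Variable R : realType.
Local Notation C := (Cplx R).
Implicit Types (x y z : C) (u v : nat -> C).

Lemma normCE z : `|z| = (cabs z)%:C%C :> C.
Proof. by []. Qed.

Lemma cabs_ge0 z : 0 <= cabs z.
Proof. by case: z => a b; rewrite /= sqrtr_ge0. Qed.

Lemma cabs0 : cabs (0 : C) = 0.
Proof. exact: ComplexField.Normc.normc0. Qed.

Lemma cabs1 : cabs (1 : C) = 1.
Proof. exact: ComplexField.Normc.normc1. Qed.

Lemma cabsM x y : cabs (x * y) = cabs x * cabs y.
Proof. exact: ComplexField.Normc.normcM. Qed.

Lemma cabsV x : cabs x^-1 = (cabs x)^-1.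
Proof. exact: ComplexField.Normc.normcV. Qed.

Lemma cabs_eq0 x : (cabs x == 0) = (x == 0).
Proof.
apply/eqP/eqP => [/ComplexField.Normc.eq0_normc //|->]; exact: cabs0.
Qed.

Lemma cabs_gt0 x : (0 < cabs x) = (x != 0).
Proof. by rewrite lt_def cabs_ge0 andbT cabs_eq0. Qed.

Lemma cabsX x n : cabs (x ^+ n) = cabs x ^+ n.
Proof. by elim: n => [|n IHn]; rewrite ?cabs1 // !exprS cabsM IHn. Qed.

Lemma cabsN x : cabs (- x) = cabs x.
Proof. by case: x => a b /=; rewrite !sqrrN. Qed.

Lemma cabsB x y : cabs (x - y) = cabs (y - x).
Proof. by rewrite -cabsN opprB. Qed.

Lemma cabsD x y : cabs (x + y) <= cabs x + cabs y.
Proof. by have := ler_normD x y; rewrite !normCE -rmorphD /= lecR. Qed.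

Lemma cabs_dist x y : `|cabs x - cabs y| <= cabs (x - y).
Proof.
rewrite ler_norml; apply/andP; split.
  rewrite lerBrDl lerBlDr cabsB.
  by apply: le_trans (cabsD _ _); rewrite addrC subrK.
by rewrite lerBlDr; apply: le_trans (cabsD _ _); rewrite subrK.
Qed.

Lemma cabs_sum (I : Type) (r : seq I) (P : pred I) (F : I -> C) :
  cabs (\sum_(i <- r | P i) F i) <= \sum_(i <- r | P i) cabs (F i).
Proof.
elim/big_rec2: _ => [|i y x _ h]; first by rewrite cabs0.
by apply: le_trans (cabsD _ _) _; rewrite lerD2l.
Qed.

Lemma cabs_prod (I : Type) (r : seq I) (P : pred I) (F : I -> C) :
  cabs (\prod_(i <- r | P i) F i) = \prod_(i <- r | P i) cabs (F i).
Proof. by apply: (big_morph (fun z : C => cabs z) cabsM cabs1). Qed.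

Lemma cabs_real (a : R) : cabs (a%:C%C : C) = `|a|.
Proof. by rewrite /= expr0n /= addr0 sqrtr_sqr. Qed.

Lemma cabs_natr n : cabs (n%:R : C) = n%:R.
Proof.
have -> : (n%:R : C) = ((n%:R : R)%:C)%C :> C by rewrite rmorph_nat.
by rewrite cabs_real ger0_norm.
Qed.

Lemma cabs_sqr z : cabs z ^+ 2 = complex.Re z ^+ 2 + complex.Im z ^+ 2.
Proof. by case: z => a b /=; rewrite sqr_sqrtr // addr_ge0 // sqr_ge0. Qed.

Lemma cabs_Re z : `|complex.Re z| <= cabs z.
Proof.
rewrite -(@ler_pXn2r _ 2) ?nnegrE ?cabs_ge0 //.
by rewrite real_normK ?num_real // cabs_sqr lerDl sqr_ge0.
Qed.

Lemma cabs_Im z : `|complex.Im z| <= cabs z.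
Proof.
rewrite -(@ler_pXn2r _ 2) ?nnegrE ?cabs_ge0 //.
by rewrite real_normK ?num_real // cabs_sqr lerDr sqr_ge0.
Qed.

Lemma cabs_le_ReIm z : cabs z <= `|complex.Re z| + `|complex.Im z|.
Proof.
rewrite -(@ler_pXn2r _ 2) ?nnegrE ?cabs_ge0 ?addr_ge0 //.
rewrite cabs_sqr sqrrD !real_normK ?num_real // -addrA lerD2l addrC lerDl.
by rewrite mulrn_wge0 // mulr_ge0.
Qed.

Lemma ReD x y : complex.Re (x + y) = complex.Re x + complex.Re y.
Proof. by case: x; case: y. Qed.
Lemma ImD x y : complex.Im (x + y) = complex.Im x + complex.Im y.
Proof. by case: x; case: y. Qed.
Lemma ReN x : complex.Re (- x) = - complex.Re x.
Proof. by case: x. Qed.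
Lemma ImN x : complex.Im (- x) = - complex.Im x.
Proof. by case: x. Qed.
Lemma ReM x y : complex.Re (x * y) =
  complex.Re x * complex.Re y - complex.Im x * complex.Im y.
Proof. by case: x; case: y. Qed.
Lemma ImM x y : complex.Im (x * y) =
  complex.Re x * complex.Im y + complex.Im x * complex.Re y.
Proof. by case: x; case: y. Qed.
Lemma Re_sum (I : Type) (r : seq I) (P : pred I) (F : I -> C) :
  complex.Re (\sum_(i <- r | P i) F i) = \sum_(i <- r | P i) complex.Re (F i).
Proof. by apply: (big_morph (fun z : C => complex.Re z) ReD). Qed.
Lemma Im_sum (I : Type) (r : seq I) (P : pred I) (F : I -> C) :
  complex.Im (\sum_(i <- r | P i) F i) = \sum_(i <- r | P i) complex.Im (F i).
Proof. by apply: (big_morph (fun z : C => complex.Im z) ImD). Qed.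
Lemma complex_eqP x y :
  complex.Re x = complex.Re y -> complex.Im x = complex.Im y -> x = y.
Proof. by case: x => a b; case: y => c d /= -> ->. Qed.

(** The norm of the complex numbers is complex-valued in the topology, so this turns
    complex limits into real ones, for which squeezing and ordering are available. *)
Lemma cvg_cabsP u (l : C) :
  (u @ \oo --> l) <-> ((fun n => cabs (u n - l)) @ \oo --> (0 : R)).
Proof.
split => [/cvgrPdist_lt h|/cvgrPdist_lt h].
  apply/cvgrPdist_lt => e e0.
  have [|N _ hN] := h (e%:C%C); first by rewrite ltcR.
  exists N => // n /hN; rewrite normCE /= ltcR cabsB.
  by rewrite sub0r normrN ger0_norm // cabs_ge0.
apply/cvgrPdist_lt => e e0.
have e0' : 0 < complex.Re e by move: e0; rewrite ltcE => /andP[].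
have ee : e = ((complex.Re e)%:C)%C.
  by move: e0; rewrite ltcE; case: e {e0'} => a b /= /andP[/eqP -> _].
have [N _ hN] := h _ e0'; exists N => // n /hN.
rewrite ee normCE /= ltcR -[X in _ -> X < _]cabsB.
by rewrite sub0r normrN ger0_norm // cabs_ge0.
Qed.

Lemma cvgC_unique u (l l' : C) : u @ \oo --> l -> u @ \oo --> l' -> l = l'.
Proof. by move=> h h'; rewrite -(cvg_lim _ h) // -(cvg_lim _ h'). Qed.

Lemma cvg_cabs u (l : C) :
  u @ \oo --> l -> (fun n => cabs (u n)) @ \oo --> (cabs l : R).
Proof.
move=> /cvg_cabsP ul; apply/cvgrPdist_le => e e0.
move/cvgrPdist_le: ul => /(_ _ e0) [N _ hN]; exists N => // n /hN.
rewrite sub0r normrN ger0_norm ?cabs_ge0 // => h.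
by apply: le_trans (cabs_dist _ _) _; rewrite cabsB.
Qed.

Lemma cvg_Re u (l : C) : u @ \oo --> l ->
  (fun n => complex.Re (u n)) @ \oo --> (complex.Re l : R).
Proof.
move=> /cvg_cabsP ul; apply/cvgrPdist_le => e e0.
move/cvgrPdist_le: ul => /(_ _ e0) [N _ hN]; exists N => // n /hN.
rewrite sub0r normrN ger0_norm ?cabs_ge0 // => h.
by apply: le_trans h; rewrite distrC -ReN -ReD; exact: cabs_Re.
Qed.

Lemma cvg_Im u (l : C) : u @ \oo --> l ->
  (fun n => complex.Im (u n)) @ \oo --> (complex.Im l : R).
Proof.
move=> /cvg_cabsP ul; apply/cvgrPdist_le => e e0.
move/cvgrPdist_le: ul => /(_ _ e0) [N _ hN]; exists N => // n /hN.
rewrite sub0r normrN ger0_norm ?cabs_ge0 // => h.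
by apply: le_trans h; rewrite distrC -ImN -ImD; exact: cabs_Im.
Qed.

Lemma cvg_ReIm u (l : C) :
  (fun n => complex.Re (u n)) @ \oo --> (complex.Re l : R) ->
  (fun n => complex.Im (u n)) @ \oo --> (complex.Im l : R) ->
  u @ \oo --> l.
Proof.
move=> hr hi; apply/cvg_cabsP.
have hr0 : (fun n => `|complex.Re (u n) - complex.Re l|) @ \oo --> (0 : R).
  by rewrite -(normr0 R); apply: cvg_norm; apply/subr_cvg0.
have hi0 : (fun n => `|complex.Im (u n) - complex.Im l|) @ \oo --> (0 : R).
  by rewrite -(normr0 R); apply: cvg_norm; apply/subr_cvg0.
apply: (@squeeze_cvgr _ _ _ _ (cst 0) (fun n => `|complex.Re (u n) - complex.Re l|
  + `|complex.Im (u n) - complex.Im l|)).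
- apply: nearW => n; rewrite /= cabs_ge0 /=.
  by rewrite -ReN -ImN -ReD -ImD; exact: cabs_le_ReIm.
- exact: cvg_cst.
- by rewrite -[X in _ --> X](addr0 (0 : R)); exact: cvgD.
Qed.

(** Reduces to the real and imaginary parts, which converge absolutely. *)
Lemma abs_cvg_series u (b : nat -> R) :
  (forall n, cabs (u n) <= b n) -> cvgn (series b) -> cvgn (series u).
Proof.
move=> ub cb.
have b0 n : 0 <= b n by apply: le_trans (ub n); exact: cabs_ge0.
have cr : cvgn (series (fun n => complex.Re (u n))).
  apply: normed_cvg; apply: (series_le_cvg _ b0 _ cb) => n /=.
    exact: normr_ge0.
  by apply: le_trans (ub n); exact: cabs_Re.
have ci : cvgn (series (fun n => complex.Im (u n))).
  apply: normed_cvg; apply: (series_le_cvg _ b0 _ cb) => n /=.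
    exact: normr_ge0.
  by apply: le_trans (ub n); exact: cabs_Im.
apply/cvg_ex; exists (Complex (limn (series (fun n => complex.Re (u n))))
   (limn (series (fun n => complex.Im (u n))))).
apply: cvg_ReIm => /=.
  by under eq_fun do rewrite /series /= Re_sum.
by under eq_fun do rewrite /series /= Im_sum.
Qed.

Lemma cabs_lim_le u (l : C) (B : R) :
  u @ \oo --> l -> (forall n, cabs (u n) <= B) -> cabs l <= B.
Proof.
move=> /cvg_cabs ul uB.
have cv : cvgn (fun n => cabs (u n)) by apply/cvg_ex; exists (cabs l).
by rewrite -(cvg_lim _ ul) //; apply: limr_le => //; exact: nearW.
Qed.

Lemma cabs_series_le u (b : nat -> R) (l : C) (B : R) :
  (forall n, cabs (u n) <= b n) -> series b @ \oo --> B ->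
  series u @ \oo --> l -> cabs l <= B.
Proof.
move=> ub cb cu; apply: (cabs_lim_le cu) => n.
apply: le_trans (cabs_sum _ _ _) _.
apply: (@le_trans _ _ (series b n)); first exact: ler_sum.
have nd : nondecreasing_seq (series b).
  apply: nondecreasing_series => m _ _.
  by apply: le_trans (ub m); exact: cabs_ge0.
have cb' : cvgn (series b) by apply/cvg_ex; exists B.
by rewrite -(cvg_lim _ cb) //; exact: nondecreasing_cvgn_le.
Qed.

End ComplexModulus.

(** * Kronecker's theorem with positive density *)

Lemma cvg_bigsum (K : numFieldType) (V : normedModType K) (I : Type)
    (r : seq I) (F : I -> nat -> V) (l : I -> V) :
  (forall i, F i @ \oo --> l i) ->
  (fun n => \sum_(i <- r) F i n) @ \oo --> \sum_(i <- r) l i.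
Proof.
move=> h; elim: r => [|i r IHr].
  by rewrite big_nil; under eq_fun do rewrite big_nil; exact: cvg_cst.
rewrite big_cons; under eq_fun do rewrite big_cons.
exact: cvgD (h i) IHr.
Qed.

Section Kronecker.
Variable R : realType.
Local Notation C := (Cplx R).

Lemma mul_conjc (z : C) : (z * (conjc z : C) : C) = ((cabs z ^+ 2)%:C)%C.
Proof.
rewrite cabs_sqr; case: z => a b; by apply: complex_eqP => /=; ring.
Qed.

Lemma unimodular_conjc (z : C) : cabs z = 1 -> (conjc z : C) = z^-1.
Proof.
move=> z1; have z0 : z != 0 by rewrite -cabs_gt0 z1.
by apply: (mulfI z0); rewrite mul_conjc z1 expr1n divff.
Qed.

Lemma conjcX (z : C) n : (conjc (z ^+ n) : C) = (conjc z : C) ^+ n.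
Proof. exact: (rmorphXn (@conjc R)). Qed.

Lemma conjc_sum (I : Type) (r : seq I) (P : pred I) (F : I -> C) :
  (conjc (\sum_(i <- r | P i) F i) : C) = \sum_(i <- r | P i) (conjc (F i) : C).
Proof. exact: (rmorph_sum (@conjc R)). Qed.

Definition mean (f : nat -> C) (K : nat) : C := K%:R^-1 * \sum_(k < K) f k.

Lemma mean_geometric (v : C) : cabs v = 1 -> v != 1 ->
  mean (fun k => v ^+ k) @ \oo --> (0 : C).
Proof.
move=> v1 vn1; apply/cvg_cabsP.
have d0 : 0 < cabs (v - 1) by rewrite cabs_gt0 subr_eq0.
apply: (@squeeze_cvgr _ _ _ _ (cst 0) (fun n => 2 / cabs (v - 1) * n%:R^-1)).
- apply: nearW => n; rewrite /= cabs_ge0 /= subr0 cabsM cabsV cabs_natr.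
  rewrite mulrC ler_wpM2r ?invr_ge0 // ler_pdivlMr // -cabsM mulrC -subrX1.
  by apply: le_trans (cabsD _ _) _; rewrite cabsN cabs1 cabsX v1 expr1n.
- exact: cvg_cst.
- rewrite -[X in _ --> X](mulr0 (2 / cabs (v - 1))).
  apply: cvgM; first exact: cvg_cst.
  by rewrite -cvg_shiftS; exact: cvg_harmonic.
Qed.

Lemma mean_one (c : C) : mean (fun=> c) @ \oo --> c.
Proof.
apply: cvg_near_cst; near=> K.
rewrite /mean sumr_const card_ord -[c *+ K]mulr_natl mulrA mulVf ?mul1r //.
by rewrite pnatr_eq0 -lt0n; near: K; exact: nbhs_infty_gt.
Unshelve. all: by end_near.
Qed.

(** Orthogonality of distinct characters of the integers: on expanding the square,
    every off-diagonal term is a geometric sum of bounded size. *)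
Lemma mean_square (I : finType) (c u : I -> C) :
  (forall a, cabs (u a) = 1) -> injective u ->
  (fun K => K%:R^-1 * \sum_(k < K) cabs (\sum_a c a * u a ^+ k) ^+ 2) @ \oo
    --> (\sum_a cabs (c a) ^+ 2 : R).
Proof.
move=> u1 uI.
have E K : ((K%:R^-1 * \sum_(k < K) cabs (\sum_a c a * u a ^+ k) ^+ 2 : R)%:C)%C =
    \sum_a \sum_b c a * (conjc (c b) : C) * mean (fun k => (u a / u b) ^+ k) K :> C.
  rewrite rmorphM /= fmorphV /= rmorph_nat rmorph_sum /=.
  transitivity (K%:R^-1 * \sum_(k < K) \sum_a \sum_b
      c a * (conjc (c b) : C) * (u a / u b) ^+ k : C).
    congr (_ * _); apply: eq_bigr => k _.
    rewrite -mul_conjc conjc_sum mulr_suml; apply: eq_bigr => a _.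
    rewrite mulr_sumr; apply: eq_bigr => b _.
    rewrite (rmorphM (@conjc R)) /= conjcX (unimodular_conjc (u1 b)).
    by rewrite exprMn; ring.
  rewrite exchange_big mulr_sumr /=; apply: eq_bigr => a _.
  rewrite exchange_big mulr_sumr /=; apply: eq_bigr => b _.
  by rewrite -mulr_sumr /mean; ring.
have L : (fun K => \sum_a \sum_b
    c a * (conjc (c b) : C) * mean (fun k => (u a / u b) ^+ k) K) @ \oo -->
    (\sum_a \sum_b c a * (conjc (c b) : C) * (a == b)%:R : C).
  apply: cvg_bigsum => a; apply: cvg_bigsum => b.
  apply: cvgM; first exact: cvg_cst.
  have [<-|ab] := eqVneq a b.
    rewrite divff; last by rewrite -cabs_gt0 u1.
    have -> : (fun k => 1 ^+ k) = (fun=> 1 : C).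
      by apply/funext => k; rewrite expr1n.
    exact: mean_one.
  apply: mean_geometric; first by rewrite cabsM cabsV !u1 invr1 mulr1.
  apply: contra ab => /eqP /(congr1 (fun z => z * u b)).
  by rewrite mul1r divfK -?cabs_gt0 ?u1 // => /uI ->.
have := cvg_Re L.
under eq_fun do rewrite -E /=.
suff -> : \sum_a \sum_b c a * (conjc (c b) : C) * (a == b)%:R =
   ((\sum_a cabs (c a) ^+ 2 : R)%:C)%C :> C by [].
rewrite rmorph_sum /=; apply: eq_bigr => a _.
rewrite (bigD1 a) //= eqxx mulr1 mul_conjc big1 ?addr0 // => b.
by rewrite eq_sym => /negbTE ->; rewrite mulr0.
Qed.


(** Mean square of ((1 + e u^k) / 2)^m for a unimodular u that is not a root of unity;
    the bound M on the summation index is kept apart from m so that different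
    exponents share one index set. *)
Definition bin_energy (M m : nat) : R :=
  \sum_(a < M.+1) ('C(m, a)%:R / 2 ^+ m) ^+ 2.

Lemma bin_energy0 M : bin_energy M 0 = 1.
Proof.
rewrite /bin_energy big_ord_recl /= bin0 expr0 divr1 expr1n big1 ?addr0 // => i _.
by rewrite bin0n /= mul0r expr0n.
Qed.

(** Cauchy-Schwarz: the M + 1 binomial weights have sum 1. *)
Lemma bin_energy_ge M : (M.+1%:R)^-1 <= bin_energy M M.
Proof.
set x := fun a : 'I_M.+1 => 'C(M, a)%:R / 2 ^+ M : R.
have x1 : \sum_a x a = 1.
  rewrite -mulr_suml -natr_sum.
  have -> : (\sum_(a < M.+1) 'C(M, a) = 2 ^ M)%N.
    by rewrite (Pascal 1 1) //; apply: eq_bigr => i _; rewrite !exp1n !muln1.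
  by rewrite natrX divff // expf_neq0.
have N0 : (M.+1%:R : R) != 0 by rewrite pnatr_eq0.
pose t : R := M.+1%:R^-1.
have le a : 2 * t * x a - t ^+ 2 <= x a ^+ 2.
  by have := sqr_ge0 (x a - t); rewrite sqrrB mulr2n; lra.
apply: (@le_trans _ _ (\sum_a (2 * t * x a - t ^+ 2))); last exact: ler_sum.
rewrite sumrB -mulr_sumr x1 sumr_const card_ord -[t ^+ 2 *+ _]mulr_natl.
by rewrite expr2 mulrA mulfV // mul1r mulr1 -/t; lra.
Qed.

(** By Bernoulli applied to a square root s of q: n s^n is bounded, so n q^n is at
    most a constant times s^n. *)
Lemma natr_mul_exp_small (q : R) (B : R) : 0 <= q -> q < 1 ->
  exists M : nat, B * M.+1%:R * q ^+ M < 1.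
Proof.
move=> q0 q1.
pose u := fun M : nat => M.+1%:R * q ^+ M.
suff /cvgrPdist_lt /(_ (`|B| + 1)^-1) [|N _ /(_ N (leqnn N))] : u @ \oo --> (0 : R).
- by rewrite invr_gt0 ltr_wpDl.
- rewrite sub0r normrN ger0_norm; last by rewrite mulr_ge0 // exprn_ge0.
  rewrite -div1r ltr_pdivlMr ?ltr_wpDl // => h; exists N.
  apply: le_lt_trans h; rewrite -mulrA -/(u N) mulrC.
  rewrite ler_wpM2l //; first by rewrite mulr_ge0 // exprn_ge0.
  by apply: (le_trans (ler_norm B)); rewrite lerDl.
have [qz|qn0] := eqVneq q 0.
  rewrite -cvg_shiftS; apply: cvg_near_cst; apply: nearW => n.
  by rewrite /u /= qz exprS mul0r mulr0.
have {q0 qn0} q0 : 0 < q by rewrite lt_def qn0.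
pose s := Num.sqrt q; have s0 : 0 < s by rewrite sqrtr_gt0.
have s1 : s < 1 by rewrite -sqrtr1 ltr_sqrt.
pose h := s^-1 - 1; have h0 : 0 < h by rewrite subr_gt0 invf_gt1.
have bern n : n.+1%:R * Num.min 1 h <= (s ^- n : R).
  have sE : s^-1 = 1 + h by rewrite /h addrC subrK.
  rewrite -exprVn sE; apply: (@le_trans _ _ (1 + n%:R * h)).
    rewrite -[n.+1]addn1 natrD mulrDl mul1r addrC lerD ?ge_min ?lexx //.
    by rewrite ler_wpM2l // ge_min lexx orbT.
  elim: n => [|n IHn]; first by rewrite mul0r addr0 expr0.
  rewrite exprS; apply: le_trans (ler_wpM2l _ IHn); last by rewrite addr_ge0 // ltW.
  rewrite -natr1; have : 0 <= n%:R * h * h by rewrite !mulr_ge0 // ltW.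
  by lra.
pose m := Num.min 1 h; have m0 : 0 < m by rewrite lt_min ltr01.
apply: (@squeeze_cvgr _ _ _ _ (cst 0) (fun n => m^-1 * s ^+ n)).
- apply: nearW => n; rewrite /u /= mulr_ge0 ?exprn_ge0 ?(ltW q0) //=.
  have -> : q ^+ n = s ^+ n * s ^+ n by rewrite -exprMn -expr2 sqr_sqrtr // ltW.
  rewrite mulrA.
  rewrite ler_wpM2r ?exprn_ge0 ?(ltW s0) // mulrC -ler_pdivlMl ?exprn_gt0 //.
  by rewrite ler_pdivlMr //; exact: bern.
- exact: cvg_cst.
- rewrite -[X in _ --> X](mulr0 m^-1); apply: cvgM; first exact: cvg_cst.
  by apply: cvg_expr; rewrite ger0_norm // ltW.
Qed.

(** Expanding the product gives one monomial for every exponent vector; independence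
    of the u_j makes these monomials pairwise distinct, and [mean_square] applies. *)
Lemma mean_square_prod (J : finType) (e u : J -> C) (M : nat) (m : J -> nat) :
  (forall j, cabs (e j) = 1) -> (forall j, cabs (u j) = 1) ->
  (forall f g : {ffun J -> 'I_M.+1},
     \prod_j u j ^+ f j = \prod_j u j ^+ g j -> f = g) ->
  (forall j, (m j <= M)%N) ->
  (fun K => K%:R^-1 * \sum_(k < K)
     cabs (\prod_j ((1 + e j * u j ^+ k) / 2) ^+ m j) ^+ 2) @ \oo
    --> (\prod_j bin_energy M (m j) : R).
Proof.
move=> e1 u1 uI mM.
pose U (f : {ffun J -> 'I_M.+1}) : C := \prod_j u j ^+ f j.
pose c (f : {ffun J -> 'I_M.+1}) : C :=
  \prod_j ('C(m j, f j)%:R / 2 ^+ m j * e j ^+ f j).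
have U1 f : cabs (U f) = 1.
  by rewrite cabs_prod big1 // => j _; rewrite cabsX u1 expr1n.
have E k : \prod_j ((1 + e j * u j ^+ k) / 2) ^+ m j = \sum_f c f * U f ^+ k.
  transitivity (\prod_j \sum_(a < M.+1)
      'C(m j, a)%:R / 2 ^+ m j * e j ^+ a * (u j ^+ a) ^+ k : C).
    apply: eq_bigr => j _; rewrite expr_div_n exprDn.
    rewrite mulr_suml (big_ord_widen M.+1 (fun a => 1 ^+ (m j - a) *
       (e j * u j ^+ k) ^+ a *+ 'C(m j, a) / 2 ^+ m j)) ?ltnS //.
    rewrite big_mkcond /=; apply: eq_bigr => a _.
    case: ltnP => [_|ha]; last by rewrite bin_small // !mul0r.
    rewrite expr1n mul1r exprMn -!exprM [(k * a)%N]mulnC -mulr_natl; ring.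
  rewrite bigA_distr_bigA /=; apply: eq_bigr => f _.
  by rewrite /c /U -prodrXl -big_split /=.
under eq_fun do under eq_bigr do rewrite E.
suff -> : \prod_j bin_energy M (m j) = \sum_f cabs (c f) ^+ 2.
  exact: mean_square.
rewrite bigA_distr_bigA /=; apply: eq_bigr => f _.
rewrite /c cabs_prod -prodrXl; apply: eq_bigr => j _.
rewrite !cabsM cabsV !cabsX e1 expr1n mulr1 !cabs_natr //.
Qed.

(** The parallelogram law for 1 and e^-1 v. *)
Lemma half_bound (e v : C) (eta : R) : cabs e = 1 -> cabs v = 1 ->
  0 <= eta -> eta <= cabs (v - e) ->
  cabs ((1 + e^-1 * v) / 2) ^+ 2 <= 1 - eta ^+ 2 / 4.
Proof.
move=> e1 v1 eta0 h.
have en0 : e != 0 by rewrite -cabs_gt0 e1.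
pose z := e^-1 * v; have z1 : cabs z = 1 by rewrite cabsM cabsV e1 v1 invr1 mulr1.
have ve : cabs (v - e) = cabs (z - 1).
  have -> : v - e = e * (z - 1) by rewrite /z mulrBr mulrA mulfV // mul1r mulr1.
  by rewrite cabsM e1 mul1r.
rewrite ve in h; have h2 : eta ^+ 2 <= cabs (z - 1) ^+ 2 by rewrite ler_pXn2r ?nnegrE ?cabs_ge0.
rewrite -/z cabsM cabsV cabs_natr exprMn.
have : cabs z ^+ 2 = 1 by rewrite z1 expr1n.
rewrite cabs_sqr in h2; rewrite !cabs_sqr !ReD !ImD !ReN !ImN /= in h2 *.
have -> : 2^-1 ^+ 2 = 4^-1 :> R by rewrite exprVn; congr (_^-1); ring.
lra.
Qed.


Definition close_to (J : finType) (e u : J -> C) (eta : R) (k : nat) : bool :=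
  [forall j, cabs (u j ^+ k - e j) < eta].

(** The product P of ((1 + e_j^-1 u_j^k) / 2)^M is concentrated, for large M, on the
    integers k for which every u_j^k is close to e_j.  Its mean square is A^N, with
    A at least 1 / (M + 1).  The integers at which u_j^k is far from e_j contribute at
    most q^M A^(N-1) with q < 1, and N q^M < A for large M; so the good integers carry a
    positive part of the mean, and since |P| <= 1 they have positive density. *)
Lemma kronecker_density (J : finType) (e u : J -> C) (eta : R) :
  (forall j, cabs (e j) = 1) -> (forall j, cabs (u j) = 1) ->
  (forall f g : J -> nat, \prod_j u j ^+ f j = \prod_j u j ^+ g j -> f =1 g) ->
  0 < eta ->
  exists c : R, 0 < c /\
    \forall K \near \oo, c * K%:R <= (count (close_to e u eta) (iota 0 K))%:R.
Proof.
move=> e1 u1 uI eta0.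
(* makes q below nonnegative *)
wlog eta1 : eta eta0 / eta <= 1.
  move=> wl; have [||c [c0 hc]] := wl (Num.min eta 1).
  - by rewrite lt_min eta0 ltr01.
  - by rewrite ge_min lexx orbT.
  exists c; split=> //; apply: filterS hc => K /le_trans -> //.
  rewrite ler_nat; apply: sub_count => k /forallP h; apply/forallP => j.
  by apply: lt_le_trans (h j) _; rewrite ge_min lexx.
pose q : R := 1 - eta ^+ 2 / 4.
have eta2 : eta ^+ 2 <= 1 by rewrite expr_le1 // ltW.
have eta2' : 0 < eta ^+ 2 by rewrite exprn_gt0.
have q0 : 0 <= q by rewrite /q; lra.
have q1 : q < 1 by rewrite /q; lra.
have [M hM] := natr_mul_exp_small #|J|%:R q0 q1.
pose A := bin_energy M M.
have AM : M.+1%:R^-1 <= A := bin_energy_ge M.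
have A0 : 0 < A by apply: lt_le_trans AM; rewrite invr_gt0 ltr0n.
pose P (m : J -> nat) k : C := \prod_j ((1 + (e j)^-1 * u j ^+ k) / 2) ^+ m j.
pose mP (m : J -> nat) K : R := K%:R^-1 * \sum_(k < K) cabs (P m k) ^+ 2.
have cP m : (forall j, (m j <= M)%N) -> mP m @ \oo --> (\prod_j bin_energy M (m j) : R).
  apply: mean_square_prod => // [j|f g h]; first by rewrite cabsV e1 invr1.
  apply/ffunP => j; apply: val_inj.
  exact: (uI (fun j => val (f j)) (fun j => val (g j)) h j).
pose mall := fun _ : J => M.
(* the exponents of P without the factor of j0 *)
pose mone (j0 j : J) := if j == j0 then 0%N else M.
have half1 j k : cabs ((1 + (e j)^-1 * u j ^+ k) / 2) <= 1.
  rewrite cabsM cabsV cabs_natr ler_pdivrMr // mul1r.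
  apply: le_trans (cabsD _ _) _.
  by rewrite cabs1 cabsM cabsV cabsX e1 u1 expr1n invr1 mulr1.
have P1 m k : cabs (P m k) <= 1.
  rewrite cabs_prod; apply: (@proj2 (0 <= _)); apply/andP.
  apply: (big_ind (fun x : R => 0 <= x <= 1)).
  - by rewrite ler01 lexx.
  - by move=> x y /andP[? ?] /andP[? ?]; rewrite mulr_ge0 //= mulr_ile1.
  - by move=> j _; rewrite cabs_ge0 cabsX exprn_ile1 ?cabs_ge0.
have key k : cabs (P mall k) ^+ 2 <=
    (close_to e u eta k)%:R + q ^+ M * \sum_j cabs (P (mone j) k) ^+ 2.
  have [_|/forallPn [j0]] := boolP (close_to e u eta k).
    rewrite -[X in X <= _]addr0 lerD //; first by rewrite exprn_ile1 ?cabs_ge0.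
    by rewrite mulr_ge0 ?exprn_ge0 // sumr_ge0 // => j _; rewrite exprn_ge0 ?cabs_ge0.
  rewrite -leNgt add0r => hj.
  rewrite (bigD1 j0) //= mulrDr -[X in X <= _]addr0 lerD //; last first.
    rewrite mulr_ge0 ?exprn_ge0 // sumr_ge0 // => j _.
    by rewrite exprn_ge0 ?cabs_ge0.
  rewrite /P (bigD1 j0) //= cabsM exprMn [X in _ <= _ * X ^+ 2]cabs_prod.
  rewrite [X in _ <= _ * X ^+ 2](bigD1 j0) //= /mone eqxx expr0 cabs1 mul1r -cabs_prod.
  rewrite [X in _ <= _ * cabs X ^+ 2](eq_bigr
    (fun j => ((1 + (e j)^-1 * u j ^+ k) / 2) ^+ M)); last first.
    by move=> j /negbTE ->.
  rewrite ler_wpM2r ?exprn_ge0 ?cabs_ge0 // cabsX -exprM mulnC exprM.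
  rewrite lerXn2r ?nnegrE ?exprn_ge0 ?cabs_ge0 //.
  by apply: half_bound hj => //; [rewrite cabsX u1 expr1n | exact: ltW].
pose B K : R := mP mall K - q ^+ M * \sum_j mP (mone j) K.
have BE K : B K * K%:R <= (count (close_to e u eta) (iota 0 K))%:R.
  have [->|K0] := eqVneq K 0%N; first by rewrite mulr0.
  have K0' : (K%:R : R) != 0 by rewrite pnatr_eq0.
  rewrite /B mulrBl {1}/mP mulrAC mulVf // mul1r.
  have -> : (count (close_to e u eta) (iota 0 K))%:R =
      \sum_(k < K) (close_to e u eta k)%:R :> R.
    rewrite -(big_mkord xpredT (fun k => (close_to e u eta k)%:R)) /index_iota subn0.
    rewrite -sum1_count natr_sum big_mkcond /=; apply: eq_bigr => k _.
    by case: ifP.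
  rewrite lerBlDr.
  apply: le_trans (ler_sum _ (fun (k : 'I_K) _ => key k)) _.
  rewrite big_split /= lerD //.
  rewrite -mulr_sumr -mulrA ler_wpM2l ?exprn_ge0 //.
  rewrite exchange_big /= mulr_suml le_eqVlt; apply/orP; left; apply/eqP.
  by apply: eq_bigr => j _; rewrite /mP mulrAC mulVf // mul1r.
pose L : R := A ^+ #|J| * (1 - #|J|%:R * q ^+ M / A).
have cB : B @ \oo --> L.
  have -> : L = \prod_(j : J) bin_energy M (mall j) -
      q ^+ M * \sum_j \prod_j' bin_energy M (mone j j').
    rewrite /L /mall prodr_const -/A.
    rewrite (eq_bigr (fun=> A ^+ #|J| / A)); last first.
      move=> j _; rewrite -(prodr_const _ A) (bigD1 j) //= [in RHS](bigD1 j) //=.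
      rewrite /mone eqxx bin_energy0 mul1r mulrAC divff ?gt_eqF // mul1r.
      by apply: eq_bigr => j' /negbTE ->.
    by rewrite sumr_const -[_ *+ #|J|]mulr_natl; ring.
  apply: cvgB; first exact: cP.
  apply: cvgM; first exact: cvg_cst.
  by apply: cvg_bigsum => j; apply: cP => j'; rewrite /mone; case: ifP.
have L0 : 0 < L.
  rewrite mulr_gt0 ?exprn_gt0 // subr_gt0 ltr_pdivrMr // mul1r.
  apply: lt_le_trans AM; rewrite -div1r ltr_pdivlMr ?ltr0n //.
  by rewrite mulrAC.
exists (L / 2); split; first by rewrite divr_gt0.
have /cvgrPdist_lt /(_ (L / 2)) := cB.
rewrite divr_gt0 // => /(_ isT); apply: filterS => K hK.
apply: le_trans (BE K); rewrite ler_wpM2r //.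
by move: hK; rewrite ltr_norml => /andP[_]; lra.
Qed.

End Kronecker.

(** * Estimates for the exponential *)

Section RealCalculus.
Variable R : realType.

Lemma mean_value (f df : R -> R) (a b : R) :
  (forall x : R, is_derive x 1 f (df x)) -> a <= b ->
  exists2 c, a <= c <= b & f b - f a = df c * (b - a).
Proof.
move=> fd ab; have [//|c cab h] := @MVT_segment R f df a b ab (fun x _ => fd x).
  by apply: derivable_within_continuous => x _; have [] := fd x.
by exists c => //; rewrite in_itv in cab.
Qed.

Lemma norm_mean_value (f df : R -> R) (B y : R) :
  (forall x : R, is_derive x 1 f (df x)) -> (forall x, `|x| <= `|y| -> `|df x| <= B) ->
  `|f y - f 0| <= B * `|y|.
Proof.
move=> fd dB; have [y0|y0] := leP 0 y.
  have [c /andP[c0 cy] ->] := mean_value fd y0.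
  by rewrite subr0 normrM ler_wpM2r // dB // !ger0_norm.
have [c /andP[cy c0] h] := mean_value fd (ltW y0).
rewrite distrC h sub0r normrM normrN ler_wpM2r // dB //.
by rewrite !ler0_norm ?lerN2 // ltW.
Qed.

Lemma norm_sin_le (y : R) : `|sin y| <= `|y|.
Proof.
have := @norm_mean_value sin cos 1 y _ (fun x _ => cos_max x).
by rewrite sin0 subr0 mul1r; apply => x; exact: is_derive_sin.
Qed.

Lemma norm_cosB1_le (y : R) : `|cos y - 1| <= `|y|.
Proof.
have := @norm_mean_value cos (fun x => - sin x) 1 y.
rewrite cos0 mul1r; apply => x.
by rewrite normrN => _; exact: sin_max.
Qed.

Lemma norm_cosB1_le_sqr (y : R) : `|cos y - 1| <= y ^+ 2.
Proof.
have := @norm_mean_value cos (fun x => - sin x) `|y| y.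
rewrite cos0 -expr2 real_normK ?num_real //; apply => x.
by rewrite normrN => h; exact: le_trans (norm_sin_le x) h.
Qed.

Lemma norm_sinB_le_sqr (y : R) : `|sin y - y| <= y ^+ 2.
Proof.
have := @norm_mean_value (fun x => sin x - x) (fun x => cos x - 1) `|y| y.
rewrite sin0 !subr0 -expr2 real_normK ?num_real //; apply => x.
by move=> h; exact: le_trans (norm_cosB1_le x) h.
Qed.

Lemma expRB1_le (x : R) : `|expR x - 1| <= `|x| * expR `|x|.
Proof.
have h1 := expR_ge1Dx x; have h2 := expR_ge1Dx (- x).
have p := expR_gt0 x.
have h3 : expR x - 1 <= x * expR x.
  have : (1 - x) * expR x <= 1.
    by apply: le_trans (ler_wpM2r (ltW p) h2) _; rewrite expRN mulVf ?gt_eqF.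
  by lra.
have [x0|x0] := leP 0 x; first by rewrite (ger0_norm x0) ger0_norm; lra.
have h4 := expR_ge1Dx `|x|.
rewrite ltr0_norm // in h4 *; rewrite ler0_norm.
  have : 1 * (- x) <= expR (- x) * (- x) by rewrite ler_wpM2r; lra.
  by lra.
have : x * expR x <= 0 by rewrite mulr_le0_ge0 // ltW.
by lra.
Qed.

Lemma expRB1B_le (x : R) : `|expR x - 1 - x| <= x ^+ 2 * expR `|x|.
Proof.
have h1 := expR_ge1Dx x; have h2 := expR_ge1Dx (- x).
have p := expR_gt0 x.
have h3 : expR x - 1 <= x * expR x.
  have : (1 - x) * expR x <= 1.
    by apply: le_trans (ler_wpM2r (ltW p) h2) _; rewrite expRN mulVf ?gt_eqF.
  by lra.
have h0 := expRB1_le x.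
rewrite ger0_norm; last by lra.
apply: (@le_trans _ _ (x * (expR x - 1))); first by lra.
apply: (le_trans (ler_norm _)); rewrite normrM.
rewrite -(@real_normK _ x) ?num_real // expr2 -mulrA.
by rewrite ler_wpM2l.
Qed.

End RealCalculus.

Section ComplexExponential.
Variable R : realType.
Local Notation C := (Cplx R).
Implicit Types (x y z : C).

Lemma cexpD x y : cexp (x + y) = cexp x * cexp y.
Proof.
case: x => a b; case: y => c d; apply: complex_eqP.
  by rewrite ReM /= expRD cosD; ring.
by rewrite ImM /= expRD sinD; ring.
Qed.

Lemma cexp0 : cexp (0 : C) = 1.
Proof. by apply: complex_eqP; rewrite /= expR0 ?cos0 ?sin0 ?mulr1 ?mulr0. Qed.

Lemma cabs_cexp z : cabs (cexp z) = expR (complex.Re z).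
Proof.
case: z => a b /=; rewrite !exprMn -mulrDr cos2Dsin2 mulr1 sqrtr_sqr.
by rewrite ger0_norm // expR_ge0.
Qed.

Lemma cexp_neq0 z : cexp z != 0.
Proof. by rewrite -cabs_gt0 cabs_cexp expR_gt0. Qed.

Lemma cexpN z : cexp (- z) = (cexp z)^-1.
Proof.
by apply: (mulfI (cexp_neq0 z)); rewrite -cexpD subrr cexp0 mulfV // cexp_neq0.
Qed.

Lemma cexpX z n : cexp (n%:R * z) = cexp z ^+ n.
Proof.
elim: n => [|n IHn]; first by rewrite mul0r cexp0.
by rewrite -natr1 mulrDl mul1r addrC cexpD IHn exprS.
Qed.

Lemma cexpB1_le z : cabs (cexp z - 1) <= 3 * cabs z * expR (cabs z).
Proof.
apply: le_trans (cabs_le_ReIm _) _.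
have hx := cabs_Re z; have hy := cabs_Im z.
rewrite ReD ImD ReN ImN; case: z hx hy => x y /= hx hy.
set r := Num.sqrt _ in hx hy *.
have r0 : 0 <= r := sqrtr_ge0 _.
have xe : expR x <= expR r by rewrite ler_expR; apply: le_trans hx; exact: ler_norm.
have ae : expR `|x| <= expR r by rewrite ler_expR.
have e0 := expR_gt0 x.
have b1 : `|expR x - 1| <= r * expR r.
  by apply: le_trans (expRB1_le x) _; rewrite ler_pM // expR_ge0.
have b2 : `|expR x * (cos y - 1)| <= r * expR r.
  rewrite normrM (ger0_norm (ltW e0)) mulrC ler_pM ?(ltW e0) //.
  exact: le_trans (norm_cosB1_le y) _.
have b3 : `|expR x * sin y| <= r * expR r.
  rewrite normrM (ger0_norm (ltW e0)) mulrC ler_pM ?(ltW e0) //.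
  exact: le_trans (norm_sin_le y) _.
have -> : expR x * cos y - 1 = (expR x - 1) + expR x * (cos y - 1) by ring.
have := ler_normD (expR x - 1) (expR x * (cos y - 1)).
rewrite subr0; lra.
Qed.

Lemma cexpB1B_le z : cabs (cexp z - 1 - z) <= 4 * cabs z ^+ 2 * expR (cabs z).
Proof.
apply: le_trans (cabs_le_ReIm _) _.
have hx := cabs_Re z; have hy := cabs_Im z.
rewrite !ReD !ImD !ReN !ImN; case: z hx hy => x y /= hx hy.
set r := Num.sqrt _ in hx hy *.
have r0 : 0 <= r := sqrtr_ge0 _.
have xe : expR x <= expR r by rewrite ler_expR; apply: le_trans hx; exact: ler_norm.
have ae : expR `|x| <= expR r by rewrite ler_expR.
have e0 := expR_gt0 x.
have x2 : x ^+ 2 <= r ^+ 2 by rewrite -(@real_normK _ x) ?num_real // lerXn2r ?nnegrE.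
have y2 : y ^+ 2 <= r ^+ 2 by rewrite -(@real_normK _ y) ?num_real // lerXn2r ?nnegrE.
have b1 : `|expR x - 1 - x| <= r ^+ 2 * expR r.
  by apply: le_trans (expRB1B_le x) _; rewrite ler_pM // ?sqr_ge0 ?expR_ge0.
have b2 : `|expR x * (cos y - 1)| <= r ^+ 2 * expR r.
  rewrite normrM (ger0_norm (ltW e0)) mulrC ler_pM ?(ltW e0) //.
  exact: le_trans (norm_cosB1_le_sqr y) _.
have b3 : `|expR x * (sin y - y)| <= r ^+ 2 * expR r.
  rewrite normrM (ger0_norm (ltW e0)) mulrC ler_pM ?(ltW e0) //.
  exact: le_trans (norm_sinB_le_sqr y) _.
have b4 : `|(expR x - 1) * y| <= r ^+ 2 * expR r.
  rewrite normrM expr2 mulrAC ler_pM //.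
  by apply: le_trans (expRB1_le x) _; rewrite ler_pM // expR_ge0.
have -> : expR x * cos y - 1 - x = (expR x - 1 - x) + expR x * (cos y - 1) by ring.
have -> : expR x * sin y - 0 - y = expR x * (sin y - y) + (expR x - 1) * y by ring.
have := ler_normD (expR x - 1 - x) (expR x * (cos y - 1)).
have := ler_normD (expR x * (sin y - y)) ((expR x - 1) * y).
lra.
Qed.

(** The function exp z - z is Lipschitz near 0 with a constant proportional to the
    radius: the form in which the second-order Taylor bound enters Newton's method. *)
Lemma cexp_chord_le (u v : C) (m : R) : cabs u <= m -> cabs v <= m ->
  cabs (cexp u - cexp v - (u - v)) <= 11 * m * expR (3 * m) * cabs (u - v).
Proof.
move=> um vm.
have m0 : 0 <= m by apply: le_trans vm; exact: cabs_ge0.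
have duv : cabs (u - v) <= 2 * m.
  by apply: le_trans (cabsD _ _) _; rewrite cabsN; lra.
have d0 := cabs_ge0 (u - v).
have -> : cexp u - cexp v - (u - v) =
    cexp v * (cexp (u - v) - 1 - (u - v)) + (cexp v - 1) * (u - v).
  have -> : cexp u = cexp (u - v) * cexp v by rewrite -cexpD subrK.
  by move: (cexp (u - v)) (cexp v) => e1 e2; ring.
apply: le_trans (cabsD _ _) _; rewrite !cabsM.
have b1 : cabs (cexp v) <= expR m.
  rewrite cabs_cexp ler_expR; apply: le_trans vm.
  by apply: le_trans (cabs_Re v); exact: ler_norm.
have E3 : expR (3 * m) = expR m * expR (2 * m) by rewrite -expRD; congr expR; ring.
have b2 : cabs (cexp (u - v) - 1 - (u - v)) <= 8 * m * expR (2 * m) * cabs (u - v).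
  apply: le_trans (cexpB1B_le _) _.
  have : cabs (u - v) * expR (cabs (u - v)) <= 2 * m * expR (2 * m).
    by rewrite ler_pM // ?expR_ge0 // ler_expR.
  move=> /(ler_wpM2r d0); rewrite expr2; lra.
have b3 : cabs (cexp v - 1) <= 3 * m * expR (3 * m).
  apply: le_trans (cexpB1_le _) _; rewrite ler_pM // ?expR_ge0 //.
  - by rewrite mulr_ge0 // cabs_ge0.
  - by rewrite ler_wpM2l.
  - by rewrite ler_expR; lra.
have := ler_pM (cabs_ge0 _) (cabs_ge0 _) b1 b2.
have := ler_wpM2r d0 b3.
by rewrite E3; lra.
Qed.

End ComplexExponential.

(** * Dirichlet series with bounded coefficients *)

Section Majorants.
Variable R : realType.

Lemma powR_natE (n : nat) (x : R) : (0 < n)%N -> n%:R `^ x = expR (x * ln n%:R).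
Proof. by move=> n0; rewrite /powR pnatr_eq0 eqn0Ngt n0. Qed.

Lemma ln_nat_ge0 (n : nat) : 0 <= ln (n%:R : R).
Proof.
case: n => [|n]; first by rewrite ln0.
by rewrite ln_ge0 // ler1n.
Qed.

(** Comparison with a telescoping sum of n^(1 - sigma). *)
Lemma cvg_zeta_series (sigma : R) : 1 < sigma ->
  cvgn (series (fun n : nat => n%:R `^ (- sigma) : R)).
Proof.
move=> s1; set u := fun n : nat => _.
pose c := sigma - 1; have c0 : 0 < c by rewrite subr_gt0.
have u0 n : 0 <= u n by exact: powR_ge0.
have step n : c * u n.+2 <= (n.+1%:R `^ (- c) : R) - n.+2%:R `^ (- c).
  rewrite /u !powR_natE //.
  set x := ln (n.+1%:R : R); set y := ln (n.+2%:R : R).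
  have xy : (n.+2%:R : R)^-1 <= y - x.
    have n20 : (0 : R) < n.+2%:R by rewrite ltr0n.
    have := @le_ln1Dx R (- n.+2%:R^-1).
    have -> : 1 + - n.+2%:R^-1 = n.+1%:R / n.+2%:R :> R.
      by rewrite -[n.+1%:R](addrK 1) natr1 mulrBl divff ?gt_eqF // mul1r.
    rewrite ln_div ?posrE ?ltr0n // -/x -/y => h.
    have : -1 < - (n.+2%:R : R)^-1 by rewrite ltrN2 invf_lt1 // ltr1n.
    by move=> /h hh; rewrite -(opprB x y) lerNr.
  have -> : expR (- sigma * y) = expR (- c * y) * n.+2%:R^-1.
    rewrite -[n.+2%:R in RHS](@lnK R) ?posrE ?ltr0n // -/y -expRN -expRD.
    by congr expR; rewrite /c; ring.
  have -> : expR (- c * x) = expR (- c * y) * expR (c * (y - x)).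
    by rewrite -expRD; congr expR; ring.
  have h := expR_ge1Dx (c * (y - x)).
  have p := expR_gt0 (- c * y).
  have q : c * n.+2%:R^-1 <= c * (y - x) by rewrite ler_wpM2l // ltW.
  have : expR (- c * y) * (c * n.+2%:R^-1) <= expR (- c * y) * (expR (c * (y - x)) - 1).
    rewrite ler_wpM2l //; apply: le_trans q _; lra.
  by move: (n.+2%:R^-1) => t; lra.
(* the index is shifted since the telescoping starts at n = 1 *)
have bnd n : c * series u n.+2 <= c * (u 0%N + u 1%N) + 1 - (n.+1%:R `^ (- c) : R).
  elim: n => [|n IHn].
    have -> : (1%:R `^ (- c) : R) = 1 by rewrite powR1.
    rewrite !seriesSr.
    have -> : series u 0 = 0 by rewrite /series /= big_geq.
    by lra.
  rewrite seriesSr mulrDr; have := step n; lra.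
apply: nondecreasing_is_cvgn; first by apply: nondecreasing_series => *; exact: u0.
exists ((u 0%N + u 1%N) + c^-1) => _ [n _ <-].
have nd : nondecreasing_seq (series u) by apply: nondecreasing_series => *; exact: u0.
apply: (@le_trans _ _ (series u n.+2)); first by apply: nd; rewrite ltnW.
rewrite -(ler_pM2l c0) mulrDr mulfV ?gt_eqF //.
by have := bnd n; have := powR_ge0 (n.+1%:R : R) (- c); lra.
Qed.

(** Real majorant of the terms of the k-th derivative of the Dirichlet series. *)
Definition log_term (k : nat) (sigma : R) (n : nat) : R :=
  ln n%:R ^+ k * n%:R `^ (- sigma).

Lemma log_term_ge0 k sigma n : 0 <= log_term k sigma n.
Proof. by rewrite mulr_ge0 ?powR_ge0 // exprn_ge0 // ln_nat_ge0. Qed.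

Lemma ln_le_powR (n : nat) (e : R) : (0 < n)%N -> 0 < e ->
  ln n%:R <= e^-1 * n%:R `^ e.
Proof.
move=> n0 e0; have p : (0 : R) < n%:R `^ e by rewrite powR_gt0 // ltr0n.
have := ltW (ln_sublinear p).
by rewrite ln_powR mulrC -ler_pdivlMr // mulrC.
Qed.

Lemma cvg_log_series k sigma : 1 < sigma -> cvgn (series (log_term k sigma)).
Proof.
move=> s1.
pose e : R := (sigma - 1) / (2 * k.+1%:R).
have k0 : (0 : R) < 2 * k.+1%:R by rewrite mulr_gt0 // ltr0n.
have e0 : 0 < e by rewrite divr_gt0 // subr_gt0.
have ke : k%:R * e <= (sigma - 1) / 2.
  have -> : k%:R * e = ((sigma - 1) / 2) * (k%:R / k.+1%:R) by rewrite /e invfM; ring.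
  rewrite -[leRHS]mulr1 ler_wpM2l //; first by rewrite divr_ge0 // subr_ge0 ltW.
  by rewrite ler_pdivrMr ?ltr0n // mul1r ler_nat.
have cv : cvgn (series (fun n : nat => e^-1 ^+ k * n%:R `^ (- ((sigma + 1) / 2)) : R)).
  by apply: is_cvg_seriesZ; apply: cvg_zeta_series; lra.
apply: (series_le_cvg _ _ _ cv) => n; first exact: log_term_ge0.
  by rewrite mulr_ge0 ?exprn_ge0 ?invr_ge0 ?powR_ge0 // ltW.
case: n => [|n].
  by rewrite /log_term !powR0 ?mulr0 // oppr_eq0 gt_eqF //; lra.
have n0 : (0 : R) < n.+1%:R by rewrite ltr0n.
apply: (@le_trans _ _ ((e^-1 * n.+1%:R `^ e) ^+ k * n.+1%:R `^ (- sigma))).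
  rewrite ler_wpM2r ?powR_ge0 // lerXn2r ?nnegrE ?ln_nat_ge0 ?ln_le_powR //.
  by rewrite mulr_ge0 ?powR_ge0 // invr_ge0 ltW.
rewrite exprMn -mulrA ler_wpM2l ?exprn_ge0 ?invr_ge0 ?(ltW e0) //.
rewrite -powR_mulrn ?powR_ge0 // -powRrM -powRD; last by rewrite (gt_eqF n0) implybT.
by rewrite ler_powR ?ler1n //; lra.
Qed.

End Majorants.

Section DirichletSeries.
Variable R : realType.
Local Notation C := (Cplx R).
Implicit Types (a b : nat -> C) (s w : C) (sigma : R).

(** The number n^-s. *)
Definition dpow (n : nat) s : C := cexp (- (s * ((ln n%:R)%:C)%C)).

Lemma cpowV n s : (cpow n%:R s)^-1 = dpow n s.
Proof. by rewrite /cpow -cexpN. Qed.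

Lemma dpowD n s w : dpow n (s + w) = dpow n s * dpow n w.
Proof. by rewrite /dpow -cexpD; congr cexp; ring. Qed.

Lemma dpowM m n s : (0 < m)%N -> (0 < n)%N -> dpow (m * n) s = dpow m s * dpow n s.
Proof.
move=> m0 n0; rewrite /dpow -cexpD natrM lnM ?posrE ?ltr0n // rmorphD /=.
by congr cexp; ring.
Qed.

Lemma cabs_dpow n s : (0 < n)%N -> cabs (dpow n s) = n%:R `^ (- complex.Re s).
Proof.
move=> n0; rewrite cabs_cexp powR_natE //; congr expR.
by rewrite ReN ReM /= mulr0 subr0 mulNr.
Qed.

Lemma dpow1 s : dpow 1 s = 1.
Proof. by rewrite /dpow ln1 mulr0 oppr0 cexp0. Qed.

(** Up to the sign (-1)^k, the terms of the k-th derivative of the sum of a(n) n^-s. *)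
Definition dterm (k : nat) a s (n : nat) : C :=
  a n * ((ln n%:R ^+ k)%:C)%C * dpow n s.

Definition dseries (k : nat) a s : C := limn (series (dterm k a s)).

(** Series are indexed from 0, and ln 0 = 0 would give the index 0 a spurious term. *)
Definition coef a := a 0%N = 0 /\ forall n, cabs (a n) <= 1.

Lemma dterm_le k a s n : coef a ->
  cabs (dterm k a s n) <= log_term k (complex.Re s) n.
Proof.
move=> [a0 a1]; case: n => [|n].
  by rewrite /dterm a0 !mul0r cabs0; exact: log_term_ge0.
rewrite /dterm !cabsM cabs_dpow // /log_term ler_wpM2r ?powR_ge0 //.
rewrite cabs_real ger0_norm; last by rewrite exprn_ge0 // ln_nat_ge0.
by rewrite ler_piMl // exprn_ge0 // ln_nat_ge0.
Qed.

Lemma cvg_dseries k a s : coef a -> 1 < complex.Re s ->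
  series (dterm k a s) @ \oo --> dseries k a s.
Proof.
move=> ca s1; apply: (@abs_cvg_series R _ (log_term k (complex.Re s))) => [n|].
  exact: dterm_le.
exact: cvg_log_series.
Qed.

Definition log_sum k sigma : R := limn (series (log_term k sigma)).

Lemma log_sum_ge0 k sigma : 1 < sigma -> 0 <= log_sum k sigma.
Proof.
move=> s1; apply: limr_ge; first exact: cvg_log_series.
by apply: nearW => n; apply: sumr_ge0 => i _; exact: log_term_ge0.
Qed.

Lemma dseries_le k a s : coef a -> 1 < complex.Re s ->
  cabs (dseries k a s) <= log_sum k (complex.Re s).
Proof.
move=> ca s1.
apply: (cabs_series_le (fun n => dterm_le k s n ca)); first exact: cvg_log_series.
exact: cvg_dseries.
Qed.

(** [dseries 1 a] is minus the derivative of [dseries 0 a].  The constants depend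
    only on sigma and not on the coefficients, so that one radius serves all twists. *)
Lemma dseries_lipschitz sigma : 1 < sigma ->
  exists rho B : R, [/\ 0 < rho, 0 <= B & forall a (r : R) w w', coef a -> r <= rho ->
    cabs w <= r -> cabs w' <= r ->
    cabs (dseries 0 a (sigma%:C%C + w) - dseries 0 a (sigma%:C%C + w')
          + dseries 1 a sigma%:C%C * (w - w')) <= B * r * cabs (w - w')].
Proof.
move=> s1; pose sg := (sigma + 1) / 2.
have sg1 : 1 < sg by rewrite /sg; lra.
(* n^(3 rho - sigma) is then n^-sg with sg > 1 *)
pose rho := (sigma - 1) / 6.
have L0 := log_sum_ge0 2 sg1.
exists rho, (11 * log_sum 2 sg); split; first by rewrite /rho; lra.
  by rewrite mulr_ge0.
move=> a r w w' ca rr wr wr'.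
have r0 : 0 <= r by apply: le_trans wr; exact: cabs_ge0.
have Re1 z : cabs z <= r -> 1 < complex.Re (sigma%:C%C + z).
  move=> zr; rewrite ReD /=; have := cabs_Re z.
  rewrite ler_norml => /andP[h _]; rewrite /rho in rr; lra.
have cs := cvg_dseries (k:=1) ca (s1 : 1 < complex.Re (sigma%:C%C : C)).
have cw := cvg_dseries (k:=0) ca (Re1 _ wr).
have cw' := cvg_dseries (k:=0) ca (Re1 _ wr').
pose T n := dterm 0 a (sigma%:C%C + w) n - dterm 0 a (sigma%:C%C + w') n
   + dterm 1 a sigma%:C%C n * (w - w').
have cT : series T @ \oo --> (dseries 0 a (sigma%:C%C + w)
    - dseries 0 a (sigma%:C%C + w') + dseries 1 a sigma%:C%C * (w - w')).
  have -> : series T = (fun N => series (dterm 0 a (sigma%:C%C + w)) N -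
      series (dterm 0 a (sigma%:C%C + w')) N + series (dterm 1 a sigma%:C%C) N * (w - w')).
    by apply/funext => N; rewrite /series /= big_split sumrB mulr_suml.
  apply: (cvgD (cvgB cw cw')); apply: (cvgM cs); exact: cvg_cst.
apply: (cabs_series_le (b := fun n => 11 * r * cabs (w - w') * log_term 2 sg n)) cT; last first.
  rewrite (_ : 11 * _ * r * _ = 11 * r * cabs (w - w') * log_sum 2 sg); last by ring.
  rewrite (_ : series _ = (fun N => 11 * r * cabs (w - w') * series (log_term 2 sg) N)).
    by apply: cvgM; [exact: cvg_cst | exact: cvg_log_series].
  by apply/funext => N; rewrite /series /= mulr_sumr.
case=> [|n].
  rewrite /T /dterm ca.1 !mul0r subrr addr0 cabs0.
  by apply: mulr_ge0 (log_term_ge0 _ _ _); rewrite !mulr_ge0 ?cabs_ge0.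
set L := ln (n.+1%:R : R); have Lge : 0 <= L := ln_nat_ge0 _ _.
pose u : C := - (w * (L%:C)%C); pose v : C := - (w' * (L%:C)%C).
have cL : cabs (L%:C%C : C) = L by rewrite cabs_real ger0_norm.
have ur : cabs u <= r * L by rewrite cabsN cabsM cL ler_wpM2r.
have vr : cabs v <= r * L by rewrite cabsN cabsM cL ler_wpM2r.
have -> : T n.+1 = a n.+1 * dpow n.+1 sigma%:C%C * (cexp u - cexp v - (u - v)).
  rewrite /T /dterm !dpowD /dpow -/L -/u -/v !expr0 expr1.
  by move: (cexp u) (cexp v) (cexp _) (a n.+1) => e1 e2 e3 e4; rewrite /u /v; ring.
rewrite !cabsM cabs_dpow //=.
have an : cabs (a n.+1) <= 1 := ca.2 _.
apply: (@le_trans _ _ (1 * n.+1%:R `^ (- sigma) *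
    (11 * (r * L) * expR (3 * (r * L)) * cabs (u - v)))).
  rewrite ler_pM ?mulr_ge0 ?cabs_ge0 ?powR_ge0 //; last exact: cexp_chord_le.
  by rewrite ler_wpM2r ?powR_ge0.
have -> : cabs (u - v) = cabs (w - w') * L.
  by rewrite -cL -cabsM -[RHS]cabsN; congr (cabs _); rewrite /u /v; ring.
rewrite /log_term -/L mul1r.
have E : n.+1%:R `^ (- sigma) * expR (3 * (r * L)) <= (n.+1%:R `^ (- sg) : R).
  rewrite !powR_natE // -/L -expRD ler_expR.
  have : r * L <= rho * L by rewrite ler_wpM2r.
  by rewrite /rho /sg; lra.
have P0 : 0 <= 11 * r * cabs (w - w') * L ^+ 2 by rewrite !mulr_ge0 ?cabs_ge0 ?exprn_ge0.
have := ler_wpM2l P0 E.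
set e := expR _; set p := n.+1%:R `^ (- sigma); set q := n.+1%:R `^ (- sg).
have -> : p * (11 * (r * L) * e * (cabs (w - w') * L)) =
   11 * r * cabs (w - w') * L ^+ 2 * (p * e) by ring.
by move=> h; apply: le_trans h _; rewrite [leRHS]mulrA.
Qed.

(** The tail is uniformly small and the head depends on finitely many coefficients. *)
Lemma dseries_near k sigma (eta : R) : 1 < sigma -> 0 < eta ->
  exists (X : nat) (eta' : R), 0 < eta' /\ forall a b, coef a -> coef b ->
    (forall n, (n < X)%N -> cabs (a n - b n) <= eta') ->
    cabs (dseries k a sigma%:C%C - dseries k b sigma%:C%C) <= eta.
Proof.
move=> s1 eta0.
have cv := @cvg_log_series R k sigma s1.
set S := log_sum k sigma; have S0 : 0 <= S := @log_sum_ge0 k sigma s1.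
have [X _ hX] : \forall X \near \oo, `|S - series (log_term k sigma) X| < eta / 4.
  by move/cvgrPdist_lt: cv; apply; rewrite divr_gt0.
have {hX} := hX X (leqnn X); set SX := series _ X => hX.
exists X, (eta / (2 * (S + 1))).
have S1 : 0 < 2 * (S + 1) by lra.
split => [|a b ca cb ab]; first by rewrite divr_gt0.
set eta' := eta / _ in ab *; have eta'0 : 0 <= eta' by rewrite divr_ge0 // ltW.
have csa := cvg_dseries (k:=k) ca (s1 : 1 < complex.Re (sigma%:C%C : C)).
have csb := cvg_dseries (k:=k) cb (s1 : 1 < complex.Re (sigma%:C%C : C)).
pose T n := dterm k a sigma%:C%C n - dterm k b sigma%:C%C n.
have cT : series T @ \oo --> (dseries k a sigma%:C%C - dseries k b sigma%:C%C).
  have -> : series T = (fun N => series (dterm k a sigma%:C%C) N -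
      series (dterm k b sigma%:C%C) N).
    by apply/funext => N; rewrite /series /= sumrB.
  exact: (cvgB csa csb).
pose B n := eta' * log_term k sigma n + 2 * (if (n < X)%N then 0 else log_term k sigma n).
have cB : series B @ \oo --> (eta' * S + 2 * (S - SX)).
  have E : \forall N \near \oo, eta' * series (log_term k sigma) N
      + 2 * (series (log_term k sigma) N - SX) = series B N.
    near=> N.
    have XN : (X <= N)%N by near: N; exact: nbhs_infty_ge.
    rewrite /series /= big_split /= -!mulr_sumr; congr (_ + 2 * _).
    rewrite /SX /series /= (big_cat_nat (n := X)) //= [in RHS](big_cat_nat (n := X)) //=.
    rewrite [in LHS]addrAC subrr add0r [X in _ = X + _]big_nat_cond.
    rewrite [X in _ = X + _]big1 ?add0r; last by move=> i /andP[/andP[_ ->]].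
    rewrite big_nat_cond [RHS]big_nat_cond.
    by apply: eq_bigr => i /andP[/andP[Xi _] _]; rewrite ltnNge Xi.
  apply: cvg_trans (near_eq_cvg E) _.
  apply: (cvgD (cvgM (cvg_cst eta') cv)).
  apply: (cvgM (cvg_cst (2 : R))); apply: (cvgB cv); exact: cvg_cst.
apply: (@le_trans _ _ (eta' * S + 2 * (S - SX))).
  apply: (cabs_series_le _ cB cT) => n.
  rewrite /B; case: ltnP => [nX|Xn]; last first.
    apply: (@le_trans _ _ (2 * log_term k sigma n)); last first.
      by rewrite lerDr mulr_ge0 ?log_term_ge0.
    apply: le_trans (cabsD _ _) _; rewrite cabsN.
    have := dterm_le k sigma%:C%C n ca; have := dterm_le k sigma%:C%C n cb.
    by rewrite /=; lra.
  rewrite mulr0 addr0 /T /dterm -!mulrBl -mulrA cabsM.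
  case: n nX => [|n] nX.
    by rewrite ca.1 cb.1 subrr cabs0 mul0r mulr_ge0 // log_term_ge0.
  rewrite ler_pM ?cabs_ge0 ?ab //.
  rewrite !cabsM cabs_dpow // cabs_real ger0_norm //.
  by rewrite exprn_ge0 // ln_nat_ge0.
have : eta' * S <= eta / 2.
  rewrite /eta' mulrAC ler_pdivrMr // mulrA divfK //.
  by rewrite ler_wpM2l ?ltW //; lra.
by move: hX; rewrite ltr_norml => /andP[_]; lra.
Unshelve. all: by end_near.
Qed.

End DirichletSeries.

(** * Primes in increasing order, and sums over divisors and pairs *)

Arguments nth_prime : simpl never.

Section Primes.

Lemma next_prime_gt m : (m < next_prime m)%N.
Proof. by rewrite /next_prime; case: ex_minnP => p /andP[]. Qed.

Lemma next_prime_prime m : prime (next_prime m).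
Proof. by rewrite /next_prime; case: ex_minnP => p /andP[]. Qed.

Lemma next_prime_le m q : (m < q)%N -> prime q -> (next_prime m <= q)%N.
Proof.
by move=> mq pq; rewrite /next_prime; case: ex_minnP => p _; apply; rewrite mq.
Qed.

Lemma nth_prime_prime i : prime (nth_prime i.+1).
Proof. exact: next_prime_prime. Qed.

Lemma nth_prime_gt0 i : (0 < nth_prime i.+1)%N.
Proof. exact: prime_gt0 (nth_prime_prime i). Qed.

Lemma nth_prime_lt i j : (i < j)%N -> (nth_prime i < nth_prime j)%N.
Proof.
elim: j => [//|j IHj]; rewrite ltnS leq_eqVlt => /predU1P[->|/IHj h].
  exact: next_prime_gt.
exact: ltn_trans h (next_prime_gt _).
Qed.

Lemma nth_prime_inj : injective nth_prime.
Proof.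
move=> i j h; case: (ltngtP i j) => // ij.
  by have := nth_prime_lt ij; rewrite h ltnn.
by have := nth_prime_lt ij; rewrite h ltnn.
Qed.

Lemma nth_prime_ge i : (i <= nth_prime i)%N.
Proof. by elim: i => [//|i IHi]; exact: leq_ltn_trans IHi (nth_prime_lt _). Qed.

Lemma nth_prime_onto (q N : nat) : prime q -> (q <= nth_prime N)%N ->
  exists2 i, (i < N)%N & q = nth_prime i.+1.
Proof.
move=> pq; elim: N => [|N IHN]; first by rewrite leqNgt prime_gt0.
have [qN _|Nq qN] := leqP q (nth_prime N).
  by have [i iN ->] := IHN qN; exists i => //; exact: ltnW.
exists N => //; apply/eqP; rewrite eqn_leq qN; exact: next_prime_le.
Qed.

Definition rough (N n : nat) : bool := [forall i : 'I_N, ~~ (nth_prime i.+1 %| n)%N].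

Lemma rough0 n : rough 0 n.
Proof. by apply/forallP; case. Qed.

Lemma roughS N n : rough N.+1 n = rough N n && ~~ (nth_prime N.+1 %| n)%N.
Proof.
apply/forallP/andP => [h|[/forallP h hN] i].
  split; last exact: (h ord_max).
  by apply/forallP => i; exact: (h (widen_ord (leqnSn N) i)).
have [iN|Ni] := ltnP i N; first exact: (h (Ordinal iN)).
suff -> : nat_of_ord i = N by [].
by apply/eqP; rewrite eqn_leq Ni -ltnS ltn_ord.
Qed.

Lemma rough1 N : rough N 1.
Proof.
by apply/forallP => i; rewrite dvdn1 neq_ltn (prime_gt1 (nth_prime_prime i)) orbT.
Qed.

(** The least prime divisor is not among the first N primes, and the N-th prime is at
    least N. *)
Lemma rough_gt N n : rough N n -> (1 < n)%N -> (N < n)%N.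
Proof.
move=> /forallP h n1; have [//|nN] := ltnP N n.
have qp := pdiv_prime n1.
have qn : (pdiv n <= nth_prime N)%N.
  apply: leq_trans (nth_prime_ge N); apply: leq_trans nN.
  by apply: dvdn_leq (pdiv_dvd n); exact: ltnW.
have [i iN qE] := nth_prime_onto qp qn.
by have := h (Ordinal iN); rewrite /= -qE pdiv_dvd.
Qed.

Lemma rough_mul N m : rough N (nth_prime N.+1 * m) = rough N m.
Proof.
apply/forallP/forallP => h i; apply: contra (h i); first exact: dvdn_mull.
rewrite Euclid_dvdM ?nth_prime_prime // dvdn_prime2 ?nth_prime_prime //.
by case/orP => // /eqP /nth_prime_inj [] E; move: (ltn_ord i); rewrite E ltnn.
Qed.

End Primes.

Section Sums.
Variable R : realType.
Local Notation C := (Cplx R).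

Lemma sum_dvd (p K : nat) (f : nat -> C) : (0 < p)%N ->
  \sum_(0 <= n < p * K) (if (p %| n)%N then f n else 0) = \sum_(0 <= m < K) f (p * m)%N.
Proof.
move=> p0; elim: K => [|K IHK]; first by rewrite muln0 !big_geq.
rewrite big_nat_recr //= -IHK mulnS addnC (big_cat_nat (n := (p * K)%N)) ?leq_addr //=.
congr (_ + _); rewrite -{1}[(p * K)%N]add0n big_addn addKn big_ltn // add0n.
rewrite dvdn_mulr // big_nat_cond big1 ?addr0 // => i /andP[/andP[i0 ip] _].
by rewrite dvdn_addl ?dvdn_mulr // gtnNdvd.
Qed.

Lemma series_dvd (p : nat) (f : nat -> C) (l l' : C) : (0 < p)%N ->
  series (fun n => if (p %| n)%N then f n else 0) @ \oo --> l ->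
  series (fun m => f (p * m)%N) @ \oo --> l' -> l = l'.
Proof.
move=> p0 h h'.
have sub : (fun K => (p * K)%N) @ \oo --> \oo.
  move=> A [N _ hN]; exists N => // K /= NK; apply: hN => /=.
  by apply: leq_trans NK _; rewrite leq_pmull.
have h2 := cvg_comp _ _ sub h.
have E : series (fun n => if (p %| n)%N then f n else 0) \o (fun K => (p * K)%N)
    = series (fun m => f (p * m)%N).
  by apply/funext => K; rewrite /series /= sum_dvd.
by rewrite E in h2; rewrite -(cvg_lim _ h') // -(cvg_lim _ h2).
Qed.

(** The pairs i < j contribute (A^2 - Q) / 2 to the square A^2.  The inner
    sums are a(m + 1) (A - S) with S a partial sum of A, so the iterated limit is a limit
    of finite expressions in the partial sums of A and Q. *)
Lemma iterated_pair_sum (a : nat -> C) (A Q : C) : a 0%N = 0 ->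
  series a @ \oo --> A -> series (fun n => a n ^+ 2) @ \oo --> Q ->
  limn (series (fun m => limn (series (fun n => a m.+1 * a (m.+1 + n.+1)%N : C)) : C))
    = 2^-1 * (A ^+ 2 - Q).
Proof.
move=> a0 hA hQ.
have inner m : limn (series (fun n => a m.+1 * a (m.+1 + n.+1)%N : C)) =
    a m.+1 * (A - series a m.+2).
  apply: cvg_lim; first exact: norm_hausdorff.
  rewrite (_ : series _ = fun n => a m.+1 * (series a (m.+2 + n)%N - series a m.+2)); last first.
    apply/funext => n; rewrite /series /= -mulr_sumr; congr (_ * _).
    rewrite [X in _ = X - _](big_cat_nat (n := m.+2)) //= ?leq_addr //.
    rewrite [RHS]addrAC subrr add0r -[X in _ = \sum_(X <= _ < _) _]add0n big_addn addKn.
    by apply: eq_bigr => i _; congr a; lia.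
  apply: (cvgM (cvg_cst (a m.+1))); apply: (cvgB _ (cvg_cst (series a m.+2))).
  exact: (cvg_comp _ _ (cvg_addnl m.+2) hA).
under eq_fun do rewrite inner.
have ident N : \sum_(0 <= i < N) a i * series a i.+1 =
    2^-1 * (series a N ^+ 2 + series (fun n => a n ^+ 2) N).
  elim: N => [|N IHN]; first by rewrite /series /= !big_geq // expr0n /= addr0 mulr0.
  rewrite big_nat_recr //= IHN !seriesSr.
  have n2 : (2 : C) != 0 by rewrite pnatr_eq0.
  by apply: (mulfI n2); rewrite !mulrDr !mulrA mulfV //; ring.
have E : series (fun m => a m.+1 * (A - series a m.+2)) =
    (fun N => A * series a N.+1 -
      2^-1 * (series a N.+1 ^+ 2 + series (fun n => a n ^+ 2) N.+1)).
  apply/funext => N; rewrite -ident /series /= [in RHS]mulr_sumr -sumrB.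
  rewrite [RHS]big_nat_recl //= a0 mulr0 mul0r subrr add0r.
  by apply: eq_bigr => i _; rewrite /series /=; ring.
rewrite E; apply: cvg_lim; first exact: norm_hausdorff.
have hA1 : (fun N => series a N.+1) @ \oo --> A.
  exact: (cvg_comp _ _ (cvg_addnl 1) hA).
have hQ1 : (fun N => series (fun n => a n ^+ 2) N.+1) @ \oo --> Q.
  exact: (cvg_comp _ _ (cvg_addnl 1) hQ).
have -> : 2^-1 * (A ^+ 2 - Q) = A * A - 2^-1 * (A * A + Q).
  have n2 : (2 : C) != 0 by rewrite pnatr_eq0.
  by apply: (mulfI n2); rewrite !mulrBr !mulrA mulfV //; ring.
apply: cvgB; first by apply: (cvgM (cvg_cst A) hA1).
apply: (cvgM (cvg_cst (2^-1 : C))); apply: cvgD hQ1.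
under eq_fun do rewrite expr2.
exact: (cvgM hA1 hA1).
Qed.

End Sums.

(** * Euler product and logarithmic derivative *)

Section EulerProduct.
Variable R : realType.
Local Notation C := (Cplx R).
Variables (a : nat -> C) (s : C).

(** Completely multiplicative with unimodular values, extended by 0 at 0. *)
Definition cmult (a : nat -> C) :=
  [/\ a 0%N = 0, a 1%N = 1, (forall n, (0 < n)%N -> cabs (a n) = 1) &
      forall m n, a (m * n)%N = a m * a n].

Lemma cmult_coef b : cmult b -> coef b.
Proof.
move=> [b0 b1 bu bM]; split=> // n; case: n => [|n].
  by rewrite b0 cabs0.
by rewrite bu.
Qed.

Hypothesis (am : cmult a) (s1 : 1 < complex.Re s).

Let ac : coef a := cmult_coef am.

Definition sieve (N : nat) : nat -> C := fun n => if rough N n then a n else 0.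

Definition local_value (i : nat) : C :=
  a (nth_prime i.+1) * dpow (nth_prime i.+1) s.

Lemma coef_sieve N : coef (sieve N).
Proof.
split; first by rewrite /sieve ac.1 if_same.
by move=> n; rewrite /sieve; case: ifP => _; [exact: ac.2 | rewrite cabs0].
Qed.

Lemma cabs_local_value i : cabs (local_value i) = (nth_prime i.+1)%:R `^ (- complex.Re s).
Proof.
have [_ _ au _] := am; have p0 := nth_prime_gt0 i.
by rewrite cabsM au // mul1r cabs_dpow.
Qed.

Lemma cabs_local_value_lt1 i : cabs (local_value i) < 1.
Proof.
rewrite cabs_local_value powR_natE ?nth_prime_gt0 // -[X in _ < X](@expR0 R) ltr_expR.
have p1 : (1 : R) < (nth_prime i.+1)%:R by rewrite ltr1n prime_gt1 ?nth_prime_prime.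
have := ln_gt0 p1; set L := ln _ => L0.
by rewrite mulNr oppr_lt0 mulr_gt0 //; apply: lt_trans s1.
Qed.

Lemma local_value_neq1 i : 1 - local_value i != 0.
Proof.
rewrite subr_eq0; apply/eqP => h.
by have := cabs_local_value_lt1 i; rewrite -h cabs1 ltxx.
Qed.

Let p_ i := nth_prime i.+1.

Lemma cvg_sieve k N : series (dterm k (sieve N) s) @ \oo --> dseries k (sieve N) s.
Proof. by apply: cvg_dseries => //; exact: coef_sieve. Qed.

(** The multiples of the next prime are exactly what one more sieving step removes. *)
Lemma sieve_drop k N :
  series (fun n => if (p_ N %| n)%N then dterm k (sieve N) s n else 0) @ \oo -->
  (dseries k (sieve N) s - dseries k (sieve N.+1) s).
Proof.
have -> : series (fun n => if (p_ N %| n)%N then dterm k (sieve N) s n else 0) =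
    (fun K => series (dterm k (sieve N) s) K - series (dterm k (sieve N.+1) s) K).
  apply/funext => K; rewrite /series /= -sumrB; apply: eq_bigr => n _.
  rewrite /dterm /sieve roughS -/(p_ N).
  by case: (rough N n); case: (p_ N %| n)%N; rewrite /= ?mul0r ?subr0 ?subrr.
exact: (cvgB (@cvg_sieve k N) (@cvg_sieve k N.+1)).
Qed.

Lemma dterm0_mul N m : dterm 0 (sieve N) s (p_ N * m)%N =
  local_value N * dterm 0 (sieve N) s m.
Proof.
have [a0 _ _ aM] := am; case: m => [|m].
  by rewrite muln0 /dterm (coef_sieve N).1 !mul0r mulr0.
rewrite /dterm !expr0 !mulr1 /sieve rough_mul /local_value -/(p_ N).
rewrite dpowM ?nth_prime_gt0 // aM; case: ifP => _; rewrite ?mul0r ?mulr0 //.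
by ring.
Qed.

Lemma dterm1_mul N m : dterm 1 (sieve N) s (p_ N * m)%N =
  local_value N * (dterm 1 (sieve N) s m + ((ln (p_ N)%:R)%:C)%C * dterm 0 (sieve N) s m).
Proof.
have [a0 _ _ aM] := am; case: m => [|m].
  by rewrite muln0 /dterm (coef_sieve N).1 !mul0r mulr0 addr0 mulr0.
have pN0 : (0 < p_ N)%N by exact: nth_prime_gt0.
rewrite /dterm !expr0 !expr1 !mulr1 /sieve rough_mul /local_value -/(p_ N).
rewrite dpowM // aM natrM lnM ?posrE ?ltr0n // rmorphD /=.
case: ifP => _; rewrite ?mul0r ?mulr0 ?addr0 ?mulr0 //.
by ring.
Qed.

Lemma sieve0S N : dseries 0 (sieve N.+1) s = (1 - local_value N) * dseries 0 (sieve N) s.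
Proof.
have h : dseries 0 (sieve N) s - dseries 0 (sieve N.+1) s =
    local_value N * dseries 0 (sieve N) s.
  apply: (series_dvd (nth_prime_gt0 N) (@sieve_drop 0 N)).
  rewrite (_ : series _ = fun K => local_value N * series (dterm 0 (sieve N) s) K).
    exact: (cvgM (cvg_cst (local_value N)) (@cvg_sieve 0 N)).
  apply/funext => K; rewrite /series /= mulr_sumr.
  by apply: eq_bigr => m _; exact: dterm0_mul.
by rewrite mulrBl mul1r -h opprB addrC subrK.
Qed.

(** A sum with weight log(p m) = log p + log m: the derivative of the factor 1 - z_p
    appears as a second term. *)
Lemma sieve1S N : dseries 1 (sieve N.+1) s = (1 - local_value N) * dseries 1 (sieve N) s
  - local_value N * ((ln (p_ N)%:R)%:C)%C * dseries 0 (sieve N) s.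
Proof.
have h : dseries 1 (sieve N) s - dseries 1 (sieve N.+1) s =
    local_value N * (dseries 1 (sieve N) s + ((ln (p_ N)%:R)%:C)%C * dseries 0 (sieve N) s).
  apply: (series_dvd (nth_prime_gt0 N) (@sieve_drop 1 N)).
  rewrite (_ : series _ = fun K => local_value N * (series (dterm 1 (sieve N) s) K +
      ((ln (p_ N)%:R)%:C)%C * series (dterm 0 (sieve N) s) K)).
    apply: (cvgM (cvg_cst (local_value N))); apply: (cvgD (@cvg_sieve 1 N)).
    exact: (cvgM (cvg_cst (((ln (p_ N)%:R)%:C)%C : C)) (@cvg_sieve 0 N)).
  apply/funext => K; rewrite /series /= mulr_sumr -big_split mulr_sumr /=.
  by apply: eq_bigr => m _; rewrite dterm1_mul.
rewrite -[LHS](subKr (dseries 1 (sieve N) s)) h; ring.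
Qed.

(** Beyond n = 1, only integers larger than N survive N steps of the sieve. *)
Lemma sieve_tail k N :
  cabs (dseries k (sieve N) s - (k == 0)%:R) <=
  log_sum k (complex.Re s) - series (log_term k (complex.Re s)) N.+1.
Proof.
pose T n := dterm k (sieve N) s n - (if n == 1%N then (k == 0)%:R else 0).
have cT : series T @ \oo --> (dseries k (sieve N) s - (k == 0)%:R).
  rewrite (_ : series T = fun K => series (dterm k (sieve N) s) K -
      series (fun n => if n == 1%N then (k == 0)%:R else 0) K); last first.
    by apply/funext => K; rewrite /series /= sumrB.
  apply: (cvgB (@cvg_sieve k N)); apply: cvg_near_cst; near=> K.
  have K1 : (1 < K)%N by near: K; exact: nbhs_infty_gt.
  rewrite /series /= (bigD1_seq 1%N) ?mem_index_iota ?iota_uniq //= big1 ?addr0 //.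
  by move=> i /negbTE ->.
set L := log_term k (complex.Re s).
have cL : series (fun n => if (n < N.+1)%N then 0 else L n) @ \oo -->
    (log_sum k (complex.Re s) - series L N.+1).
  have E : \forall K \near \oo, series L K - series L N.+1 =
      series (fun n => if (n < N.+1)%N then 0 else L n) K.
    near=> K.
    have NK : (N.+1 <= K)%N by near: K; exact: nbhs_infty_ge.
    rewrite sub_series_geq // /series /= [RHS](big_cat_nat (n := N.+1)) //=.
    rewrite [X in _ = X + _]big_nat_cond [X in _ = X + _]big1 ?add0r; last first.
      by move=> i /andP[/andP[_ ->]].
    rewrite big_nat_cond [RHS]big_nat_cond.
    by apply: eq_bigr => i /andP[/andP[Xi _] _]; rewrite ltnNge Xi.
  apply: cvg_trans (near_eq_cvg E) _.
  by apply: (cvgB (@cvg_log_series R k _ s1)); exact: cvg_cst.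
apply: (cabs_series_le _ cL cT) => n.
have b0 (x : C) : x = 0 -> cabs x <= if (n < N.+1)%N then 0 else L n.
  by move=> ->; rewrite cabs0; case: ifP => // _; exact: log_term_ge0.
case: n b0 => [|[|n]] b0.
- by apply: b0; rewrite /T /= subr0 /dterm (coef_sieve N).1 !mul0r.
- apply: b0; rewrite /T /= /dterm /sieve rough1 dpow1 ln1; have [_ -> _ _] := am.
  case: k {T cT L cL} => [|k].
    by rewrite expr0 rmorph1 !mulr1 subrr.
  by rewrite exprS mul0r rmorph0 mulr0 mul0r subrr.
case: ltnP b0 => [nN b0|Nn _].
  apply: b0; rewrite /T /= subr0 /dterm /sieve; case: ifP => [/rough_gt h|_].
    by have := h isT; rewrite ltnNge -ltnS nN.
  by rewrite !mul0r.
by rewrite /T subr0; apply: dterm_le; exact: coef_sieve.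
Unshelve. all: by end_near.
Qed.

Lemma cvg_sieve_tail k : (fun N => dseries k (sieve N) s) @ \oo --> ((k == 0)%:R : C).
Proof.
apply/cvg_cabsP.
apply: (@squeeze_cvgr _ _ _ _ (cst 0) (fun N => log_sum k (complex.Re s) -
   series (log_term k (complex.Re s)) N.+1)).
- by apply: nearW => n; rewrite /= cabs_ge0 sieve_tail.
- exact: cvg_cst.
- rewrite -[X in _ --> X](subrr (log_sum k (complex.Re s))).
  apply: (cvgB (cvg_cst (log_sum k (complex.Re s)))).
  exact: (cvg_comp _ _ (cvg_addnl 1) (@cvg_log_series R k _ s1)).
Qed.

Definition euler_factor (N : nat) : C := \prod_(0 <= i < N) (1 - local_value i).

Definition mangoldt_sum (N : nat) : C :=
  \sum_(0 <= i < N) ((ln (nth_prime i.+1)%:R)%:C)%C * (local_value i / (1 - local_value i)).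

Lemma sieve_init k : dseries k (sieve 0) s = dseries k a s.
Proof.
congr dseries; apply/funext => n.
by rewrite /sieve rough0.
Qed.

Lemma sieve0E N : dseries 0 (sieve N) s = euler_factor N * dseries 0 a s.
Proof.
elim: N => [|N IHN].
  by rewrite sieve_init /euler_factor big_geq // mul1r.
by rewrite sieve0S IHN /euler_factor big_nat_recr //=; ring.
Qed.

Lemma sieve1E N : dseries 1 (sieve N) s =
  euler_factor N * (dseries 1 a s - dseries 0 a s * mangoldt_sum N).
Proof.
elim: N => [|N IHN].
  by rewrite sieve_init /euler_factor /mangoldt_sum !big_geq // mul1r mulr0 subr0.
have nz := local_value_neq1 N.
rewrite sieve1S IHN sieve0E /euler_factor /mangoldt_sum !big_nat_recr //= -/(p_ N).
set z := local_value N in nz *; set E := \prod_(0 <= i < N) _.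
set V := \sum_(0 <= i < N) _; set l : C := _%:C%C.
set Z := dseries 0 a s; set T := dseries 1 a s.
by field.
Qed.

(** N steps of the sieve multiply Z by the first N factors and leave only n = 1 in
    the limit. *)
Theorem euler_product : (fun N => euler_factor N * dseries 0 a s) @ \oo --> (1 : C).
Proof.
have := @cvg_sieve_tail 0; rewrite /=.
by under eq_fun do rewrite sieve0E.
Qed.

Lemma dseries_neq0 : dseries 0 a s != 0.
Proof.
apply/eqP => Z0; have := euler_product; rewrite Z0.
under eq_fun do rewrite mulr0.
move=> /cvgC_unique /(_ (cvg_cst (0 : C))) /eqP.
by rewrite oner_eq0.
Qed.

(** The sieve applied to the series with weight log n, whose sifted part tends to 0
    because log 1 = 0. *)
Theorem log_derivative : (fun N => dseries 0 a s * mangoldt_sum N) @ \oo --> dseries 1 a s.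
Proof.
have h1 := @cvg_sieve_tail 1; rewrite /= in h1.
have hE := euler_product.
have nE N : euler_factor N != 0.
  by rewrite /euler_factor prodf_seq_neq0; apply/allP => i _; rewrite local_value_neq1.
have E N : dseries 1 a s - dseries 0 a s * (dseries 1 (sieve N) s / (euler_factor N * dseries 0 a s))
    = dseries 0 a s * mangoldt_sum N.
  have Z0 := dseries_neq0; have := nE N; rewrite sieve1E.
  set e := euler_factor N; set Z := dseries 0 a s in Z0 *; set T := dseries 1 a s.
  by move=> e0; field; rewrite ?Z0 ?e0.
have -> : dseries 1 a s = dseries 1 a s - dseries 0 a s * (0 / 1) by rewrite mul0r mulr0 subr0.
under eq_fun do rewrite -E.
apply: (cvgB (cvg_cst (dseries 1 a s))).
apply: (cvgM (cvg_cst (dseries 0 a s))).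
apply: (cvgM h1); apply: (cvgV _ hE); exact: oner_neq0.
Qed.

End EulerProduct.

(** * Twisted zeros and their persistence *)

Section CriticalPoint.
Variable R : realType.
Local Notation C := (Cplx R).

Definition sqr_coef (a : nat -> C) : nat -> C := fun n => a n ^+ 2.

Lemma cmult_sqr a : cmult a -> cmult (sqr_coef a).
Proof.
move=> [a0 a1 au aM]; split; rewrite /sqr_coef.
- by rewrite a0 expr0n.
- by rewrite a1 expr1n.
- by move=> n n0; rewrite cabsX au // expr1n.
- by move=> m n; rewrite aM exprMn.
Qed.

Lemma dpow_double n (s : C) : dpow n (2 * s) = dpow n s ^+ 2.
Proof. by rewrite mulr_natl mulr2n dpowD expr2. Qed.

Lemma local_value_sqr a (s : C) i :
  local_value (sqr_coef a) (2 * s) i = local_value a s i ^+ 2.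
Proof. by rewrite /local_value /sqr_coef dpow_double exprMn. Qed.

(** The Euler products of Z(s)^2 and of Z2(2s) differ by the given product, which
    tends to 1; the second limit is the difference of their logarithmic derivatives,
    as x / (1 - x) - x^2 / (1 - x^2) = x / (1 - x^2). *)
Lemma critical_point (a : nat -> C) (s : C) : cmult a -> 1 < complex.Re s ->
  (fun N => \prod_(0 <= i < N) ((1 + local_value a s i) / (1 - local_value a s i)))
     @ \oo --> (1 : C) ->
  dseries 0 a s ^+ 2 = dseries 0 (sqr_coef a) (2 * s) /\
  (fun N => dseries 0 a s ^+ 2 * \sum_(0 <= i < N) ((ln (nth_prime i.+1)%:R)%:C)%C *
      (local_value a s i / (1 - local_value a s i ^+ 2))) @ \oo -->
   (dseries 0 a s * dseries 1 a s - dseries 1 (sqr_coef a) (2 * s)).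
Proof.
move=> am s1 H; have bm := cmult_sqr am.
have s2 : 1 < complex.Re (2 * s) by rewrite mulr_natl mulr2n ReD; lra.
have e1 := euler_product am s1; have e2 := euler_product bm s2.
have l1 := log_derivative am s1; have l2 := log_derivative bm s2.
have n1 := local_value_neq1 am s1.
have n2 i : 1 - local_value a s i ^+ 2 != 0.
  by rewrite -local_value_sqr; exact: (local_value_neq1 bm s2).
set z := local_value a s in H n1 n2 *.
set Z := dseries 0 a s in e1 l1 *; set Z2 := dseries 0 _ (2 * s) in e2 l2 *.
have E2 N : euler_factor (sqr_coef a) (2 * s) N * Z ^+ 2 =
    (euler_factor a s N * Z) ^+ 2 * \prod_(0 <= i < N) ((1 + z i) / (1 - z i)).
  rewrite exprMn mulrAC; congr (_ * _).
  rewrite expr2 /euler_factor -!big_split /=; apply: eq_bigr => i _.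
  rewrite local_value_sqr -/z; have := n1 i; set x := z i => x0.
  by field.
have h : (fun N => euler_factor (sqr_coef a) (2 * s) N * Z ^+ 2) @ \oo --> (1 : C).
  under eq_fun do rewrite E2 expr2.
  have E1 : 1 * 1 * 1 = 1 :> C by rewrite !mulr1.
  have h' := cvgM (cvgM e1 e1) H; rewrite E1 in h'; exact: h'.
have nZ2 : Z2 != 0 := dseries_neq0 bm s2.
have nE N : euler_factor (sqr_coef a) (2 * s) N != 0.
  rewrite /euler_factor prodf_seq_neq0; apply/allP => i _.
  by rewrite local_value_sqr n2.
have ZZ : Z ^+ 2 = Z2.
  have hq : (fun N => (euler_factor (sqr_coef a) (2 * s) N * Z ^+ 2) /
      (euler_factor (sqr_coef a) (2 * s) N * Z2) * Z2) @ \oo --> (1 / 1 * Z2).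
    apply: cvgM (cvg_cst Z2); apply: (cvgM h); apply: (cvgV _ e2).
    exact: oner_neq0.
  rewrite divr1 mul1r in hq; apply: cvgC_unique hq.
  rewrite (_ : (fun N => _) = fun=> Z ^+ 2); first exact: cvg_cst.
  apply/funext => N; have := nE N; set e := euler_factor _ _ _ => e0.
  by field; rewrite e0 nZ2.
split; first exact: ZZ.
have hd := cvgB (cvgM (cvg_cst Z) l1) l2.
rewrite (_ : (fun N => _) = (fun N => Z * (Z * mangoldt_sum a s N) -
   Z2 * mangoldt_sum (sqr_coef a) (2 * s) N)); first exact: hd.
apply/funext => N; rewrite -ZZ mulrA -expr2 -mulrBr; congr (_ * _).
rewrite /mangoldt_sum -sumrB; apply: eq_bigr => i _.
rewrite local_value_sqr -/z; have := n1 i; have := n2 i; set x := z i => x1 x0.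
by field; rewrite x0 x1.
Qed.

End CriticalPoint.

Section Newton.
Variable R : realType.
Local Notation C := (Cplx R).

(** The map w - F(w) / c halves distances and preserves the disc of radius r. *)
Lemma newton_zero (F : C -> C) (c : C) (r : R) : c != 0 -> 0 < r ->
  (forall w w', cabs w <= r -> cabs w' <= r ->
     cabs (F w - F w' - c * (w - w')) <= cabs c / 2 * cabs (w - w')) ->
  cabs (F 0) <= cabs c * r / 2 ->
  exists w, cabs w <= r /\ F w = 0.
Proof.
move=> c0 r0 lip F0.
have cp : 0 < cabs c by rewrite cabs_gt0.
pose G w := w - F w / c.
have Glip w w' : cabs w <= r -> cabs w' <= r ->
    cabs (G w - G w') <= cabs (w - w') / 2.
  move=> wr wr'; rewrite -(ler_pM2l cp) -cabsM.
  have -> : c * (G w - G w') = - (F w - F w' - c * (w - w')) by rewrite /G; field.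
  by rewrite cabsN; have := lip _ _ wr wr'; lra.
have G0 : cabs (G 0) <= r / 2.
  rewrite /G sub0r cabsN cabsM cabsV ler_pdivrMr //; lra.
have zr : cabs (0 : C) <= r by rewrite cabs0 ltW.
have Gr w : cabs w <= r -> cabs (G w) <= r.
  move=> wr; have := Glip w 0 wr zr; rewrite subr0.
  have := cabsD (G w - G 0) (G 0); rewrite subrK; lra.
pose x n := iter n G (0 : C).
have xS n : x n.+1 = G (x n) by [].
have xr n : cabs (x n) <= r by elim: n => // n IHn; rewrite xS; exact: Gr.
have xd n : cabs (x n.+1 - x n) <= r / 2 ^+ n.+1.
  elim: n => [|n IHn]; first by rewrite subr0 expr1.
  have h := Glip _ _ (xr n.+1) (xr n); rewrite -!xS in h; apply: le_trans h _.
  by rewrite [in leRHS]exprSr invfM mulrA ler_wpM2r // invr_ge0.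
have cx : cvgn (series (fun n => x n.+1 - x n)).
  apply: (@abs_cvg_series R _ (geometric (r / 2) 2^-1)) => [n|].
    by apply: le_trans (xd n) _; rewrite /geometric /= exprVn exprS invfM mulrA.
  by apply: is_cvg_geometric_series; rewrite ger0_norm ?invr_ge0 // invf_lt1 // ltr1n.
have xE n : series (fun n => x n.+1 - x n) n = x n.
  by rewrite /series /= telescope_sumr // subr0.
have [w hw] : exists w : C, x @ \oo --> w.
  exists (limn (series (fun n => x n.+1 - x n))).
  move: cx; rewrite (_ : series (fun n => x n.+1 - x n) = x) //.
  by apply/funext => n; rewrite xE.
have wr : cabs w <= r := cabs_lim_le hw xr.
exists w; split; first exact: wr.
have hG : (fun n => x n.+1) @ \oo --> G w.
  apply/cvg_cabsP; move/cvg_cabsP: hw => hw.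
  apply: (@squeeze_cvgr _ _ _ _ (cst 0) (fun n => cabs (x n - w))); last exact: hw.
    apply: nearW => n; rewrite /= cabs_ge0 /=.
    by have := Glip _ _ (xr n) wr; rewrite -xS; have := cabs_ge0 (x n - w); lra.
  exact: cvg_cst.
have GE : G w = w by apply: cvgC_unique hG (cvg_comp _ _ (cvg_addnl 1) hw).
have : F w / c = 0 by rewrite -[LHS](subKr w) -/(G w) GE subrr.
by move=> /eqP; rewrite mulf_eq0 invr_eq0 (negbTE c0) orbF => /eqP.
Qed.

(** Near sigma the function Z^2 - Z2 is affine up to an error of relative size r on
    a disc of radius r, uniformly in the coefficients.  Hence closeness of finitely many
    coefficients gives the hypotheses of [newton_zero]. *)
Lemma zero_persists (a : nat -> C) (sigma : R) : cmult a -> 1 < sigma ->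
  dseries 0 a sigma%:C%C ^+ 2 = dseries 0 (sqr_coef a) (2 * sigma)%:C%C ->
  dseries 0 a sigma%:C%C * dseries 1 a sigma%:C%C
    - dseries 1 (sqr_coef a) (2 * sigma)%:C%C != 0 ->
  forall delta : R, 0 < delta ->
  exists (X : nat) (eta : R), 0 < eta /\ forall b, cmult b ->
    (forall n, (n < X)%N -> cabs (b n - a n) <= eta) ->
    exists w : C, cabs w < delta /\
      dseries 0 b (sigma%:C%C + w) ^+ 2 = dseries 0 (sqr_coef b) (2 * (sigma%:C%C + w)).
Proof.
move=> am s1 ZZ nc delta d0.
have s2 : 1 < 2 * sigma by lra.
have am2 := cmult_sqr am.
set Z := dseries 0 a _ in ZZ nc; set T := dseries 1 a _ in nc.
set Z2 := dseries 0 (sqr_coef a) _ in ZZ; set T2 := dseries 1 (sqr_coef a) _ in nc.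
pose c := - 2 * (Z * T - T2).
have c0 : c != 0 by rewrite mulf_neq0 // oppr_eq0 pnatr_eq0.
have cp : 0 < cabs c by rewrite cabs_gt0.
have [rho [B [rho0 B0 hB]]] := dseries_lipschitz s1.
have [rho' [B' [rho0' B0' hB']]] := dseries_lipschitz s2.
have S00 := log_sum_ge0 0 s1; have S10 := log_sum_ge0 1 s1.
set S0 := log_sum 0 sigma in S00; set S1 := log_sum 1 sigma in S10.
(* the defect from the slope c is at most r K + eta K', as the computation at the end shows *)
pose K := 2 * (S1 + B) * S1 + 2 * (S0 + S1 + B) * B + 4 * B'.
have K0 : 0 <= K by rewrite !addr_ge0 ?mulr_ge0 ?addr_ge0.
pose K' := 2 * S1 + 2 * S0 + 2.
have K0' : 0 < K' by rewrite /K'; lra.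
pose r := Num.min (Num.min 1 (delta / 2)) (Num.min (Num.min rho (rho' / 2)) (cabs c / (4 * (K + 1)))).
have r0 : 0 < r.
  by rewrite !lt_min ltr01 rho0 !divr_gt0 //; lra.
have r1 : r <= 1 by rewrite /r !ge_min lexx.
have rd : r <= delta / 2 by rewrite /r !ge_min lexx ?orbT.
have rrho : r <= rho by rewrite /r !ge_min lexx ?orbT.
have rrho' : r <= rho' / 2 by rewrite /r !ge_min lexx ?orbT.
have rK : r * K <= cabs c / 4.
  have h : r <= cabs c / (4 * (K + 1)) by rewrite /r !ge_min lexx ?orbT.
  have : r * (4 * (K + 1)) <= cabs c by rewrite -ler_pdivlMr //; lra.
  by lra.
pose eta := Num.min (cabs c / (4 * K')) (cabs c * r / (4 * K')).
have eta0 : 0 < eta.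
  by rewrite lt_min !divr_gt0 ?mulr_gt0.
have etaK : eta * K' <= cabs c / 4.
  have h : eta <= cabs c / (4 * K') by rewrite /eta ge_min lexx.
  have : eta * (4 * K') <= cabs c by rewrite -ler_pdivlMr // mulr_gt0.
  by lra.
have etaK' : eta * K' <= cabs c * r / 4.
  have h : eta <= cabs c * r / (4 * K') by rewrite /eta ge_min lexx orbT.
  have : eta * (4 * K') <= cabs c * r by rewrite -ler_pdivlMr // mulr_gt0.
  by lra.
have [X1 [e1 [e10 h1]]] := dseries_near 0 s1 eta0.
have [X2 [e2 [e20 h2]]] := dseries_near 1 s1 eta0.
have [X3 [e3 [e30 h3]]] := dseries_near 0 s2 eta0.
have [X4 [e4 [e40 h4]]] := dseries_near 1 s2 eta0.
exists (maxn (maxn X1 X2) (maxn X3 X4)).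
pose e := Num.min (Num.min e1 e2) (Num.min (e3 / 2) (e4 / 2)).
exists e; split; first by rewrite !lt_min e10 e20 !divr_gt0.
move=> b bm ab.
have bm2 := cmult_sqr bm.
have ca := cmult_coef am; have cb := cmult_coef bm.
have ca2 := cmult_coef am2; have cb2 := cmult_coef bm2.
have ab2 n : cabs (sqr_coef b n - sqr_coef a n) <= 2 * cabs (b n - a n).
  rewrite /sqr_coef subr_sqr cabsM mulrC ler_wpM2r ?cabs_ge0 //.
  apply: le_trans (cabsD _ _) _.
  by have := ca.2 n; have := cb.2 n; lra.
have b1 : cabs (dseries 0 b sigma%:C%C - Z) <= eta.
  apply: h1 => // n nX; apply: le_trans (ab n _) _; first by rewrite !leq_max nX.
  by rewrite /e !ge_min lexx.
have b2 : cabs (dseries 1 b sigma%:C%C - T) <= eta.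
  apply: h2 => // n nX; apply: le_trans (ab n _) _; first by rewrite !leq_max nX ?orbT.
  by rewrite /e !ge_min lexx ?orbT.
have b3 : cabs (dseries 0 (sqr_coef b) (2 * sigma)%:C%C - Z2) <= eta.
  apply: h3 => // n nX; apply: le_trans (ab2 n) _.
  have : cabs (b n - a n) <= e by apply: ab; rewrite !leq_max nX ?orbT.
  have : e <= e3 / 2 by rewrite /e !ge_min lexx ?orbT.
  by lra.
have b4 : cabs (dseries 1 (sqr_coef b) (2 * sigma)%:C%C - T2) <= eta.
  apply: h4 => // n nX; apply: le_trans (ab2 n) _.
  have : cabs (b n - a n) <= e by apply: ab; rewrite !leq_max nX ?orbT.
  have : e <= e4 / 2 by rewrite /e !ge_min lexx ?orbT.
  by lra.
pose A w := dseries 0 b (sigma%:C%C + w).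
pose A2 w := dseries 0 (sqr_coef b) ((2 * sigma)%:C%C + 2 * w).
have A0 : A 0 = dseries 0 b sigma%:C%C by rewrite /A addr0.
have A20 : A2 0 = dseries 0 (sqr_coef b) (2 * sigma)%:C%C by rewrite /A2 mulr0 addr0.
suff [w [wr Fw]] : exists w, cabs w <= r /\ A w ^+ 2 - A2 w = 0.
  exists w; split; first by lra.
  have := subr0_eq Fw; rewrite /A /A2 => ->; congr (dseries 0 _ _).
  by rewrite mulrDr rmorphM /= rmorph_nat.
have bT : cabs (dseries 1 b sigma%:C%C) <= S1 by apply: dseries_le.
have bZ : cabs (dseries 0 b sigma%:C%C) <= S0 by apply: dseries_le.
have bZa : cabs Z <= S0 by apply: dseries_le.
apply: (@newton_zero (fun w => A w ^+ 2 - A2 w) c r c0 r0); last first.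
  rewrite A0 A20.
  have -> : dseries 0 b sigma%:C%C ^+ 2 - dseries 0 (sqr_coef b) (2 * sigma)%:C%C =
     (dseries 0 b sigma%:C%C - Z) * (dseries 0 b sigma%:C%C + Z)
       - (dseries 0 (sqr_coef b) (2 * sigma)%:C%C - Z2).
    by rewrite -subr_sqr ZZ; ring.
  apply: le_trans (cabsD _ _) _; rewrite cabsM cabsN.
  have q : cabs (dseries 0 b sigma%:C%C + Z) <= 2 * S0.
    by apply: le_trans (cabsD _ _) _; lra.
  have := ler_pM (cabs_ge0 _) (cabs_ge0 _) b1 q.
  have : 0 <= eta * S1 by rewrite mulr_ge0 // ltW.
  have : 0 <= cabs c * r by rewrite mulr_ge0 ?cabs_ge0 // ltW.
  move: etaK' b3; rewrite /K'; lra.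
move=> w w' wr wr'.
have nb2 x : cabs x <= r -> cabs (2 * x) <= 2 * r.
  by move=> xr; rewrite cabsM cabs_natr; lra.
have L1 := hB b r w w' cb rrho wr wr'.
have zr : cabs (0 : C) <= r by rewrite cabs0 ltW.
have L2 : cabs (A2 w - A2 w' + dseries 1 (sqr_coef b) (2 * sigma)%:C%C * (2 * (w - w')))
    <= 4 * B' * r * cabs (w - w').
  have := hB' (sqr_coef b) (2 * r) (2 * w) (2 * w') cb2 _ (nb2 _ wr) (nb2 _ wr').
  rewrite -mulrBr cabsM cabs_natr /A2 => h.
  by have : 2 * r <= rho' by [lra]; move=> /h; lra.
have bA x : cabs x <= r -> cabs (A x - dseries 0 b sigma%:C%C) <= (S1 + B) * r.
  move=> xr; have h := hB b r x 0 cb rrho xr zr.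
  rewrite addr0 subr0 -/(A x) in h.
  have -> : A x - dseries 0 b sigma%:C%C =
    (A x - dseries 0 b sigma%:C%C + dseries 1 b sigma%:C%C * x) - dseries 1 b sigma%:C%C * x by ring.
  apply: le_trans (cabsD _ _) _; rewrite cabsN cabsM.
  have q1 := ler_pM (cabs_ge0 _) (cabs_ge0 _) bT xr.
  have q2 : B * r * cabs x <= B * r * 1.
    by apply: ler_wpM2l; [rewrite mulr_ge0 // ltW | exact: le_trans r1].
  by lra.
have h1w := bA w wr; have h1w' := bA w' wr'.
rewrite -/(A w) -/(A w') in L1.
set Tb := dseries 1 b _ in b2 bT L1; set T2b := dseries 1 (sqr_coef b) _ in b4 L2.
set Zb := dseries 0 b _ in b1 bZ h1w h1w'.
set d := cabs (w - w') in L1 L2 *; have dge : 0 <= d := cabs_ge0 _.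
set E1 := A w - A w' + _ in L1; set E2 := A2 w - A2 w' + _ in L2.
(* Z is the value of A at 0 for the limiting coefficients *)
pose U := A w + A w' - 2 * Z.
have U_le : cabs U <= 2 * (S1 + B) * r + 2 * eta.
  have -> : U = (A w - Zb) + (A w' - Zb) + 2 * (Zb - Z) by rewrite /U; ring.
  apply: le_trans (cabsD _ _) _.
  have := cabsD (A w - Zb) (A w' - Zb); rewrite cabsM cabs_natr; lra.
have V_le : cabs (A w + A w') <= 2 * (S0 + S1 + B).
  have -> : A w + A w' = (A w - Zb) + (A w' - Zb) + 2 * Zb by ring.
  apply: le_trans (cabsD _ _) _.
  have := cabsD (A w - Zb) (A w' - Zb); rewrite cabsM cabs_natr.
  have : (S1 + B) * r <= (S1 + B) * 1 by rewrite ler_wpM2l // addr_ge0.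
  lra.
have -> : A w ^+ 2 - A2 w - (A w' ^+ 2 - A2 w') - c * (w - w') =
   (- (U * Tb) - 2 * Z * (Tb - T) + 2 * (T2b - T2)) * (w - w') + (A w + A w') * E1 - E2.
  by rewrite /c /U /E1 /E2; ring.
have m1 : cabs (U * Tb) <= (2 * (S1 + B) * r + 2 * eta) * S1.
  by rewrite cabsM ler_pM ?cabs_ge0.
have m2 : cabs (2 * Z * (Tb - T)) <= 2 * S0 * eta.
  by rewrite cabsM ler_pM ?cabs_ge0 // cabsM cabs_natr ler_wpM2l.
have m3 : cabs (2 * (T2b - T2)) <= 2 * eta by rewrite cabsM cabs_natr ler_wpM2l.
have m4 : cabs ((A w + A w') * E1) <= 2 * (S0 + S1 + B) * (B * r * d).
  by rewrite cabsM ler_pM ?cabs_ge0.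
have m5 : cabs (- (U * Tb) - 2 * Z * (Tb - T) + 2 * (T2b - T2)) <=
   (2 * (S1 + B) * r + 2 * eta) * S1 + 2 * S0 * eta + 2 * eta.
  apply: le_trans (cabsD _ _) _; apply: lerD m3.
  by apply: le_trans (cabsD _ _) _; rewrite !cabsN; exact: lerD.
have m6 : cabs ((- (U * Tb) - 2 * Z * (Tb - T) + 2 * (T2b - T2)) * (w - w')) <=
   ((2 * (S1 + B) * r + 2 * eta) * S1 + 2 * S0 * eta + 2 * eta) * d.
  by rewrite cabsM ler_wpM2r.
apply: le_trans (cabsD _ _) _; rewrite cabsN.
apply: le_trans (lerD (le_trans (cabsD _ _) (lerD m6 m4)) L2) _.
have -> : ((2 * (S1 + B) * r + 2 * eta) * S1 + 2 * S0 * eta + 2 * eta) * d +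
    2 * (S0 + S1 + B) * (B * r * d) + 4 * B' * r * d = (r * K + eta * K') * d.
  by rewrite /K /K'; ring.
by rewrite ler_wpM2r //; lra.
Qed.

End Newton.

(** * The Cayley transform of the unit disc *)

Section Angles.
Variable R : realType.
Local Notation C := (Cplx R).

Definition cis (y : R) : C := (cos y +i* sin y)%C.

Lemma cisD x y : cis (x + y) = cis x * cis y.
Proof.
by apply: complex_eqP; rewrite ?ReM ?ImM /= ?cosD ?sinD //; ring.
Qed.

Lemma cis0 : cis 0 = 1.
Proof. by apply: complex_eqP; rewrite /= ?cos0 ?sin0. Qed.

Lemma cis_sum (t : nat -> R) N : cis (\sum_(0 <= i < N) t i) = \prod_(0 <= i < N) cis (t i).
Proof. by apply: (big_morph cis cisD cis0). Qed.

Lemma cvg_cis (y : nat -> R) (l : R) : y @ \oo --> l -> (fun n => cis (y n)) @ \oo --> cis l.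
Proof.
move=> h; apply: cvg_ReIm => /=.
  exact: (cvg_comp _ _ h (@continuous_cos R l)).
exact: (cvg_comp _ _ h (@continuous_sin R l)).
Qed.

Lemma sin_atan (x : R) : sin (atan x) = x / Num.sqrt (1 + x ^+ 2).
Proof.
have c := cos_atan x; have := atanK x; rewrite /tan => h.
have s0 : 0 < Num.sqrt (1 + x ^+ 2) by rewrite sqrtr_gt0 ltr_wpDr // sqr_ge0.
have c0 : cos (atan x) != 0 by rewrite c invr_eq0 gt_eqF.
have := congr1 (fun y => y * cos (atan x)) h.
by rewrite divfK // => ->; rewrite c.
Qed.

Lemma polar_right_half (w : C) : 0 < complex.Re w ->
  w = (cabs w)%:C%C * cis (atan (complex.Im w / complex.Re w)).
Proof.
move=> u0; set u := complex.Re w in u0 *; set v := complex.Im w.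
have E : cabs w = u * Num.sqrt (1 + (v / u) ^+ 2).
  have -> : u = Num.sqrt (u ^+ 2) by rewrite sqrtr_sqr ger0_norm // ltW.
  rewrite -sqrtrM ?sqr_ge0 // sqrtr_sqr ger0_norm ?(ltW u0) //.
  have -> : u ^+ 2 * (1 + (v / u) ^+ 2) = cabs w ^+ 2.
    by rewrite cabs_sqr -/u -/v; field; rewrite gt_eqF.
  by rewrite sqrtr_sqr ger0_norm // cabs_ge0.
have s0 : 0 < Num.sqrt (1 + (v / u) ^+ 2) by rewrite sqrtr_gt0 ltr_wpDr // sqr_ge0.
apply: complex_eqP; rewrite ?ReM ?ImM /= E cos_atan ?sin_atan mul0r ?subr0 ?addr0 -/u -/v.
  by rewrite mulfK // gt_eqF.
by move: (Num.sqrt _) s0 => q q0; field; rewrite !gt_eqF.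
Qed.

(** The Cayley transform maps the disc to the right half-plane, where the argument
    is an arc tangent. *)
Lemma cayley_polar (z : C) : cabs z < 1 ->
  (1 + z) / (1 - z) = (cabs ((1 + z) / (1 - z)))%:C%C
     * cis (atan (2 * complex.Im z / (1 - cabs z ^+ 2))).
Proof.
move=> z1.
have n0 : 1 - z != 0.
  rewrite subr_eq0; apply/eqP => h; by rewrite -h cabs1 ltxx in z1.
have p0 : 0 < cabs (1 - z) ^+ 2 by rewrite exprn_gt0 // cabs_gt0.
have q0 : 0 < 1 - cabs z ^+ 2 by rewrite subr_gt0 expr_lt1 // cabs_ge0.
set w := (1 + z) / (1 - z).
have wE : w * ((cabs (1 - z) ^+ 2)%:C%C : C) = (1 + z) * (conjc (1 - z) : C).
  by rewrite -mul_conjc /w mulrA divfK.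
have wRe : complex.Re w * cabs (1 - z) ^+ 2 = 1 - cabs z ^+ 2.
  have := congr1 (fun x : C => complex.Re x) wE; rewrite ReM /= mulr0 subr0 => ->.
  rewrite cabs_sqr; case: (z) => a b /=; ring.
have wIm : complex.Im w * cabs (1 - z) ^+ 2 = 2 * complex.Im z.
  have := congr1 (fun x : C => complex.Im x) wE; rewrite ImM /= mulr0 add0r => ->.
  case: (z) => a b /=; ring.
have Re0 : 0 < complex.Re w by rewrite -(pmulr_lgt0 _ p0) wRe.
rewrite {1}(polar_right_half Re0) -wIm -wRe; congr (_ * cis (atan _)).
by field; rewrite cabs_eq0 n0 gt_eqF.
Qed.

Lemma cabs_cayley (z : C) :
  cabs ((1 + z) / (1 - z)) ^+ 2 =
  (1 + cabs z ^+ 2 + 2 * complex.Re z) / (1 + cabs z ^+ 2 - 2 * complex.Re z).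
Proof.
rewrite cabsM cabsV exprMn exprVn !cabs_sqr.
by case: z => a b /=; congr (_ / _); ring.
Qed.

Lemma atan_double (x : R) : 0 < x -> x < 1 -> atan (2 * x / (1 - x ^+ 2)) = 2 * atan x.
Proof.
move=> x0 x1.
have a0 : 0 < atan x by rewrite -(@atan0 R) lt_atan.
have a1 : atan x < pi / 4 by rewrite -(@atan1 R) lt_atan.
have c0 : cos (atan x) != 0.
  by rewrite cos_atan invr_eq0 gt_eqF // sqrtr_gt0 ltr_wpDr // sqr_ge0.
have -> : 2 * x / (1 - x ^+ 2) = tan (2 * atan x).
  by rewrite [in RHS]mulr_natl tan_mulr2n // atanK mulr_natl.
by rewrite tanK // in_itv /=; apply/andP; split; lra.
Qed.

Lemma atan_gt0 (x : R) : 0 < x -> 0 < atan x.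
Proof. by move=> x0; rewrite -(@atan0 R) lt_atan. Qed.

(** On the imaginary axis the Cayley transform is unimodular. *)
Lemma cayley_i (x : R) (b : bool) : 0 < x -> x < 1 ->
  let z : C := (0 +i* ((-1) ^+ b * x))%C in
  (1 + z) / (1 - z) = cis ((-1) ^+ b * (2 * atan x)).
Proof.
move=> x0 x1 z.
have zx : cabs z ^+ 2 = x ^+ 2 by rewrite cabs_sqr /= expr0n add0r exprMn sqrr_sign mul1r.
have z1 : cabs z < 1.
  by rewrite -(@expr_lt1 _ 2) ?cabs_ge0 // zx expr_lt1 // ltW.
rewrite (cayley_polar z1) zx.
have -> : cabs ((1 + z) / (1 - z)) = 1.
  have zRe : complex.Re z = 0 by [].
  have := cabs_cayley z; rewrite zx zRe mulr0 addr0 subr0 divff; last first.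
    by rewrite gt_eqF // ltr_wpDr // sqr_ge0.
  by move=> /eqP; rewrite sqrf_eq1 => /orP[/eqP //|/eqP h]; have := cabs_ge0 ((1 + z) / (1 - z)); rewrite h ler0N1.
rewrite mul1r /=; case: b z zx z1 => /= z zx z1.
  by rewrite expr1 !mulN1r mulrN mulNr atanN atan_double.
by rewrite expr0 !mul1r atan_double.
Qed.

End Angles.

(** * Choice of the phases *)

Section PhaseChoice.
Variable R : realType.
Local Notation C := (Cplx R).

Definition atan_weight (x : R) : R := (1 + x ^+ 2) * atan x.

Lemma is_derive_atan_weight (x : R) :
  is_derive x 1 atan_weight (2 * x * atan x + 1).
Proof.
have h1 : is_derive x 1 (fun y : R => 1 + y ^+ 2) (2 * x).
  by apply: is_derive_eq; rewrite add0r /GRing.scale /=; ring.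
have h2 : is_derive x 1 atan_weight ((1 + x ^+ 2) *: (1 + x ^+ 2)^-1 + atan x *: (2 * x)).
  exact: is_deriveM.
apply: (is_derive_eq h2).
rewrite /GRing.scale /= mulfV; first by ring.
by rewrite gt_eqF // ltr_wpDr // sqr_ge0.
Qed.

Lemma atan_weight_gt0 x : 0 < x -> 0 < atan_weight x.
Proof. by move=> x0; rewrite mulr_gt0 ?atan_gt0 // ltr_wpDr // sqr_ge0. Qed.

(** The function (1 + x^2) atan x vanishes at 0 and has an increasing derivative, so
    its quotient by x increases.  Both the ratio of two angles as a function of sigma
    and the non-vanishing of the slope in the degenerate case come from this. *)
Lemma atan_weight_star (x y : R) : 0 < x -> x <= y ->
  atan_weight x * y <= atan_weight y * x.
Proof.
move=> x0 xy; have d := is_derive_atan_weight.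
have [c /andP[c0 cx] hc] := mean_value d (ltW x0).
have [e /andP[xe ey] he] := mean_value d xy.
have h0 : atan_weight 0 = 0 by rewrite /atan_weight atan0 mulr0.
rewrite h0 !subr0 in hc.
have ce : 2 * c * atan c + 1 <= 2 * e * atan e + 1.
  rewrite lerD2r ler_pM ?mulr_ge0 //.
  - by rewrite -(@atan0 R) le_atan.
  - by rewrite ler_pM2l //; apply: le_trans xe.
  - by rewrite le_atan //; apply: le_trans xe.
have : atan_weight x * (y - x) <= (atan_weight y - atan_weight x) * x.
  rewrite he hc mulrAC ler_wpM2r // ?(ltW x0) //.
  by rewrite ler_wpM2r // subr_ge0.
lra.
Qed.

Variables (x l : nat -> R).
Hypothesis x01 : forall i, 0 < x i < 1.
Hypothesis x_decr : forall i j, (i < j)%N -> x j < x i.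
Hypothesis l_gt0 : forall i, 0 < l i.
Hypothesis l_incr : forall i j, (i < j)%N -> l i < l j.

Let theta i := 2 * atan (x i).
Let x0 i : 0 < x i. Proof. by have /andP[] := x01 i. Qed.
Let x1 i : x i < 1. Proof. by have /andP[] := x01 i. Qed.
Let theta0 i : 0 < theta i. Proof. by rewrite mulr_gt0 // atan_gt0. Qed.

Variable Theta : R.
Hypothesis cTheta : series theta @ \oo --> Theta.
Hypothesis first_angle : 2 * theta 0%N < Theta.

Definition cayley_prod (z : nat -> C) (N : nat) : C :=
  \prod_(0 <= i < N) ((1 + z i) / (1 - z i)).

Definition slope_sum (z : nat -> C) (N : nat) : C :=
  \sum_(0 <= i < N) ((l i)%:C)%C * (z i / (1 - z i ^+ 2)).

(** The prime at which the total angle changes its sign; the hypothesis on the first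
    angle excludes the index 0. *)
Lemma flip_index : exists2 n : nat, (0 < n)%N &
  2 * series theta n <= Theta /\ Theta < 2 * series theta n.+1.
Proof.
have Th0 : 0 < Theta by apply: lt_trans first_angle; rewrite mulr_gt0.
have ex : exists n, Theta < 2 * series theta n.+1.
  move/cvgrPdist_lt: cTheta => /(_ (Theta / 2)); rewrite divr_gt0 // => /(_ isT).
  move=> [N _ /(_ N.+1)] /=; rewrite leqnSn => /(_ isT) h; exists N.
  by move: h; rewrite ltr_norml => /andP[_]; lra.
have ex' : exists n, `[< Theta < 2 * series theta n.+1 >].
  by have [n hn] := ex; exists n; exact/asboolP.
case: (ex_minnP ex') => n /asboolP hn nmin; exists n; last first.
  split=> //; case: n hn nmin => [_ _|n hn nmin].
    by rewrite /series /= big_geq // mulr0 ltW.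
  rewrite leNgt; apply/negP => h.
  by have := nmin n (asboolT h); rewrite ltnn.
case: n hn {nmin} => //; rewrite /series /= big_nat1 => h.
by have := lt_trans h first_angle; rewrite ltxx.
Qed.

(** From the index m on the angles are those of the phase -i, so only a finite
    balance has to be checked. *)
Lemma cvg_prod_one (w : nat -> C) (t : nat -> R) (m : nat) :
  (forall i, (m <= i)%N -> t i = - theta i) ->
  series t m + series theta m = Theta ->
  (forall N, (m <= N)%N -> \prod_(0 <= i < N) w i = cis (series t N)) ->
  (fun N => \prod_(0 <= i < N) w i) @ \oo --> (1 : C).
Proof.
move=> tm tE wE.
have E : \forall N \near \oo, cis (Theta - series theta N) = \prod_(0 <= i < N) w i.
  near=> N; have mN : (m <= N)%N by near: N; exact: nbhs_infty_ge.
  rewrite wE //; congr cis; rewrite -tE.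
  have e1 := sub_series_geq t mN; have e2 := sub_series_geq theta mN.
  have e3 : \sum_(m <= k < N) t k = - \sum_(m <= k < N) theta k.
    by rewrite -sumrN; apply: eq_big_nat => i /andP[mi _]; exact: tm.
  by lra.
apply: cvg_trans (near_eq_cvg E) _.
rewrite -cis0; apply: cvg_cis; rewrite -(subrr Theta).
by apply: cvgB => //; exact: cvg_cst.
Unshelve. all: by end_near.
Qed.


Lemma Re_scale (r : R) (w : C) : complex.Re ((r%:C)%C * w) = r * complex.Re w.
Proof. by rewrite ReM /= mul0r subr0. Qed.

Lemma slope_imag (lam y : R) : ((lam)%:C)%C * ((0 +i* y)%C / (1 - (0 +i* y)%C ^+ 2)) =
  (0 +i* (lam * (y / (1 + y ^+ 2))))%C :> C.
Proof.
have -> : 1 - (0 +i* y)%C ^+ 2 = (1 + y ^+ 2)%:C%C :> C.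
  by rewrite expr2; apply: complex_eqP => /=; ring.
rewrite -fmorphV; apply: complex_eqP; rewrite /=; ring.
Qed.

Lemma Re_slope (z : C) : cabs z < 1 ->
  complex.Re (z / (1 - z ^+ 2)) = complex.Re z * (1 - cabs z ^+ 2) /
    ((1 + cabs z ^+ 2) ^+ 2 - 4 * complex.Re z ^+ 2).
Proof.
move=> z1.
have n0 : 1 - z ^+ 2 != 0.
  by rewrite subr_eq0; apply/eqP => h; have := expr_lt1 (isT : (0 < 2)%N) (cabs_ge0 z);
     rewrite z1 -cabsX -h cabs1 ltxx.
have p0 : 0 < cabs (1 - z ^+ 2) ^+ 2 by rewrite exprn_gt0 // cabs_gt0.
have E : (1 + cabs z ^+ 2) ^+ 2 - 4 * complex.Re z ^+ 2 = cabs (1 - z ^+ 2) ^+ 2.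
  by rewrite !cabs_sqr; case: (z) => a b; rewrite [_ ^+ 2 : C]expr2 /=; ring.
have wE : (z / (1 - z ^+ 2)) * ((cabs (1 - z ^+ 2) ^+ 2)%:C%C : C) =
    z * (conjc (1 - z ^+ 2) : C).
  by rewrite -mul_conjc mulrA divfK.
have h := congr1 (fun x : C => complex.Re x) wE.
rewrite ReM [X in _ - _ * X]/= mulr0 subr0 [complex.Re (_%:C)%C]/= in h.
rewrite E; apply: (mulIf (lt0r_neq0 p0)); rewrite h divfK ?gt_eqF //.
by rewrite cabs_sqr; case: (z) => a b; rewrite [_ ^+ 2 : C]expr2 /=; ring.
Qed.

(** With all phases equal to i or -i the slope is purely imaginary, with terms
    rho_i theta_i of the same sign as the angles.  The angles balance and rho increases,
    so the terms with phase -i win. *)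
Lemma phase_choice_degenerate n : (0 < n)%N -> 2 * series theta n = Theta ->
  exists z : nat -> C, [/\ forall i, cabs (z i) = x i,
    cayley_prod z @ \oo --> (1 : C) & forall L : C, slope_sum z @ \oo --> L -> L != 0].
Proof.
move=> n0 hn.
pose y i := (-1) ^+ (n <= i)%N * x i.
pose z i : C := (0 +i* y i)%C.
have y2 i : y i ^+ 2 = x i ^+ 2 by rewrite exprMn sqrr_sign mul1r.
exists z; split.
- move=> i; apply/eqP; rewrite -(eqrXn2 (_ : (0 < 2)%N)) ?cabs_ge0 ?(ltW (x0 i)) //.
  by rewrite cabs_sqr /= expr0n add0r y2.
- apply: (@cvg_prod_one _ (fun i => (-1) ^+ (n <= i)%N * theta i) n).
  + by move=> i ->; rewrite expr1 mulN1r.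
  + rewrite -hn mulr_natl mulr2n; congr (_ + _); apply: eq_big_nat => i /andP[_].
    by rewrite ltnNge => /negbTE ->; rewrite expr0 mul1r.
  + move=> N _; rewrite cis_sum; apply: eq_bigr => i _.
    exact: cayley_i.
- move=> L hL; apply/eqP => L0; rewrite L0 in hL.
  move: hL => /cvg_Im; rewrite /slope_sum /=.
  (* ratio of the i-th term of the slope to the i-th angle *)
  pose rho i := l i * x i / (2 * atan_weight (x i)).
  have aw0 i : 0 < atan_weight (x i) by exact: atan_weight_gt0.
  have rho_lt i j : (i < j)%N -> rho i < rho j.
    have p k : 0 < 2 * atan_weight (x k) by rewrite mulr_gt0.
    move=> ij; rewrite /rho ltr_pdivrMr ?p // mulrAC ltr_pdivlMr ?p //.
    have h := atan_weight_star (x0 j) (ltW (x_decr ij)).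
    apply: (@lt_le_trans _ _ (l j * x i * (2 * atan_weight (x j)))).
      by rewrite (ltr_pM2r (p j)) (ltr_pM2r (x0 i)) l_incr.
    have := ler_wpM2l (ltW (l_gt0 j)) h.
    set A := atan_weight _; set B := atan_weight _.
    move=> h'; have -> : l j * x i * (2 * A) = 2 * (l j * (A * x i)) by ring.
    by have -> : l j * x j * (2 * B) = 2 * (l j * (B * x j)) by [ring]; rewrite ler_pM2l.
  have vE i : l i * (y i / (1 + y i ^+ 2)) = (-1) ^+ (n <= i)%N * (rho i * theta i).
    rewrite y2 /y /rho /theta /atan_weight.
    have a0 : atan (x i) != 0 by rewrite gt_eqF // atan_gt0.
    have b0 : 1 + x i ^+ 2 != 0 by rewrite gt_eqF // ltr_wpDr // sqr_ge0.
    by field; rewrite a0 b0.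
  move=> h0.
  have hle : \forall N \near \oo, complex.Im (\sum_(0 <= i < N) ((l i)%:C)%C * (z i / (1 - z i ^+ 2)) : C)
      <= rho n.-1 * series theta n - rho n * (series theta N - series theta n).
    near=> N; have nN : (n <= N)%N by near: N; exact: nbhs_infty_ge.
    rewrite Im_sum (eq_bigr (fun i => (-1) ^+ (n <= i)%N * (rho i * theta i))); last first.
      by move=> i _; rewrite /z slope_imag -vE.
    rewrite sub_series_geq // (big_cat_nat (n := n)) //=; apply: lerD.
      rewrite /series /= mulr_sumr big_nat_cond [leRHS]big_nat_cond.
      apply: ler_sum => i /andP[/andP[_ h2] _].
      rewrite leqNgt h2 expr0 mul1r ler_wpM2r ?(ltW (theta0 i)) //.
      case: (ltngtP i n.-1) => [/rho_lt /ltW //| h3|-> //].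
      by move: h2 h3; lia.
    rewrite mulr_sumr -sumrN big_nat_cond [leRHS]big_nat_cond.
    apply: ler_sum => i /andP[/andP[h1 _] _].
    rewrite h1 expr1 mulN1r lerN2 ler_wpM2r ?(ltW (theta0 i)) //.
    by move: h1; rewrite leq_eqVlt => /predU1P[->//|/rho_lt /ltW].
  have hc : (fun N => rho n.-1 * series theta n - rho n * (series theta N - series theta n)) @ \oo -->
      (rho n.-1 * series theta n - rho n * (Theta - series theta n)).
    apply: cvgB; first exact: cvg_cst.
    by apply: cvgM; [exact: cvg_cst | apply: cvgB; [exact: cTheta | exact: cvg_cst]].
  have : complex.Im (0 : C) <= rho n.-1 * series theta n - rho n * (Theta - series theta n).
    exact: (ler_cvg_to h0 hc hle).
  have hlt : rho n.-1 < rho n by apply: rho_lt; rewrite prednK.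
  have S0 : 0 < series theta n.
    have : 0 < Theta by apply: lt_trans first_angle; rewrite mulr_gt0.
    by lra.
  have -> : Theta - series theta n = series theta n by lra.
  by rewrite -mulrBl pmulr_lge0 // subr_ge0 leNgt hlt.
Unshelve. all: by end_near.
Qed.


Lemma big_split2 (T : Type) (idx : T) (op : Monoid.com_law idx) (f : nat -> T) (n N : nat) :
  (0 < n)%N -> (n < N)%N -> \big[op/idx]_(0 <= i < N) f i =
  op (op (f 0%N) (f n)) (\big[op/idx]_(0 <= i < N | (i != 0%N) && (i != n)) f i).
Proof.
move=> n0 nN.
rewrite (bigD1_seq 0%N) ?mem_index_iota ?iota_uniq ?(leq_ltn_trans _ nN) //=.
rewrite -big_filter (bigD1_seq n) ?filter_uniq ?iota_uniq //=; last first.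
  by rewrite mem_filter mem_index_iota -lt0n n0 nN.
rewrite -Monoid.mulmA; congr (op _ _); congr (op _ _).
by rewrite big_filter_cond.
Qed.

Lemma sum_split2 (V : nmodType) (f : nat -> V) (n N : nat) : (0 < n)%N -> (n < N)%N ->
  \sum_(0 <= i < N) f i = f 0%N + f n + \sum_(0 <= i < N | (i != 0%N) && (i != n)) f i.
Proof. exact: big_split2. Qed.

Lemma prod_split2 (f : nat -> C) (n N : nat) : (0 < n)%N -> (n < N)%N ->
  \prod_(0 <= i < N) f i = f 0%N * f n * \prod_(0 <= i < N | (i != 0%N) && (i != n)) f i.
Proof. exact: big_split2. Qed.

(** In a disc of radius a the point u + i s has Cayley transform of modulus depending
    only on u / (1 + a^2); the point -u (1 + b^2) / (1 + a^2) + i v of radius b has the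
    inverse modulus.  As s goes from -a to a, the sum of the two arguments goes from
    2 atan b - 2 atan a to 2 atan b + 2 atan a.  The end points are excluded, whence
    u > 0. *)
Lemma balance_two (a b Cst : R) : 0 < a -> a < b -> b < 1 ->
  2 * atan b - 2 * atan a < Cst -> Cst < 2 * atan b + 2 * atan a ->
  exists u s v : R, [/\ 0 < u, u ^+ 2 + s ^+ 2 = a ^+ 2,
    (u * (1 + b ^+ 2) / (1 + a ^+ 2)) ^+ 2 + v ^+ 2 = b ^+ 2 &
    atan (2 * v / (1 - b ^+ 2)) + atan (2 * s / (1 - a ^+ 2)) = Cst].
Proof.
move=> a0 ab b1 h1 h2.
have b0 : 0 < b by apply: lt_trans ab.
have a1 : a < 1 by apply: lt_trans b1.
pose A := 1 + a ^+ 2; pose B := 1 + b ^+ 2.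
have A0 : 0 < A by rewrite ltr_wpDr // sqr_ge0.
have B0 : 0 < B by rewrite ltr_wpDr // sqr_ge0.
pose v s := Num.sqrt (b ^+ 2 - (a ^+ 2 - s ^+ 2) * (B / A) ^+ 2).
pose F s := atan (2 * v s / (1 - b ^+ 2)) + atan (2 * s / (1 - a ^+ 2)).
have cF : continuous F.
  move=> s; rewrite /F; apply: cvgD.
    apply: continuous_comp; last exact: continuous_atan.
    apply: cvgM; last exact: cvg_cst.
    apply: cvgM; first exact: cvg_cst.
    apply: continuous_comp; last exact: sqrt_continuous.
    apply: cvgB; first exact: cvg_cst.
    apply: cvgM; last exact: cvg_cst.
    by apply: cvgB; [exact: cvg_cst | exact: exprn_continuous].
  apply: continuous_comp; last exact: continuous_atan.
  apply: cvgM; last exact: cvg_cst.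
  by apply: cvgM; [exact: cvg_cst | exact: cvg_id].
have vb s : s ^+ 2 = a ^+ 2 -> v s = b.
  by move=> e; rewrite /v e subrr mul0r subr0 sqrtr_sqr ger0_norm // ltW.
have FN : F (- a) = 2 * atan b - 2 * atan a.
  by rewrite /F vb ?sqrrN // mulrN mulNr atanN !atan_double.
have FP : F a = 2 * atan b + 2 * atan a by rewrite /F vb // !atan_double.
have [|||s] := @IVT R F (- a) a Cst.
- by lra.
- by apply: continuous_subspaceT.
- by rewrite FN FP ge_min le_max (ltW h1) (ltW h2) orbT.
rewrite in_itv /= => /andP[s1 s2] Fs.
have sa : s != a by apply/eqP => e; move: Fs; rewrite e FP; lra.
have sNa : s != - a by apply/eqP => e; move: Fs; rewrite e FN; lra.
have s1' : - a < s by rewrite lt_neqAle eq_sym sNa.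
have s2' : s < a by rewrite lt_neqAle sa.
have w0 : 0 < a ^+ 2 - s ^+ 2.
  by rewrite subr_sqr mulr_gt0 //; lra.
pose u := Num.sqrt (a ^+ 2 - s ^+ 2).
have u2 : u ^+ 2 = a ^+ 2 - s ^+ 2 by rewrite sqr_sqrtr // ltW.
exists u, s, (v s); split => //.
- by rewrite sqrtr_gt0.
- by rewrite u2 subrK.
- have k1 : a * (B / A) <= b.
    rewrite mulrA ler_pdivrMr // /A /B.
    have : 0 <= (b - a) * (1 - a * b).
      rewrite mulr_ge0 ?subr_ge0 ?(ltW ab) //.
      by rewrite -[1]mulr1 ler_pM // ?ltW.
    have <- : b * (1 + a ^+ 2) - a * (1 + b ^+ 2) = (b - a) * (1 - a * b) by ring.
    by rewrite subr_ge0.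
  have k2 : (a * (B / A)) ^+ 2 <= b ^+ 2.
    have aBA0 : 0 <= a * (B / A) by rewrite mulr_ge0 ?divr_ge0 ?(ltW a0) ?(ltW A0) ?(ltW B0).
    by rewrite lerXn2r ?nnegrE ?(ltW b0).
  have s2p := sqr_ge0 s.
  rewrite -mulrA exprMn u2 /v sqr_sqrtr; first by rewrite addrC subrK.
  rewrite subr_ge0; apply: le_trans k2; rewrite [leRHS]exprMn.
  by rewrite ler_wpM2r ?sqr_ge0 // gerBl.
Qed.

(** Only the terms 0 and n of the slope have a real part.  These have opposite signs
    and do not cancel, since l increases while x decreases. *)
Lemma phase_choice_generic n : (0 < n)%N -> 2 * series theta n < Theta ->
  Theta < 2 * series theta n.+1 ->
  exists z : nat -> C, [/\ forall i, cabs (z i) = x i,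
    cayley_prod z @ \oo --> (1 : C) & forall L : C, slope_sum z @ \oo --> L -> L != 0].
Proof.
move=> n0 hn hn1.
(* angle to be made by the factors 0 and n together *)
pose Cst := Theta - series theta n.+1 - (series theta n - theta 0%N).
have SS : series theta n.+1 = series theta n + theta n by rewrite seriesSr.
have [||u [s [v [u0 us uv hC]]]] := @balance_two (x n) (x 0%N) Cst (x0 n) (x_decr n0) (x1 0).
- by rewrite /Cst SS /theta; rewrite /theta in hn; lra.
- by rewrite /Cst SS; rewrite SS in hn1; rewrite /theta in hn1 *; lra.
set a := x n in us uv hC; set b := x 0%N in uv hC.
pose A := 1 + a ^+ 2; pose B := 1 + b ^+ 2.
have A0 : 0 < A by rewrite ltr_wpDr // sqr_ge0.
have B0 : 0 < B by rewrite ltr_wpDr // sqr_ge0.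
pose z0 : C := (- (u * B / A) +i* v)%C.
pose zn : C := (u +i* s)%C.
pose z i : C := if i == 0%N then z0 else if i == n then zn else
  (0 +i* ((-1) ^+ (n < i)%N * x i))%C.
have z0E : z 0%N = z0 by [].
have znE : z n = zn by rewrite /z eqxx gtn_eqF.
have zE i : i != 0%N -> i != n -> z i = (0 +i* ((-1) ^+ (n < i)%N * x i))%C.
  by rewrite /z => /negbTE -> /negbTE ->.
have cz0 : cabs z0 ^+ 2 = b ^+ 2 by rewrite cabs_sqr /= sqrrN uv.
have czn : cabs zn ^+ 2 = a ^+ 2 by rewrite cabs_sqr /= us.
have cabs_from (w : C) i : cabs w ^+ 2 = x i ^+ 2 -> cabs w = x i.
  by move=> /eqP; rewrite eqrXn2 ?cabs_ge0 ?(ltW (x0 i)) // => /eqP.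
have cz i : cabs (z i) = x i.
  rewrite /z; case: eqP => [->|_]; first exact: cabs_from.
  case: eqP => [->|_]; first exact: cabs_from.
  by apply: cabs_from; rewrite cabs_sqr /= expr0n add0r exprMn sqrr_sign mul1r.
have cz1 i : cabs (z i) < 1 by rewrite cz.
have lt0 : cabs z0 < 1 by rewrite -z0E.
have ltn : cabs zn < 1 by rewrite -znE.
have ua : u <= a.
  by rewrite -(@ler_pXn2r _ 2) ?nnegrE ?(ltW u0) ?(ltW (x0 n)) // -us lerDl sqr_ge0.
have a1 : a < 1 := x1 n.
have Bu : 0 < A - 2 * u.
  have : 0 <= (1 - a) ^+ 2 by exact: sqr_ge0.
  have : (1 - a) ^+ 2 != 0 by rewrite sqrf_eq0 subr_eq0 gt_eqF.
  rewrite sqrrB expr1n mul1r => h1 h2; rewrite /A.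
  have h3 : 0 < 1 - a *+ 2 + a ^+ 2 by rewrite lt_def h1.
  move: h3; rewrite mulr2n; lra.
have Bu' : 0 < A + 2 * u by lra.
have two_factors : (1 + z0) / (1 - z0) * ((1 + zn) / (1 - zn)) = cis Cst.
  rewrite (cayley_polar lt0) (cayley_polar ltn) cz0 czn -/(v).
  rewrite [complex.Im z0]/= [complex.Im zn]/=.
  set m0 := cabs _; set mn := cabs _.
  have m1 : m0 * mn = 1.
    apply/eqP; rewrite -(@eqrXn2 _ 2) ?mulr_ge0 ?cabs_ge0 // expr1n exprMn.
    rewrite /m0 /mn !cabs_cayley // cz0 czn [complex.Re z0]/= [complex.Re zn]/= -/A -/B.
    have -> : 2 * (- (u * B / A)) = - (2 * u * (B / A)) by ring.
    have q1 : B - 2 * u * (B / A) = (B / A) * (A - 2 * u) by field; rewrite gt_eqF.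
    have q2 : B - - (2 * u * (B / A)) = (B / A) * (A + 2 * u) by field; rewrite gt_eqF.
    by apply/eqP; rewrite q1 q2; field; rewrite !gt_eqF.
  by rewrite mulrACA -(rmorphM (real_complex R)) m1 mul1r -cisD hC.
exists z; split => //.
- pose t i := if i == 0%N then Cst else if i == n then 0 else (-1) ^+ (n < i)%N * theta i.
  have tE i : i != 0%N -> i != n -> t i = (-1) ^+ (n < i)%N * theta i.
    by rewrite /t => /negbTE -> /negbTE ->.
  have t0 : t 0%N = Cst by [].
  have tn : t n = 0 by rewrite /t eqxx gtn_eqF.
  apply: (@cvg_prod_one _ t n.+1).
  + move=> i ni; rewrite tE ?ni ?expr1 ?mulN1r //; first by rewrite -lt0n (leq_trans _ ni).
    by rewrite gtn_eqF.
  + rewrite {1}/series /= (@sum_split2 _ _ n) // t0 tn addr0.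
    have e1 : series theta n.+1 = theta 0%N + theta n +
        \sum_(0 <= i < n.+1 | (i != 0%N) && (i != n)) theta i.
      by rewrite {1}/series /= (@sum_split2 _ _ n).
    rewrite (_ : \sum_(0 <= i < n.+1 | _) t i =
        \sum_(0 <= i < n.+1 | (i != 0%N) && (i != n)) theta i).
      by rewrite /Cst; lra.
    rewrite big_nat_cond [RHS]big_nat_cond; apply: eq_bigr => i.
    by move=> /andP[/andP[_]]; rewrite ltnS leqNgt => /negbTE h /andP[i0 ni]; rewrite tE // h expr0 mul1r.
  + move=> N nN; rewrite cis_sum !(@prod_split2 _ n) //.
    rewrite z0E znE t0 tn cis0 mulr1; congr (_ * _); first exact: two_factors.
    apply: eq_bigr => i /andP[i0 ni].
    by rewrite tE // zE //; exact: cayley_i.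
- move=> L hL; apply/eqP => L0; rewrite L0 in hL; have h := cvg_Re hL.
  pose D := A ^+ 2 - 4 * u ^+ 2.
  have D0 : 0 < D.
    by have -> : D = (A - 2 * u) * (A + 2 * u) by [rewrite /D; ring]; rewrite mulr_gt0.
  (* real part of the slope, constant once N > n *)
  pose val := u / D * (l n * (1 - a ^+ 2) - l 0%N * (1 - b ^+ 2) * (A / B)).
  have E : \forall N \near \oo, val = complex.Re (slope_sum z N).
    near=> N; have nN : (n < N)%N by near: N; exact: nbhs_infty_gt.
    rewrite /slope_sum (@sum_split2 _ _ n) // !ReD Re_sum [X in _ + X]big1 ?addr0; last first.
      by move=> i /andP[i0 ni]; rewrite zE // slope_imag.
    rewrite z0E znE !Re_scale.
    rewrite !Re_slope // cz0 czn [complex.Re z0]/= [complex.Re zn]/= -/A -/B.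
    rewrite /val.
    have -> : B ^+ 2 - 4 * (- (u * B / A)) ^+ 2 = D * (B / A) ^+ 2.
      by rewrite /D; field; rewrite gt_eqF.
    rewrite -/D; field; rewrite !gt_eqF //.
  have hv : (fun=> val) @ \oo --> (0 : R).
    apply: cvg_trans h; apply: near_eq_cvg.
    by move: E; apply: filterS => N ->.
  have : val = 0.
    rewrite -(lim_cst (@Rhausdorff R) (F := \oo) val).
    exact: (cvg_lim (@Rhausdorff R) hv).
  apply/eqP; rewrite gt_eqF // mulr_gt0 ?divr_gt0 // subr_gt0.
  have ab : a < b := x_decr n0.
  have a0 : 0 < a := x0 n.
  have b1 : b < 1 := x1 0.
  have sq : a ^+ 2 < b ^+ 2 by rewrite ltr_pXn2r ?nnegrE ?ltW // (lt_trans a0).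
  have sb : b ^+ 2 < 1 by rewrite expr_lt1 // ltW // (lt_trans a0).
  apply: (@le_lt_trans _ _ (l 0%N * (1 - a ^+ 2))).
    rewrite -mulrA ler_wpM2l ?(ltW (l_gt0 0)) // mulrA ler_pdivrMr // /A /B.
    have p : 0 <= a ^+ 2 := sqr_ge0 a.
    rewrite -subr_ge0.
    have -> : (1 - a ^+ 2) * (1 + b ^+ 2) - (1 - b ^+ 2) * (1 + a ^+ 2) = 2 * (b ^+ 2 - a ^+ 2) by ring.
    by lra.
  by rewrite ltr_pM2r ?l_incr //; lra.
Unshelve. all: by end_near.
Qed.

Lemma phase_choice :
  exists z : nat -> C, [/\ forall i, cabs (z i) = x i,
    cayley_prod z @ \oo --> (1 : C) & forall L : C, slope_sum z @ \oo --> L -> L != 0].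
Proof.
have [n n0 [h1 h2]] := flip_index.
move: h1; rewrite le_eqVlt => /predU1P[h|h].
  exact: phase_choice_degenerate n0 h.
exact: phase_choice_generic n0 h h2.
Qed.

End PhaseChoice.

(** * The angles of the primes below sigma_b *)

Section ThetaMonotone.
Variable R : realType.

Lemma atan_le (x : R) : 0 <= x -> atan x <= x.
Proof.
move=> x0; have [c _ h] := mean_value (@is_derive1_atan R) x0.
rewrite atan0 !subr0 in h; rewrite h -[leRHS]mul1r ler_wpM2r //.
by rewrite invf_le1 ?lerDl ?sqr_ge0 // ltr_wpDr // sqr_ge0.
Qed.

Lemma is_derive_ln_atan (m s : R) :
  is_derive s 1 (fun t : R => ln (atan (expR (- m * t))))
    (- (m * expR (- m * s) / atan_weight (expR (- m * s)))).
Proof.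
set X := expR (- m * s); have X0 : 0 < X := expR_gt0 _.
have a0 : 0 < atan X := atan_gt0 X0.
have h1 : is_derive s 1 (fun t : R => - m * t) (- m).
  by apply: is_derive_eq; rewrite /GRing.scale /= mulr1.
have h2 : is_derive s 1 (fun t : R => expR (- m * t)) (- m * X).
  by have := is_derive1_comp (f := @expR R) (g := fun t => - m * t)
    (is_derive_expR (- m * s)) h1; rewrite mulrC.
have h3 : is_derive s 1 (fun t : R => atan (expR (- m * t))) ((- m * X) * (1 + X ^+ 2)^-1).
  by have := is_derive1_comp (f := @atan R) (g := fun t => expR (- m * t))
    (is_derive1_atan X) h2; rewrite mulrC.
have h4 := is_derive1_comp (f := @ln R) (g := fun t => atan (expR (- m * t)))
  (is_derive1_ln a0) h3.
apply: (is_derive_eq h4); rewrite /atan_weight.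
have : 1 + X ^+ 2 != 0 by rewrite gt_eqF // ltr_wpDr // sqr_ge0.
have : atan X != 0 by rewrite gt_eqF.
by move: (atan X) => y y0 q0; field; rewrite q0 y0.
Qed.

(** The logarithmic derivative in s of the angle of base exp(-m s) is
    - m X / ((1 + X^2) atan X) with X = exp (- m s); by [atan_weight_star] it is the
    larger in absolute value for the larger m. *)
Lemma theta_ratio (l m s t : R) : 0 < l -> l < m -> 0 < s -> s < t ->
  atan (expR (- m * t)) * atan (expR (- l * s)) <
  atan (expR (- m * s)) * atan (expR (- l * t)).
Proof.
move=> l0 lm s0 st.
pose psi y := ln (atan (expR (- m * y))) - ln (atan (expR (- l * y))).
have dpsi y := is_deriveB (is_derive_ln_atan m y) (is_derive_ln_atan l y).
have [c /andP[sc ct] h] := mean_value dpsi (ltW st).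
have pos k y : 0 < atan (expR (- k * y)) by rewrite atan_gt0 // expR_gt0.
have c0 : 0 < c by apply: lt_le_trans sc.
set X := expR (- m * c) in h; set Y := expR (- l * c) in h.
have X0 : 0 < X := expR_gt0 _; have Y0 : 0 < Y := expR_gt0 _.
have XY : X <= Y by rewrite ler_expR !mulNr lerN2 ler_wpM2r // ltW.
have hs := atan_weight_star X0 XY.
have wX := atan_weight_gt0 X0; have wY := atan_weight_gt0 Y0.
have key : l * Y / atan_weight Y < m * X / atan_weight X.
  apply: (@lt_le_trans _ _ (m * Y / atan_weight Y)).
    by rewrite ltr_pM2r ?invr_gt0 // ltr_pM2r.
  rewrite -!mulrA ler_wpM2l ?(ltW (lt_trans l0 lm)) // ler_pdivrMr // mulrAC ler_pdivlMr //.
  by rewrite mulrC [leRHS]mulrC.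
have : psi t - psi s < 0.
  rewrite /psi h pmulr_llt0 ?subr_gt0 //; lra.
rewrite /psi => h0.
suff : ln (atan (expR (- m * t)) * atan (expR (- l * s))) <
    ln (atan (expR (- m * s)) * atan (expR (- l * t))).
  by rewrite ltr_ln // posrE mulr_gt0 ?pos.
by rewrite !lnM ?posrE ?pos //; lra.
Qed.

Definition prime_pow (sigma : R) (i : nat) : R := (nth_prime i.+1)%:R `^ (- sigma).

Definition prime_log (i : nat) : R := ln (nth_prime i.+1)%:R.

Definition prime_angle (sigma : R) (i : nat) : R := 2 * atan (prime_pow sigma i).

Lemma prime_log_gt0 i : 0 < prime_log i.
Proof. by rewrite ln_gt0 // ltr1n prime_gt1 // nth_prime_prime. Qed.

Lemma prime_log_incr i j : (i < j)%N -> prime_log i < prime_log j.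
Proof.
move=> ij; rewrite ltr_ln ?posrE ?ltr0n ?nth_prime_gt0 // ltr_nat.
exact: nth_prime_lt.
Qed.

Lemma prime_powE sigma i : prime_pow sigma i = expR (- prime_log i * sigma).
Proof. by rewrite /prime_pow powR_natE ?nth_prime_gt0 // mulrC mulrN mulNr mulrC. Qed.

Lemma prime_pow01 sigma i : 0 < sigma -> 0 < prime_pow sigma i < 1.
Proof.
move=> s0; rewrite prime_powE expR_gt0 /= -[X in _ < X](@expR0 R) ltr_expR.
by rewrite mulNr oppr_lt0 mulr_gt0 // prime_log_gt0.
Qed.

Lemma prime_pow_decr sigma i j : 0 < sigma -> (i < j)%N -> prime_pow sigma j < prime_pow sigma i.
Proof.
by move=> s0 ij; rewrite !prime_powE ltr_expR !mulNr ltrN2 ltr_pM2r // prime_log_incr.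
Qed.

Lemma prime_angle_gt0 sigma i : 0 < prime_angle sigma i.
Proof. by rewrite mulr_gt0 // atan_gt0 // prime_powE expR_gt0. Qed.

Lemma cvg_prime_angle sigma : 1 < sigma -> cvgn (series (prime_angle sigma)).
Proof.
move=> s1.
have cz := cvg_zeta_series s1.
have cz1 : cvgn (series (fun i : nat => 2 * i.+1%:R `^ (- sigma) : R)).
  apply: is_cvg_seriesZ; have := cz; rewrite -(is_cvg_series_restrict 1).
  rewrite (_ : series (fun i : nat => i.+1%:R `^ (- sigma)) =
    (fun n => \sum_(1 <= k < n) k%:R `^ (- sigma)) \o S); last first.
    by apply/funext => n; rewrite /series /= big_add1.
  move=> /cvg_ex [l hl]; apply/cvg_ex; exists l.
  exact: (cvg_comp _ _ (cvg_addnl 1) hl).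
apply: (series_le_cvg _ _ _ cz1) => i.
- exact/ltW/prime_angle_gt0.
- by rewrite mulr_ge0 // powR_ge0.
- rewrite ler_wpM2l //; apply: le_trans (atan_le _) _; first by rewrite powR_ge0.
  rewrite /prime_pow !powRN lef_pV2 ?posrE ?powR_gt0 ?ltr0n ?nth_prime_gt0 //.
  rewrite ge0_ler_powR ?nnegrE ?ler_nat ?nth_prime_ge //.
  by apply: ltW; apply: lt_trans s1.
Qed.

Lemma g_theta_prime_angle sigma : 1 < sigma ->
  g_theta sigma = 2 * prime_angle sigma 0 - limn (series (prime_angle sigma)).
Proof.
move=> s1; have cv := cvg_prime_angle s1.
rewrite /g_theta; set lim0 := limn (series _) in cv *.
have E : (fun N : nat => \sum_(2 <= n < N) theta sigma n : R) @ \oo -->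
   (lim0 - prime_angle sigma 0).
  rewrite -cvg_shiftS /=.
  have E1 : \forall N \near \oo, series (prime_angle sigma) N - prime_angle sigma 0
      = \sum_(2 <= n < N.+1) theta sigma n.
    near=> N; have N0 : (0 < N)%N by near: N; exact: nbhs_infty_gt.
    by rewrite /series /= big_ltn // addrAC subrr add0r [RHS]big_add1.
  apply: cvg_trans (near_eq_cvg E1) _.
  by apply: cvgB; [exact: cv | exact: cvg_cst].
rewrite (cvg_lim _ E) //.
rewrite /theta -/(prime_pow sigma 0) -/(prime_angle sigma 0); ring.
Unshelve. all: by end_near.
Qed.

Lemma series_split2 (f : nat -> R) (N : nat) : (2 <= N)%N ->
  series f N = f 0%N + f 1%N + \sum_(2 <= i < N) f i.
Proof.
move=> N2; rewrite /series /= big_ltn ?(leq_trans _ N2) //.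
by rewrite big_ltn // addrA.
Qed.

(** Sums the inequalities of [theta_ratio]; strictness survives the limit because
    the term of the second prime is kept. *)
Lemma first_angle_lt (sigma sigma_b : R) : 1 < sigma -> sigma < sigma_b ->
  g_theta sigma_b = 0 ->
  2 * prime_angle sigma 0 < limn (series (prime_angle sigma)).
Proof.
move=> s1 sb; have sb1 := lt_trans s1 sb.
rewrite g_theta_prime_angle // => /eqP; rewrite subr_eq0 => /eqP gb.
have c0 := cvg_prime_angle s1; have cb := cvg_prime_angle sb1.
set A := prime_angle sigma in c0 *; set B := prime_angle sigma_b in cb gb.
have A0 i : 0 < A i := prime_angle_gt0 _ _; have B0 i : 0 < B i := prime_angle_gt0 _ _.
have ratio i : (0 < i)%N -> B i * A 0%N < A i * B 0%N.
  move=> i0; rewrite /A /B /prime_angle !prime_powE mulrACA [X in _ < X]mulrACA.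
  rewrite ltr_pM2l ?mulr_gt0 //; apply: theta_ratio => //.
  - exact: prime_log_gt0.
  - exact: prime_log_incr.
  - by apply: lt_trans s1.
pose D := A 1%N * B 0%N - B 1%N * A 0%N.
have D0 : 0 < D by rewrite subr_gt0 ratio.
have part : \forall N \near \oo, series B N * A 0%N + D <= series A N * B 0%N.
  near=> N; have N2 : (2 <= N)%N by near: N; exact: nbhs_infty_ge.
  rewrite !series_split2 // !mulrDl.
  have : (\sum_(2 <= i < N) B i) * A 0%N <= (\sum_(2 <= i < N) A i) * B 0%N.
    rewrite !mulr_suml big_nat_cond [leRHS]big_nat_cond.
    by apply: ler_sum => i /andP[/andP[i2 _] _]; rewrite ltW // ratio // (ltn_trans _ i2).
  by rewrite /D [B 0%N * A 0%N]mulrC; lra.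
have lhs : (fun N => series B N * A 0%N + D) @ \oo --> (limn (series B) * A 0%N + D).
  apply: cvgD; last exact: cvg_cst.
  by apply: cvgM; [exact: cb | exact: cvg_cst].
have rhs : (fun N => series A N * B 0%N) @ \oo --> (limn (series A) * B 0%N).
  by apply: cvgM; [exact: c0 | exact: cvg_cst].
have : limn (series B) * A 0%N + D <= limn (series A) * B 0%N by exact: (ler_cvg_to lhs rhs part).
rewrite -gb => h; rewrite -(ltr_pM2r (B0 0%N)); lra.
Unshelve. all: by end_near.
Qed.

End ThetaMonotone.

(** * Characters and vertical translations *)

Section Characters.
Variable R : realType.
Local Notation C := (Cplx R).

Definition char_of (E : nat -> C) (n : nat) : C :=
  if n == 0%N then 0 else \prod_(0 <= p < n.+1 | prime p) E p ^+ logn p n.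

Lemma char_ofE (E : nat -> C) (n K : nat) : (0 < n)%N -> (n < K)%N ->
  char_of E n = \prod_(0 <= p < K | prime p) E p ^+ logn p n.
Proof.
move=> n0 nK; rewrite /char_of gtn_eqF // [RHS](big_cat_nat (n := n.+1)) //=.
rewrite [X in _ = _ * X]big_nat_cond [X in _ = _ * X]big1 ?mulr1 //.
move=> p /andP[/andP[np _] pp]; rewrite lognE pp n0 /=.
by case: ifP => // /(dvdn_leq n0); rewrite leqNgt np.
Qed.

Lemma char_of_cmult (E : nat -> C) : (forall p, prime p -> cabs (E p) = 1) ->
  cmult (char_of E).
Proof.
move=> E1; split=> //.
- by rewrite (@char_ofE _ 1 2) // big1 // => p _; rewrite logn1 expr0.
- move=> n n0; rewrite (char_ofE E n0 (ltnSn n)) cabs_prod big1 // => p pp.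
  by rewrite cabsX E1 // expr1n.
- move=> m n; case: m => [|m]; first by rewrite mul0n /char_of /= mul0r.
  case: n => [|n]; first by rewrite muln0 /char_of /= mulr0.
  set K := (m.+1 * n.+1).+1.
  rewrite (@char_ofE _ _ K) // (@char_ofE _ m.+1 K) // ?(@char_ofE _ n.+1 K) //.
  + by rewrite -big_split /=; apply: eq_bigr => p pp; rewrite lognM // exprD.
  + by rewrite ltnS leq_pmull.
  + by rewrite ltnS leq_pmulr.
Qed.

Lemma char_of_prime (E : nat -> C) p : prime p -> char_of E p = E p.
Proof.
move=> pp; rewrite (char_ofE E (prime_gt0 pp) (ltnSn p)).
rewrite big_mkcond (bigD1_seq p) ?iota_uniq ?mem_index_iota //= ?ltnSn //.
rewrite pp logn_prime // eqxx expr1 big1 ?mulr1 // => q qp.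
by case: ifP => // pq; rewrite logn_prime // (negbTE qp).
Qed.

(** The inverse of [nth_prime], shifted so that 2 has index 0. *)
Definition prime_index (p : nat) : nat := find (fun i => nth_prime i.+1 == p) (iota 0 p).

Lemma nth_primeK i : prime_index (nth_prime i.+1) = i.
Proof.
rewrite /prime_index; set P := fun _ => _; set p := nth_prime i.+1.
have ip : (i < p)%N := nth_prime_ge i.+1.
have hP : has P (iota 0 p) by apply/hasP; exists i; rewrite ?mem_iota //= /P.
have h := nth_find 0%N hP; move: hP; rewrite has_find size_iota => fp.
move: h; rewrite /P nth_iota // add0n => /eqP /nth_prime_inj [].
by [].
Qed.

Lemma char_of_nth (e : nat -> C) : (forall i, cabs (e i) = 1) ->
  exists a, cmult a /\ forall i, a (nth_prime i.+1) = e i.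
Proof.
move=> e1; exists (char_of (fun p => e (prime_index p))); split.
  by apply: char_of_cmult.
by move=> i; rewrite char_of_prime ?nth_prime_prime // nth_primeK.
Qed.

Definition one_coef (n : nat) : C := (n != 0%N)%:R.

(** The coefficients n^-it, extended by 0 at 0. *)
Definition twist (t : R) (n : nat) : C := one_coef n * dpow n (0 +i* t)%C.

Lemma one_coef_coef : coef one_coef.
Proof.
split; first by rewrite /one_coef eqxx.
by move=> n; rewrite /one_coef; case: (n != 0%N); rewrite ?cabs1 ?cabs0.
Qed.

Lemma dpow_imag_cis n (t : R) : dpow n (0 +i* t)%C = cis (- (t * ln n%:R)).
Proof.
rewrite /dpow; apply: complex_eqP; rewrite /= !mul0r !mulr0 ?subr0 ?oppr0 ?expR0 ?mul1r //;
by rewrite ?add0r ?addr0.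
Qed.

Lemma cabs_cis (y : R) : cabs (cis y) = 1.
Proof. by rewrite /= cos2Dsin2 sqrtr1. Qed.

Lemma twist_cmult t : cmult (twist t).
Proof.
split; rewrite /twist /one_coef.
- by rewrite eqxx mul0r.
- by rewrite mul1r dpow1.
- by move=> n n0; rewrite -lt0n n0 mul1r dpow_imag_cis cabs_cis.
- move=> m n; case: m => [|m]; first by rewrite mul0n eqxx !mul0r.
  case: n => [|n]; first by rewrite muln0 eqxx !mul0r mulr0.
  by rewrite !mul1r dpowM.
Qed.

Lemma dseries_twist k t (s : C) : dseries k (twist t) s = dseries k one_coef (s + (0 +i* t)%C).
Proof.
congr (limn (series _)); apply/funext => n; rewrite /dterm /twist dpowD; ring.
Qed.

Lemma dseries_twist_sqr k t (s : C) :
  dseries k (sqr_coef (twist t)) (2 * s) = dseries k one_coef (2 * (s + (0 +i* t)%C)).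
Proof.
congr (limn (series _)); apply/funext => n.
rewrite /dterm /sqr_coef /twist mulrDr dpowD (dpow_double n (0 +i* t)%C) exprMn.
have -> : one_coef n ^+ 2 = one_coef n.
  by rewrite /one_coef; case: (n != 0%N); rewrite ?expr1n ?expr0n.
by ring.
Qed.

Lemma dpow_mulrn n k (s : C) : dpow n (k%:R * s) = dpow n s ^+ k.
Proof. by rewrite /dpow -mulrA -mulrN cexpX. Qed.

Lemma twist_nat k (D : R) p : prime p -> twist (k%:R * D) p = dpow p (0 +i* D)%C ^+ k.
Proof.
move=> pp; rewrite /twist /one_coef -lt0n prime_gt0 // mul1r -dpow_mulrn.
congr (dpow p _); apply: complex_eqP; rewrite ?ReM ?ImM ?mulr0 /=.
  by rewrite -[k%:R](rmorph_nat (real_complex R)) /= ?mul0r ?mulr0 ?subr0.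
by rewrite -[k%:R in RHS](rmorph_nat (real_complex R)) /= ?mul0r ?mulr0 ?addr0.
Qed.

(** Replacing one prime factor of n costs at most eta, and n has fewer than n of them. *)
Lemma cmult_close (a b : nat -> C) (eta : R) (X : nat) : cmult a -> cmult b -> 0 <= eta ->
  (forall p, prime p -> (p < X)%N -> cabs (a p - b p) <= eta) ->
  forall n, (n < X)%N -> cabs (a n - b n) <= X%:R * eta.
Proof.
move=> [a0 a1 au aM] [b0 b1 bu bM] eta0 h.
suff H n : (n < X)%N -> cabs (a n - b n) <= n%:R * eta.
  move=> n nX; apply: le_trans (H n nX) _.
  by rewrite ler_wpM2r // ler_nat ltnW.
have [K] := ubnP n; elim: K n => // K IHK n nK nX.
case: n nK nX => [|[|n]] nK nX.
- by rewrite a0 b0 subrr cabs0 mul0r.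
- by rewrite a1 b1 subrr cabs0 mul1r.
set p := pdiv n.+2; have pp : prime p by exact: pdiv_prime.
have pn : (p %| n.+2)%N by exact: pdiv_dvd.
set m := (n.+2 %/ p)%N.
have E : n.+2 = (p * m)%N by rewrite mulnC divnK.
have m0 : (0 < m)%N by rewrite divn_gt0 ?prime_gt0 // dvdn_leq.
have p1 := prime_gt1 pp.
have mn : (m < n.+2)%N by rewrite E ltn_Pmull.
have le1 : (1 + m <= n.+2)%N by rewrite add1n.
rewrite {1 2}E aM bM.
have -> : a p * a m - b p * b m = (a p - b p) * a m + b p * (a m - b m) by ring.
apply: le_trans (cabsD _ _) _; rewrite !cabsM au // bu ?prime_gt0 // mulr1 mul1r.
apply: (@le_trans _ _ (eta + m%:R * eta)).
  apply: lerD; last by apply: IHK; [exact: leq_trans mn _ | exact: ltn_trans mn nX].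
  by apply: h => //; apply: leq_ltn_trans nX; exact: dvdn_leq.
by rewrite -[X in X + _]mul1r -mulrDl -(natrD _ 1) ler_wpM2r // ler_nat.
Qed.

Lemma cis_eq1 (y : R) : 0 <= y -> cis y = 1 -> exists k : nat, y = 2 * pi * k%:R.
Proof.
move=> y0 h.
have pp : 0 < 2 * pi :> R by rewrite mulr_gt0 // pi_gt0.
pose k := Num.truncn (y / (2 * pi)).
have /andP[k1 k2] : k%:R <= y / (2 * pi) < k.+1%:R.
  by apply: truncn_itv; rewrite divr_ge0 // ltW.
exists k; pose r := y - 2 * pi * k%:R.
have r0 : 0 <= r by rewrite subr_ge0 mulrC -ler_pdivlMr.
have r1 : r < 2 * pi.
  by move: k2; rewrite ltr_pdivrMr // -natr1 mulrDl mul1r /r; lra.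
have cr : cos r = 1.
  have <- : cos y = 1 by have := congr1 (fun z : C => complex.Re z) h.
  have -> : y = r + pi *+ 2 *+ k by rewrite /r; ring.
  by rewrite (periodicn (@cosD2pi R)).
have s0 : sin (r / 2) = 0.
  have : sin (r / 2) ^+ 2 = 0.
    have := cos_mulr2n (r / 2); have -> : (r / 2) *+ 2 = r by rewrite -mulr_natr divfK.
    by rewrite cr cos2sin2 mulr2n; lra.
  by move/eqP; rewrite sqrf_eq0 => /eqP.
have : ~~ (0 < r).
  apply/negP => rp; have : 0 < sin (r / 2).
    by apply: sin_gt0_pi; apply/andP; split; lra.
  by rewrite s0 ltxx.
by rewrite -leNgt /r; move: r0; rewrite /r; lra.
Qed.

(** Equality of a^-iD and b^-iD confines D to a countable set, which cannot fill an
    interval.  The bound D >= 1 later separates the zeros obtained. *)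
Lemma generic_step : exists D : R, 1 <= D <= 2 /\
  forall a b : nat, (0 < a)%N -> (0 < b)%N ->
    dpow a (0 +i* D)%C = dpow b (0 +i* D)%C -> a = b.
Proof.
pose F (q : nat * nat * nat) : R := 2 * pi * q.2%:R / (ln q.1.1%:R - ln q.1.2%:R).
have : ~ (`[1, 2]%classic `<=` range F).
  move=> sub.
  have cr : countable (range F) by apply: card_le_trans (card_image_le _ _) _; exact: countableP.
  have c12 : countable (`[1, 2]%classic : set R) by apply: card_le_trans cr; exact: subset_card_le.
  have := countable_lebesgue_measure0 c12.
  rewrite lebesgue_measure_itv /= lte_fin ltr1n -EFinB => -[] /eqP.
  by rewrite subr_eq0 (eqr_nat R 2 1).
move=> /existsNP [D /not_implyP [D12 nD]]; exists D; split.
  by move: D12; rewrite /= in_itv.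
have D0 : 0 < D by move: D12; rewrite /= in_itv /= => /andP[h _]; apply: lt_le_trans h.
suff H a b : (0 < a)%N -> (a < b)%N -> dpow a (0 +i* D)%C <> dpow b (0 +i* D)%C.
  move=> a b a0 b0 h; case: (ltngtP a b) => // ab; exfalso.
    exact: H h.
  by apply: (H b a) => //.
move=> a0 ab; rewrite !dpow_imag_cis => h; apply: nD.
have b0 : (0 < b)%N by apply: ltn_trans ab.
have L : 0 < ln (b%:R : R) - ln a%:R.
  by rewrite subr_gt0 ltr_ln ?posrE ?ltr0n // ltr_nat.
have [||k hk] := @cis_eq1 (D * (ln b%:R - ln a%:R)).
- by rewrite mulr_ge0 // ltW.
- have -> : D * (ln b%:R - ln a%:R) = - (D * ln a%:R) + D * ln b%:R by ring.
  by rewrite cisD h -cisD addNr cis0.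
- by exists (b, a, k) => //=; rewrite /F /= -hk mulfK // gt_eqF.
Qed.

Lemma prime_power_inj (X : nat) (f g : 'I_X -> nat) :
  (\prod_(j < X) nth_prime j.+1 ^ f j = \prod_(j < X) nth_prime j.+1 ^ g j)%N -> f =1 g.
Proof.
move=> h i.
have L (e : 'I_X -> nat) : logn (nth_prime i.+1) (\prod_(j < X) nth_prime j.+1 ^ e j) = e i.
  rewrite (bigD1 i) //= lognM ?expn_gt0 ?nth_prime_gt0 //; last first.
    by rewrite prodn_gt0 // => j; rewrite expn_gt0 nth_prime_gt0.
  rewrite lognX logn_prime ?nth_prime_prime // eqxx muln1.
  suff -> : logn (nth_prime i.+1) (\prod_(j < X | j != i) nth_prime j.+1 ^ e j) = 0%N.
    by rewrite addn0.
  elim/big_rec: _ => [|j x ji IH]; first exact: logn1.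
  have [->|x0] := posnP x; first by rewrite muln0 logn0.
  rewrite lognM ?expn_gt0 ?nth_prime_gt0 // IH lognX logn_prime ?nth_prime_prime //.
  rewrite (_ : (nth_prime i.+1 == nth_prime j.+1) = false) ?muln0 //.
  by apply/eqP => /nth_prime_inj [] /ord_inj E; rewrite E eqxx in ji.
by rewrite -(L f) -(L g) h.
Qed.

Lemma dpow_prod (X : nat) (D : R) (f : 'I_X -> nat) :
  \prod_(j < X) dpow (nth_prime j.+1) (0 +i* D)%C ^+ f j =
  dpow (\prod_(j < X) nth_prime j.+1 ^ f j)%N (0 +i* D)%C.
Proof.
have pos : forall j : 'I_X, (0 < nth_prime j.+1 ^ f j)%N.
  by move=> j; rewrite expn_gt0 nth_prime_gt0.
suff [_ ->] : (0 < \prod_(j < X) nth_prime j.+1 ^ f j)%N /\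
  dpow (\prod_(j < X) nth_prime j.+1 ^ f j)%N (0 +i* D)%C =
  \prod_(j < X) dpow (nth_prime j.+1) (0 +i* D)%C ^+ f j by [].
elim/big_rec2: _ => [|j y x _ [x0 IH]]; first by rewrite dpow1.
split; first by rewrite muln_gt0 pos.
rewrite dpowM ?pos // IH; congr (_ * _).
elim: (f j) => [|n IHn]; first by rewrite expn0 dpow1 expr0.
by rewrite expnS dpowM ?expn_gt0 ?nth_prime_gt0 // IHn exprS.
Qed.

(** The phases p^-iD are multiplicatively independent by unique factorization and
    the choice of D; [kronecker_density] then prescribes them at the first primes. *)
Theorem twists_approximate (a : nat -> C) (X : nat) (eta : R) : cmult a -> 0 < eta ->
  exists (D c : R) (good : pred nat), [/\ 1 <= D <= 2, 0 < c,
    \forall K \near \oo, c * K%:R <= (count good (iota 0 K))%:R &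
    forall k, good k -> forall n, (n < X)%N -> cabs (twist (k%:R * D) n - a n) <= eta].
Proof.
move=> am eta0; have [D [D12 Dg]] := generic_step.
pose u (j : 'I_X) : C := dpow (nth_prime j.+1) (0 +i* D)%C.
pose e (j : 'I_X) : C := a (nth_prime j.+1).
pose eta' := eta / (X%:R + 1).
have X1 : (0 : R) < X%:R + 1 by rewrite ltr_wpDl.
have eta'0 : 0 < eta' by rewrite divr_gt0.
have [c [c0 hc]] : exists c : R, 0 < c /\
    \forall K \near \oo, c * K%:R <= (count (close_to e u eta') (iota 0 K))%:R.
  apply: kronecker_density => //.
  - by move=> j; have [_ _ au _] := am; rewrite /e au // nth_prime_gt0.
  - by move=> j; rewrite /u dpow_imag_cis cabs_cis.
  - move=> f g; rewrite !dpow_prod => /Dg h; apply: prime_power_inj; apply: h.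
      by rewrite prodn_gt0 // => j; rewrite expn_gt0 nth_prime_gt0.
    by rewrite prodn_gt0 // => j; rewrite expn_gt0 nth_prime_gt0.
exists D, c, (close_to e u eta'); split=> // k /forallP hk n nX.
apply: (@le_trans _ _ (X%:R * eta')); last first.
  by rewrite /eta' mulrA ler_pdivrMr // [leLHS]mulrC ler_wpM2l ?(ltW eta0) // lerDl.
apply: cmult_close nX => //; [exact: twist_cmult | exact: ltW |].
move=> p pp pX.
have [i iX pE] := nth_prime_onto pp (leq_trans (ltnW pX) (nth_prime_ge X)).
rewrite twist_nat // pE; exact/ltW/(hk (Ordinal iX)).
Qed.

End Characters.

(** * The diagonal of the double zeta-function for Re s > 1 *)

Section Zeta2.
Variable R : realType.
Local Notation C := (Cplx R).

Lemma nbhs_cabs (z : C) (P : C -> Prop) :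
  (\forall w \near z, P w) -> exists e : R, 0 < e /\ forall w, cabs (w - z) < e -> P w.
Proof.
move=> /nbhs_normP [e /= e0 he].
have e0' : 0 < complex.Re e by move: e0; rewrite ltcE => /andP[].
exists (complex.Re e); split=> // w wz; apply: he => /=.
have -> : e = ((complex.Re e)%:C)%C.
  by move: e0; rewrite ltcE; case: (e) => a b /= /andP[/eqP -> _].
by rewrite normCE /= ltcR cabsB.
Qed.

Lemma zeta2_series_diag (s : C) : 1 < complex.Re s ->
  zeta2_series s s = 2^-1 * (dseries 0 (one_coef R) s ^+ 2 - dseries 0 (one_coef R) (2 * s)).
Proof.
move=> s1; have s2 : 1 < complex.Re (2 * s) by rewrite mulr_natl mulr2n ReD; lra.
have c1 := cvg_dseries (k := 0) (one_coef_coef R) s1.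
have c2 := cvg_dseries (k := 0) (one_coef_coef R) s2.
rewrite -(@iterated_pair_sum R (dterm 0 (one_coef R) s)).
- rewrite /zeta2_series; congr (limn (series _)); apply/funext => m.
  congr (limn (series _)); apply/funext => n.
  rewrite invfM !cpowV /dterm /one_coef addnS /= expr0 !mul1r.
  by [].
- by rewrite /dterm /one_coef eqxx !mul0r.
- exact: c1.
- rewrite (_ : (fun n => _) = dterm 0 (one_coef R) (2 * s)); first exact: c2.
  apply/funext => n; rewrite /dterm dpow_double !expr0 !mulr1 exprMn.
  by congr (_ * _); rewrite /one_coef; case: (n != 0%N); rewrite ?expr1n ?expr0n.
Qed.

Lemma dseries_bounded (sg : R) (a : nat -> C) (w : C) : coef a -> 1 < sg ->
  sg <= complex.Re w -> cabs (dseries 0 a w) <= log_sum 0 sg.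
Proof.
move=> ca s1 sw; have w1 := lt_le_trans s1 sw.
apply: (@cabs_series_le R (dterm 0 a w) (log_term 0 sg)) (cvg_dseries ca w1) => [n|].
  apply: le_trans (dterm_le 0 w n ca) _.
  rewrite /log_term !expr0 !mul1r; case: n => [|n].
    by rewrite !powR0 // oppr_eq0 gt_eqF // (lt_trans ltr01).
  by rewrite ler_powR ?ler1n // lerN2.
exact: cvg_log_series.
Qed.

(** Near a pole the function would be unbounded, whereas the series is
    locally bounded in the half-plane. *)
Lemma zeta2_diag_holomorphic (f : C -> C) (z : C) : is_zeta2_diag f ->
  1 < complex.Re z -> holomorphic_at f z.
Proof.
move=> [mer fE] z1; case: (mer z) => // -[k [h [hol hz hf]]]; exfalso.
have hcont : {for z, continuous h}.
  apply: differentiable_continuous; apply/derivable1_diffP.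
  exact: (nbhs_singleton hol).
pose sg := (1 + complex.Re z) / 2.
have sg1 : 1 < sg by rewrite /sg; lra.
pose M := log_sum 0 sg ^+ 2 + log_sum 0 sg.
have S0 := log_sum_ge0 0 sg1.
have M0 : 0 <= M by rewrite addr_ge0 // sqr_ge0.
have bnd w : cabs (w - z) < (complex.Re z - 1) / 2 -> cabs (f w) <= M.
  move=> wz; have sw : sg <= complex.Re w.
    have := cabs_Re (w - z); rewrite ReD ReN ler_norml => /andP[h1 _].
    by rewrite /sg; lra.
  rewrite fE; last exact: lt_le_trans sw.
  rewrite zeta2_series_diag; last exact: lt_le_trans sw.
  rewrite cabsM cabsV cabs_natr.
  have b1 := dseries_bounded (one_coef_coef R) sg1 sw.
  have b2 : cabs (dseries 0 (one_coef R) (2 * w)) <= log_sum 0 sg.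
    apply: dseries_bounded => //; first exact: one_coef_coef.
    by rewrite mulr_natl mulr2n ReD; lra.
  have b3 : cabs (dseries 0 (one_coef R) w ^+ 2) <= log_sum 0 sg ^+ 2.
    by rewrite cabsX lerXn2r ?nnegrE ?cabs_ge0.
  have b4 := cabsD (dseries 0 (one_coef R) w ^+ 2) (- dseries 0 (one_coef R) (2 * w)).
  rewrite cabsN in b4.
  apply: (@le_trans _ _ (1 * M)); last by rewrite mul1r.
  by rewrite ler_pM ?invr_ge0 ?cabs_ge0 // ?invf_le1 ?ler1n // /M; lra.
have hp : 0 < cabs (h z) by rewrite cabs_gt0.
have [e1 [e10 he1]] : exists e : R, 0 < e /\ forall w, cabs (w - z) < e -> cabs (h w - h z) < cabs (h z) / 2.
  apply: nbhs_cabs; move/cvgrPdist_lt: hcont => /(_ ((cabs (h z) / 2)%:C)%C).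
  rewrite ltcR divr_gt0 // => /(_ isT); apply: filterS => w.
  by rewrite normCE /= ltcR cabsB.
have [e2 [e20 he2]] := nbhs_cabs hf.
pose r := Num.min (Num.min (e1 / 2) (e2 / 2)) (Num.min (Num.min (2^-1) ((complex.Re z - 1) / 4)) (cabs (h z) / (4 * (M + 1)))).
have r0 : 0 < r.
  by rewrite !lt_min !divr_gt0 ?invr_gt0 //; lra.
have [re1 re2 r1 rz rM] : [/\ r <= e1 / 2, r <= e2 / 2, r <= 2^-1,
    r <= (complex.Re z - 1) / 4 & r <= cabs (h z) / (4 * (M + 1))].
  by split; rewrite /r !ge_min lexx ?orbT.
pose w : C := z + (r%:C)%C.
have wz : w - z = (r%:C)%C by rewrite /w addrC addKr.
have cwz : cabs (w - z) = r by rewrite wz cabs_real gtr0_norm.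
have wnz : w != z by rewrite -subr_eq0 -cabs_eq0 cwz gt_eqF.
have hw : cabs (h z) / 2 <= cabs (h w).
  have : cabs (h w - h z) < cabs (h z) / 2 by apply: he1; rewrite cwz; lra.
  have := cabsD (h w) (h z - h w); rewrite addrC subrK cabsB; lra.
have fw : f w = h w / (w - z) ^+ k.+1 by apply: he2 => //; rewrite cwz; lra.
have : cabs (f w) <= M by apply: bnd; rewrite cwz; lra.
rewrite fw cabsM cabsV cabsX cwz ler_pdivrMr ?exprn_gt0 // => q.
have rk : r ^+ k.+1 <= r.
  by rewrite exprS ler_piMr ?(ltW r0) // exprn_ile1 ?(ltW r0) //; lra.
have q2 : M * r ^+ k.+1 <= M * r by rewrite ler_wpM2l.
have q3 : r * (4 * (M + 1)) <= cabs (h z) by rewrite -ler_pdivlMr // mulr_gt0 //; lra.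
lra.
Qed.

End Zeta2.

(** * Counting the zeros *)

Section Counting.
Variable R : realType.
Local Notation C := (Cplx R).

Lemma balanced_character (sigma sigma_b : R) : 1 < sigma -> sigma < sigma_b ->
  g_theta sigma_b = 0 ->
  exists a : nat -> C, [/\ cmult a,
    dseries 0 a sigma%:C%C ^+ 2 = dseries 0 (sqr_coef a) (2 * sigma)%:C%C &
    dseries 0 a sigma%:C%C * dseries 1 a sigma%:C%C
      - dseries 1 (sqr_coef a) (2 * sigma)%:C%C != 0].
Proof.
move=> s1 sb gb; have s0 : 0 < sigma by apply: lt_trans s1.
have [z [zx zp zs]] := phase_choice (fun i => prime_pow01 i s0) (fun i j => prime_pow_decr s0)
  (@prime_log_gt0 R) (@prime_log_incr R) (cvg_prime_angle s1) (first_angle_lt s1 sb gb).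
have x0 i : 0 < prime_pow sigma i by have /andP[] := prime_pow01 i s0.
have e1 i : cabs (z i / (prime_pow sigma i)%:C%C) = 1.
  by rewrite cabsM cabsV zx cabs_real gtr0_norm // mulfV // gt_eqF.
have [a [am aE]] := char_of_nth e1.
have lvE : local_value a sigma%:C%C = z.
  apply/funext => i; rewrite /local_value aE.
  have -> : dpow (nth_prime i.+1) sigma%:C%C = (prime_pow sigma i)%:C%C :> C.
    rewrite /dpow prime_powE; apply: complex_eqP; rewrite /= !mulr0 ?mul0r ?addr0 ?subr0 oppr0.
      by rewrite cos0 mulr1 /prime_log mulNr [sigma * _]mulrC.
    by rewrite sin0 mulr0.
  by rewrite divfK // -cabs_eq0 cabs_real normr_eq0 gt_eqF.
have s1' : 1 < complex.Re (sigma%:C%C : C) := s1.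
have := @critical_point R a sigma%:C%C am s1'; rewrite lvE => /(_ zp).
have -> : 2 * sigma%:C%C = (2 * sigma)%:C%C :> C by rewrite rmorphM /= rmorph_nat.
move=> [ZZ hs]; exists a; split; [exact: am | exact: ZZ |].
have Z0 : dseries 0 a sigma%:C%C != 0 := dseries_neq0 am s1'.
have h := cvgM (cvg_cst ((dseries 0 a sigma%:C%C ^+ 2)^-1 : C)) hs.
suff /zs : slope_sum (@prime_log R) z @ \oo --> ((dseries 0 a sigma%:C%C ^+ 2)^-1 *
    (dseries 0 a sigma%:C%C * dseries 1 a sigma%:C%C
      - dseries 1 (sqr_coef a) (2 * sigma)%:C%C)).
  by rewrite mulf_eq0 negb_or => /andP[].
rewrite (_ : slope_sum _ _ = fun N => (dseries 0 a sigma%:C%C ^+ 2)^-1 *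
  (dseries 0 a sigma%:C%C ^+ 2 * slope_sum (@prime_log R) z N)); first exact: h.
by apply/funext => N; rewrite mulKf // expf_neq0.
Qed.

Lemma zero_order_ge1 (f : C -> C) (s : C) : f s = 0 -> (1 <= zero_order f s)%E.
Proof.
move=> fs; apply: ereal_sup_ubound; exists 1%N => //= k.
by rewrite ltnS leqn0 => /eqP ->.
Qed.

Lemma zero_count_ge (f : C -> C) (s1 s2 T : R) (zs : seq C) : uniq zs ->
  (forall s, s \in zs -> [/\ holomorphic_at f s, f s = 0,
     s1 < complex.Re s < s2 & 0 <= complex.Im s <= T]) ->
  ((size zs)%:R%:E <= zero_count f s1 s2 T)%E.
Proof.
move=> uz hz; apply: esum_ge; exists [set` zs].
  by split; [exact: finite_seq | move=> s /= /hz].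
rewrite -fsbig_seq // -sum1_size natr_sum -sumEFin big_seq [leRHS]big_seq.
by apply: lee_sum => s /hz [_ fs _ _]; exact: zero_order_ge1.
Qed.

Lemma limf_einf_gt0 (h : R -> \bar R) (c T0 : R) : 0 < c ->
  (forall T, T0 < T -> (c%:E <= h T)%E) -> (0 < limf_einf h (+oo_R)%R)%E.
Proof.
move=> c0 hc; rewrite /limf_einf lteNr oppe0.
apply: (@le_lt_trans _ _ (- c%:E)%E); last by rewrite lteNl oppe0 lte_fin.
apply: (@le_trans _ _ (ereal_sup ((\- h)%E @` [set T | T0 < T]))).
  apply: ereal_inf_lbound; exists [set T | T0 < T] => //.
  by exists T0; split; [exact: num_real | move=> x].
apply: ub_ereal_sup => _ [T /= TT <-].
by have := hc T TT; rewrite -leeN2.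
Qed.

End Counting.

Theorem theorem2 (R : realType) (zeta2_diag : Cplx R -> Cplx R)
    (zeta2_diagP : is_zeta2_diag zeta2_diag)
    (sigma_b : R) (sigma_b_gt1 : 1 < sigma_b) (sigma_bP : g_theta sigma_b = 0)
    (sigma0 : R) (sigma0_gt1 : 1 < sigma0) (sigma0_lt : sigma0 < sigma_b) :
  exists delta0 : R, 0 < delta0 /\
    forall delta : R, 0 < delta -> delta < delta0 ->
      (0 < limf_einf
             (fun T : R => (T^-1)%:E *
                zero_count zeta2_diag (sigma0 - delta) (sigma0 + delta) T)
             (+oo_R)%R)%E.
Proof.
have [a [am ZZ slope]] := balanced_character sigma0_gt1 sigma0_lt sigma_bP.
exists 1; split=> // delta d0 _.
(* keeps the zeros in Re s > 1 and makes those of different k distinct *)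
pose d := Num.min delta (Num.min (sigma0 - 1) (2^-1)).
have dp : 0 < d by rewrite !lt_min d0 subr_gt0 sigma0_gt1 invr_gt0 ltr0n.
have [d1 d2 d3] : [/\ d <= delta, d <= sigma0 - 1 & d <= 2^-1].
  by split; rewrite /d !ge_min lexx ?orbT.
have [X [eta [eta0 persist]]] := zero_persists am sigma0_gt1 ZZ slope dp.
have [D [c [good [/andP[D1 D2] c0 hc hgood]]]] := twists_approximate X am eta0.
have /choice [w hw] : forall k, exists w : Cplx R, good k -> cabs w < d /\
    dseries 0 (twist (k%:R * D)) (sigma0%:C%C + w) ^+ 2 =
    dseries 0 (sqr_coef (twist (k%:R * D))) (2 * (sigma0%:C%C + w)).
  move=> k; have [gk|] := boolP (good k); last by exists 0.
  by have [w hw] := persist _ (twist_cmult (k%:R * D)) (hgood k gk); exists w.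
pose s k : Cplx R := sigma0%:C%C + w k + (0 +i* (k%:R * D))%C.
have sRe k : complex.Re (s k) = sigma0 + complex.Re (w k) by rewrite !ReD /= addr0.
have sIm k : complex.Im (s k) = complex.Im (w k) + k%:R * D by rewrite !ImD /= add0r.
have wRe k : good k -> - d < complex.Re (w k) < d.
  by move=> /hw [wd _]; rewrite -ltr_norml; apply: le_lt_trans wd; exact: cabs_Re.
have wIm k : good k -> - d < complex.Im (w k) < d.
  by move=> /hw [wd _]; rewrite -ltr_norml; apply: le_lt_trans wd; exact: cabs_Im.
have s_gt1 k : good k -> 1 < complex.Re (s k).
  by move=> /wRe /andP[h _]; rewrite sRe; lra.
have fs k : good k -> zeta2_diag (s k) = 0.
  move=> gk; have [_ zE] := zeta2_diagP; rewrite zE ?s_gt1 // zeta2_series_diag ?s_gt1 //.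
  have [_] := hw k gk; rewrite dseries_twist dseries_twist_sqr -/(s k) => ->.
  by rewrite subrr mulr0.
(* the ordinates differ by at least D - 2 d in absolute value, and D >= 1 >= 2 d *)
have sinj k j : good k -> good j -> s k = s j -> k = j.
  move=> gk gj /(congr1 (fun z : Cplx R => complex.Im z)); rewrite !sIm => e.
  have /andP[k1 k2] := wIm k gk; have /andP[j1 j2] := wIm j gj.
  suff H (p q : nat) : (p < q)%N -> 1 <= (q%:R - p%:R) * D.
    case: (ltngtP k j) => [kj|jk|//].
      by exfalso; have := H _ _ kj; rewrite mulrBl; lra.
    by exfalso; have := H _ _ jk; rewrite mulrBl; lra.
  move=> pq; apply: (@le_trans _ _ (1 * 1)); first by rewrite mulr1.
  rewrite ler_pM //.
  by rewrite -(natrB _ (ltnW pq)) ler1n subn_gt0.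
case: hc => K0 _ hK.
apply: (@limf_einf_gt0 R _ (c / 4) (Num.max (4 + 4 / c) (2 * (K0%:R + 1)))).
  by rewrite divr_gt0.
move=> T; rewrite gt_max => /andP[T1 T2].
have cc : 0 < 4 / c by rewrite divr_gt0.
have T0 : 0 < T by lra.
(* D <= 2, so that the zeros with k < K have ordinate at most T *)
pose K := Num.truncn (T / 2).
have /andP[KT TK] : K%:R <= T / 2 < K.+1%:R.
  by apply: truncn_itv; rewrite divr_ge0 // ltW.
have KK0 : (K0 <= K)%N.
  rewrite -ltnS -(ltr_nat R); apply: lt_trans TK; lra.
have cnt := hK K KK0.
(* k = 0 is left out since its zero may lie below the real axis *)
pose ks := [seq k <- iota 0 K | good k & (0 < k)%N].
have size_ks : c * K%:R - 1 <= (size ks)%:R.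
  have : (count good (iota 0 K) <= size ks + 1)%N.
    rewrite size_filter; set b : pred nat := fun k => _.
    have h1 : (count good (iota 0 K) <= count (predU b (pred1 0%N)) (iota 0 K))%N.
      by apply: sub_count => -[|k] /= gk; rewrite ?orbT // /b gk.
    have h2 := count_predUI b (pred1 0%N) (iota 0 K).
    have h3 : (count (pred1 0%N) (iota 0 K) <= 1)%N.
      by rewrite (count_uniq_mem 0%N (iota_uniq 0 K)); case: (_ \in _).
    apply: leq_trans h1 _; apply: (@leq_trans (count b (iota 0 K)
      + count (pred1 0%N) (iota 0 K))); first by rewrite -h2 leq_addr.
    by rewrite leq_add2l.
  rewrite -(ler_nat R) natrD; lra.
have uz : uniq [seq s k | k <- ks].
  rewrite map_inj_in_uniq ?filter_uniq ?iota_uniq //.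
  by move=> k j; rewrite !mem_filter => /andP[/andP[gk _] _] /andP[/andP[gj _] _]; exact: sinj.
have zc := @zero_count_ge R zeta2_diag (sigma0 - delta) (sigma0 + delta) T _ uz.
rewrite size_map in zc.
have {zc} zc : ((size ks)%:R%:E <= zero_count zeta2_diag (sigma0 - delta) (sigma0 + delta) T)%E.
  apply: zc => x /mapP [k]; rewrite mem_filter mem_iota => /andP[/andP[gk k0] /andP[_ kK]] ->.
  have /andP[r1 r2] := wRe k gk; have /andP[i1 i2] := wIm k gk.
  have k1 : (1 : R) <= k%:R by rewrite ler1n.
  have kD1 : 1 * 1 <= k%:R * D by rewrite ler_pM.
  have kD2 : k%:R * D <= k%:R * 2 by rewrite ler_wpM2l.
  have kT : k%:R + 1 <= K%:R :> R by rewrite natr1 ler_nat.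
  split.
  - exact: zeta2_diag_holomorphic zeta2_diagP (s_gt1 k gk).
  - exact: fs.
  - by rewrite sRe; apply/andP; split; lra.
  - by rewrite sIm; apply/andP; split; lra.
have TV : (0%E <= (T^-1)%:E)%E by rewrite lee_fin invr_ge0 ltW.
apply: le_trans (lee_wpmul2l TV zc).
rewrite -EFinM lee_fin [leRHS]mulrC ler_pdivlMr //.
apply: le_trans size_ks.
have cT : 4 + 4 / c <= T by lra.
have h1 : c * (4 + 4 / c) <= c * T by rewrite ler_wpM2l // ltW.
have h2 : c * (4 + 4 / c) = 4 * c + 4 by field; rewrite gt_eqF.
have h3 : c * (T / 2) <= c * (K%:R + 1) by rewrite ler_wpM2l ?(ltW c0) // natr1 ltW.
rewrite h2 in h1; lra.
Qed.
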